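(* Let $\Omega\subset\mathbb R^2$ be a bounded open convex domain with nonempty interior. For every $N\ge1$, the set $\mathcal G_N^{\mathrm{univ}}(\Omega)$ is permutation-invariant, residual, and of full Lebesgue measure in $\mathrm{Conf}_N(\Omega)$. If $P\in\mathcal G_N^{\mathrm{univ}}(\Omega)$ and $P\subset\Delta^\circ$ for some $\Delta\in\mathscr P_{\mathbb Q}(\Omega)$, then $P$ is strongly generic for the relaxation on $\Delta$.
   Context: For an open set $U\subset\mathbb R^2$, $\mathrm{Conf}_N(U)=\{(p_1,\dots,p_N)\in U^N:p_i\ne p_j\text{ for }i\ne j\}$. Full Lebesgue measure means that the complement in $\mathrm{Conf}_N(\Omega)$ is Lebesgue null; residual means containing a countable intersection of open dense subsets. Relaxation on a polygon. Let $\Delta$ be a compact convex polygon with nonempty interior $\Delta^\circ$ and sides of rational direction. A $\Delta$-tropical series is a continuous function $F:\Delta\to\mathbb R_{\ge0}$ with $F=0$ on $\partial\Delta$ which near every point of $\Delta^\circ$ has the form $F(x)=\min_{m\in A}(c_m+\langle m,x\rangle)$ with $A\subset\mathbb Z^2$ finite and $c_m\in\mathbb R$; it is concave. Its corner locus $V(F)\subset\Delta^\circ$ is the set of points where the minimum is attained by at least two distinct affine functions. For nonempty finite $P\subset\Delta^\circ$, the relaxation $F_{\Delta,P}$ is the pointwise infimum of all $\Delta$-tropical series $G$ with $P\subset V(G)$; it is itself such a series. Strong genericity. The linearity cells of $F_{\Delta,P}$ are the closures of the maximal connected open subsets of $\Delta^\circ$ on which it is affine; each has a gradient in $\mathbb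 Z^2$. $V(F_{\Delta,P})$ is a finite embedded polyhedral graph, whose vertices are the points of $\Delta^\circ$ where the superdifferential of $F_{\Delta,P}$ is two-dimensional and whose edges are the straight segments into which the vertices divide it; an edge separating cells of gradients $m_0,m_1$ has weight $w\ge1$ where $m_1-m_0=wn$ with $n\in\mathbb Z^2$ primitive. The gradient-labelled marked type of $P=(p_1,\dots,p_N)$ consists of the embedded face poset of this subdivision of $\Delta$ (cells, edges, vertices, incidences, cyclic orders), the gradient of each two-dimensional cell, all edge weights, all incidences with the sides and vertices of $\Delta$, and for each $i$ the face containing $p_i$ in its relative interior. $P\in\mathrm{Conf}_N(\Delta^\circ)$ is strongly generic for the relaxation on $\Delta$ if (i) every $p_i$ lies in the relative interior of an edge of $V(F_{\Delta,P})$; (ii) distinct $p_i$ lie on distinct edges; (iii) the gradient-labelled marked type is unchanged under all sufficiently small independent perturbations of the points $p_i$. Let $\mathcal G_N(\Delta)\subset\mathrm{Conf}_N(\Delta^\circ)$ be the set of strongly generic configurations. Universal genericity. $\mathscr P_{\mathbb Q}(\Omega)$ is the (countable) family of compact convex polygons $\Delta\subset\Omega$ with nonempty interior and all vertices in $\mathbb Q^2$. For $\Delta\in\mathscr P_{\mathbb Q}(\Omega)$ put $$\widehat{\mathcal G}_N(\Delta)=\mathcal G_N(\Delta)\cup\{(p_1,\dots,p_N)\in\mathrm{Conf}_N(\Omega):p_i\notin\Delta\text{ for some }i\},$$ and $\mathcal G_N^{\mathrm{univ}}(\Omega)=\bigcap_{\Delta\in\mathscr P_{\mathbb Q}(\Omega)}\widehat{\mathcal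 G}_N(\Delta)$. *)

(* Defs.v *)
From HB Require Import structures.
From mathcomp Require Import all_boot all_order all_algebra all_fingroup.
From mathcomp Require Import all_classical all_reals all_analysis.

Set Implicit Arguments.
Unset Strict Implicit.
Unset Printing Implicit Defensive.

Import Order.TTheory GRing.Theory Num.Theory.
Import numFieldTopology.Exports numFieldNormedType.Exports.

Local Open Scope classical_set_scope.
Local Open Scope ring_scope.

(* A configuration of N points of the plane is an N x 2 real matrix whose
   rows are the points, so that configurations carry the product topology. *)
Notation plane R := 'rV[R]_2.
Notation lattice := 'rV[int]_2.
Notation config R N := 'M[R]_(N, 2).

Section PlaneGeometry.
Variable R : realType.
Implicit Types (u x y v : plane R) (D S : set (plane R)).

Definition dot u x : R := \sum_(j < 2) u 0 j * x 0 j.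

Definition zdot (m : lattice) x : R := dot (map_mx intr m) x.

Definition polar (r t : R) : plane R :=
  \row_(j < 2) (if j == 0 then r * cos t else r * sin t).

(* a, b, c are nonzero and their directions are distinct and occur in this
   cyclic order when turning counterclockwise. *)
Definition ccw (a b c : plane R) : Prop :=
  exists r1 r2 r3 t1 t2 t3 : R,
    [/\ 0 < r1, 0 < r2 & 0 < r3] /\
    [/\ t1 < t2, t2 < t3 & t3 < t1 + 2 * pi] /\
    [/\ a = polar r1 t1, b = polar r2 t2 & c = polar r3 t3].

Definition polygon D : Prop :=
  exists (n : nat) (p : 'I_n -> plane R),
    D = [set x | exists t : 'I_n -> R,
           [/\ forall i, 0 <= t i, \sum_i t i = 1 & x = \sum_i t i *: p i]].

Definition polygon_vertex D v : Prop :=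
  D v /\ forall x y (t : R), D x -> D y -> 0 < t < 1 ->
    v = t *: x + (1 - t) *: y -> x = y.

Definition polygon_side D S : Prop :=
  exists u, [/\ u != 0,
    S = [set x | D x /\ forall y, D y -> dot u y <= dot u x] &
    exists x y, [/\ S x, S y & x != y]].

(* The vertices and the relatively open sides of D. *)
Definition boundary_face D : set (set (plane R)) :=
  [set B | (exists2 v, polygon_vertex D v & B = [set v]) \/
           (exists2 S, polygon_side D S & B = S `\` polygon_vertex D)].

Definition two_dimensional (A : set (plane R)) : Prop :=
  exists u v w, [/\ A u, A v, A w & row_free (col_mx (v - u) (w - u))].

Definition rational_polygon_in (Omega : set (plane R)) : set (set (plane R)) :=
  [set D | [/\ polygon D, D° !=set0, D `<=` Omega &
     forall v, polygon_vertex D v -> forall j, exists q : rat, v 0 j = ratr q]].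

End PlaneGeometry.

(* Functions on D are total functions whose values outside of D are
   irrelevant. *)
Section TropicalSeries.
Variable R : realType.
Implicit Types (D S U e : set (plane R)) (F G : plane R -> R) (x y : plane R).

(* The minimum over the nonempty finite set m0 :: s. *)
Definition tropical_poly (m0 : lattice) (s : seq lattice) (c : lattice -> R)
    x : R :=
  \big[Num.min/c m0 + zdot m0 x]_(m <- s) (c m + zdot m x).

Definition tropical_series D F : Prop :=
  [/\ {within D, continuous F},
      forall x, D x -> 0 <= F x,
      forall x, (D `\` D°) x -> F x = 0 &
      forall x, D° x -> exists m0 s c,
        \forall y \near x, F y = tropical_poly m0 s c y].

(* Two distinct slopes attaining the minimum at x make F nondifferentiable at x,
   so this does not depend on the chosen local representation. *)
Definition corner_locus D F : set (plane R) :=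
  [set x | D° x /\ exists m0 s c,
     (\forall y \near x, F y = tropical_poly m0 s c y) /\
     exists m m', [/\ m \in m0 :: s, m' \in m0 :: s, m != m',
       F x = c m + zdot m x & F x = c m' + zdot m' x]].

Definition relaxation D S : plane R -> R := fun x =>
  inf [set G x | G in [set G | tropical_series D G /\ S `<=` corner_locus D G]].

Definition affine_on U F : Prop :=
  exists u (c : R), forall x, U x -> F x = c + dot u x.

Definition has_gradient F U (m : lattice) : Prop :=
  exists c : R, forall x, U x -> F x = c + zdot m x.

(* The interiors of the linearity cells. *)
Definition linearity_region D F : set (set (plane R)) :=
  [set U | [/\ open U, connected U, U !=set0, U `<=` D° & affine_on U F] /\
     forall V, open V -> connected V -> V `<=` D° -> affine_on V F ->
       U `<=` V -> V = U].

Definition superdifferential D F x : set (plane R) :=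
  [set u | forall y, D y -> F y <= F x + dot u (y - x)].

Definition corner_vertex D F : set (plane R) :=
  [set x | D° x /\ two_dimensional (superdifferential D F x)].

(* The relative interiors of the edges. *)
Definition open_edge D F : set (set (plane R)) :=
  [set e | exists2 x, (corner_locus D F `\` corner_vertex D F) x &
     e = connected_component (corner_locus D F `\` corner_vertex D F) x].

Definition primitive (n : lattice) : bool := coprimez (n 0 0) (n 0 1).

Definition edge_weight D F e (w : nat) : Prop :=
  exists U0 U1 m0 m1 n,
    [/\ linearity_region D F U0, linearity_region D F U1, U0 <> U1,
        e `<=` closure U0 & e `<=` closure U1] /\
    [/\ has_gradient F U0 m0, has_gradient F U1 m1, primitive n,
        (0 < w)%N & m1 - m0 = n *+ w].

(* Faces are represented by their relative interiors, which partition the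
   interior of D. *)
Definition face D F (d : nat) : set (set (plane R)) :=
  match d with
  | 0 => [set [set v] | v in corner_vertex D F]
  | 1 => open_edge D F
  | 2 => linearity_region D F
  | _ => set0
  end.

Definition stratum D F : set (set (plane R)) :=
  [set X | (exists d, face D F d X) \/ boundary_face D X].

Definition low_stratum D F : set (set (plane R)) :=
  [set X | [\/ face D F 0 X, face D F 1 X | boundary_face D X]].

Definition direction_at (v : plane R) (X : set (plane R)) (a : plane R) : Prop :=
  \forall t \near 0^'+, X (v + t *: a).

(* X, Y, Z are met in this cyclic order when turning around the point v. *)
Definition cyclic_at (v : plane R) (X Y Z : set (plane R)) : Prop :=
  [/\ X <> Y, Y <> Z & Z <> X] /\
  exists a b c,
    [/\ direction_at v X a, direction_at v Y b, direction_at v Z c & ccw a b c].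

(* X, Y, Z are met in this cyclic order along the boundary of the cell U,
   as seen from a point of the cell. *)
Definition cyclic_along U (X Y Z : set (plane R)) : Prop :=
  [/\ X <> Y, Y <> Z & Z <> X] /\
  exists o a b c, [/\ U o, (X `&` closure U) a, (Y `&` closure U) b,
    (Z `&` closure U) c & ccw (a - o) (b - o) (c - o)].

End TropicalSeries.

Section Genericity.
Variables (R : realType) (N : nat).
Implicit Types (D U : set (plane R)) (P Q : config R N).

Definition points P : set (plane R) := [set row i P | i in setT].

Definition Conf U : set (config R N) :=
  [set P | (forall i, U (row i P)) /\
           (forall i j, i != j -> row i P <> row j P)].

(* The structure recorded by the gradient-labelled marked type: [phi] is an
   isomorphism between the subdivisions of D given by F and F', marked by P
   and Q. It is the identity on the sides and vertices of D. *)
Record type_iso D (F : plane R -> R) P (F' : plane R -> R) Q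
    (phi : set (plane R) -> set (plane R)) : Prop := TypeIso {
  iso_bij : forall d, set_bij (face D F d) (face D F' d) phi;
  iso_boundary : forall B, boundary_face D B -> phi B = B;
  iso_incidence : forall d d' X Y, face D F d X -> face D F d' Y ->
    (X `<=` closure Y <-> phi X `<=` closure (phi Y));
  iso_boundary_incidence : forall d X B, face D F d X -> boundary_face D B ->
    (B `&` closure X !=set0 <-> B `&` closure (phi X) !=set0);
  iso_cyclic_at : forall v v' X Y Z, stratum D F [set v] ->
    phi [set v] = [set v'] ->
    stratum D F X -> stratum D F Y -> stratum D F Z ->
    (cyclic_at v X Y Z <-> cyclic_at v' (phi X) (phi Y) (phi Z));
  iso_cyclic_along : forall U X Y Z, face D F 2 U ->
    low_stratum D F X -> low_stratum D F Y -> low_stratum D F Z ->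
    (cyclic_along U X Y Z <-> cyclic_along (phi U) (phi X) (phi Y) (phi Z));
  iso_gradient : forall U m, face D F 2 U ->
    (has_gradient F U m <-> has_gradient F' (phi U) m);
  iso_weight : forall e w, face D F 1 e ->
    (edge_weight D F e w <-> edge_weight D F' (phi e) w);
  iso_mark : forall i d X, face D F d X -> (X (row i P) <-> phi X (row i Q))
}.

Definition same_type D P Q : Prop :=
  exists phi, type_iso D (relaxation D (points P)) P
                         (relaxation D (points Q)) Q phi.

Definition strongly_generic D : set (config R N) :=
  [set P | [/\ Conf D° P,
    forall i, exists2 e, face D (relaxation D (points P)) 1 e & e (row i P),
    forall i j e, i != j -> face D (relaxation D (points P)) 1 e ->
      e (row i P) -> ~ e (row j P) &
    \forall Q \near P, same_type D P Q]].

Definition generic_hat (Omega : set (plane R)) D : set (config R N) :=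
  strongly_generic D `|`
  [set P | Conf Omega P /\ exists i, ~ D (row i P)].

Definition universally_generic (Omega : set (plane R)) : set (config R N) :=
  \bigcap_(D in rational_polygon_in Omega) generic_hat Omega D.

Definition permutation_invariant (A : set (config R N)) : Prop :=
  forall (s : 'S_N) P, A P -> A (row_perm s P).

End Genericity.

(* A is a subset of X containing a countable intersection of relatively open,
   dense subsets U k `&` X of X. *)
Definition residual_in (T : topologicalType) (X A : set T) : Prop :=
  A `<=` X /\
  exists U : nat -> set T,
    (forall k, open (U k) /\ X `<=` closure (U k `&` X)) /\
    \bigcap_k (U k `&` X) `<=` A.

(* Lebesgue outer measure on R^(m * n), by covers with countably many boxes;
   a Lebesgue null set is a set of outer measure 0. *)
Section LebesgueNull.
Variables (R : realType) (m n : nat).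
Implicit Types (a b : 'M[R]_(m, n)) (A : set 'M[R]_(m, n)).

Definition box a b : set 'M[R]_(m, n) :=
  [set M | forall i j, a i j <= M i j <= b i j].

Definition box_volume a b : R := \prod_i \prod_j (b i j - a i j).

Definition lebesgue_outer A : \bar R :=
  ereal_inf [set s | exists a b : nat -> 'M[R]_(m, n),
    [/\ forall k i j, a k i j <= b k i j,
        A `<=` \bigcup_k box (a k) (b k) &
        s = (\sum_(k <oo) (box_volume (a k) (b k))%:E)%E]].

Definition full_measure_in (X A : set 'M[R]_(m, n)) : Prop :=
  lebesgue_outer (X `\` A) = 0%E.

End LebesgueNull.

(* Main.v *)
Require Import Defs.
From mathcomp Require Import all_boot all_order all_algebra all_fingroup.
From mathcomp Require Import all_classical all_reals all_analysis.
From mathcomp Require Import ring lra zify.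
Import Order.TTheory GRing.Theory Num.Theory.
Import numFieldTopology.Exports numFieldNormedType.Exports.
Local Open Scope classical_set_scope.
Local Open Scope ring_scope.
Set Implicit Arguments.
Unset Strict Implicit.
Unset Printing Implicit Defensive.

(* The relaxation at P equals F_c = min_m (c_m + <m, .>), m ranging over a fixed
   finite set A of slopes, where c is the coefficientwise least admissible vector:
   the c_m + <m, .> are nonnegative on the polygon, F_c vanishes on its boundary,
   and at least two slopes are tied at every point of P. Call P generic if its
   coordinates satisfy no nontrivial affine relation with integer coefficients;
   this excludes countably many hyperplanes.
   Let P be generic. Minimality of c means that no nonempty set C of slopes whose
   functions are positive on the polygon can be lowered simultaneously, so at some
   p_i exactly one slope of C is tied. Removing that slope and iterating,
   each free coefficient becomes a rational affine function of the points, exactly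
   two slopes are tied at each p_i, the free coefficients are rationally
   independent modulo Q, and solving the same equations at Q near P yields
   coefficients c(Q), continuous in Q, which are again the minimal ones.
   By independence, a small change of the free coefficients tied at a point can be
   undone by a small translation of that point; with compactness of the polygon,
   F_c and F_c(Q) have the same tie sets. The faces are the level sets of the tie
   set, and their incidences, cyclic orders and labels are read off from the tie
   sets, so P and Q have the same type. *)

(** A competitor in the relaxation may have infinitely many slopes. Its minimum with [barrier],
    which has corners at the same points and is at most [N] times each [af s], is a function below
    it whose supergradients at interior points lie in a fixed finite set. This is the origin of [A]
    and of the factor [N], one truncated copy of the distance to the boundary per point. Vanishing
    on the boundary then becomes the inequality [c (s.1 *+ N) <= N%:R * s.2]. An affine function of
    the family that vanishes somewhere on the polygon vanishes at a rational vertex, so its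
    coefficient is rational and does not move; only the other, free, coefficients are deformed. The
    obstacle is stability away from the points of [P], where any number of cells may meet. An
    integer affine dependency among the slopes tied there is an integer relation among their
    coefficients, and independence leaves it supported on fixed slopes; so degenerate ties survive
    the deformation. *)

Section Dot.
Variable R : realType.
Implicit Types (u v w x y : plane R) (m k : lattice) (t : R).

Lemma dotE u x : dot u x = u 0 0 * x 0 0 + u 0 1 * x 0 1.
Proof.
rewrite /dot !big_ord_recl big_ord0 addr0.
by have -> : lift ord0 ord0 = 1 :> 'I_2 by apply/val_inj.
Qed.

Lemma ord2P (j : 'I_2) : j = 0 \/ j = 1.
Proof. by case: j => [[|[|//]] ?]; [left|right]; apply/val_inj. Qed.

Lemma plane_eq (T : Type) (x y : 'rV[T]_2) : x 0 0 = y 0 0 -> x 0 1 = y 0 1 -> x = y.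
Proof. by move=> e0 e1; apply/rowP=> j; case: (ord2P j) => ->. Qed.

Lemma dotDr u x y : dot u (x + y) = dot u x + dot u y.
Proof. by rewrite !dotE !mxE; ring. Qed.
Lemma dotBr u x y : dot u (x - y) = dot u x - dot u y.
Proof. by rewrite !dotE !mxE; ring. Qed.
Lemma dotZr u t x : dot u (t *: x) = t * dot u x.
Proof. by rewrite !dotE !mxE; ring. Qed.
Lemma dotZl u t x : dot (t *: u) x = t * dot u x.
Proof. by rewrite !dotE !mxE; ring. Qed.
Lemma dotDl u v x : dot (u + v) x = dot u x + dot v x.
Proof. by rewrite !dotE !mxE; ring. Qed.
Lemma dotC u x : dot u x = dot x u.
Proof. by rewrite !dotE; ring. Qed.
Lemma dotNr u x : dot u (- x) = - dot u x.
Proof. by rewrite !dotE !mxE; ring. Qed.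
Lemma dotNl u x : dot (- u) x = - dot u x.
Proof. by rewrite !dotE !mxE; ring. Qed.
Lemma dot0l x : dot 0 x = 0.
Proof. by rewrite !dotE !mxE; ring. Qed.
Lemma dot0r u : dot u 0 = 0.
Proof. by rewrite !dotE !mxE; ring. Qed.
Lemma dot_gt0 u : u != 0 -> 0 < dot u u.
Proof.
move=> u0; rewrite dotE -!expr2 lt_neqAle addr_ge0 ?sqr_ge0 // andbT eq_sym.
rewrite paddr_eq0 ?sqr_ge0 // !sqrf_eq0; apply: contra u0 => /andP[/eqP e0 /eqP e1].
by apply/eqP/plane_eq; rewrite mxE.
Qed.

Definition rot u : plane R := \row_j (if j == 0 then - u 0 1 else u 0 0).

Lemma dot_rot u : dot u (rot u) = 0.
Proof. by rewrite dotE !mxE /=; ring. Qed.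
Lemma rot_neq0 u : u != 0 -> rot u != 0.
Proof.
apply: contraNneq => a0; apply/eqP/plane_eq.
  by have := congr1 (fun v : plane R => v 0 1) a0; rewrite !mxE.
by have := congr1 (fun v : plane R => v 0 0) a0; rewrite !mxE /= => /eqP; rewrite oppr_eq0 => /eqP.
Qed.

Lemma zdotE m x : zdot m x = (m 0 0)%:~R * x 0 0 + (m 0 1)%:~R * x 0 1.
Proof. by rewrite /zdot dotE !mxE. Qed.
Lemma zdotDr m x y : zdot m (x + y) = zdot m x + zdot m y.
Proof. exact: dotDr. Qed.
Lemma zdotBr m x y : zdot m (x - y) = zdot m x - zdot m y.
Proof. exact: dotBr. Qed.
Lemma zdotZr m t x : zdot m (t *: x) = t * zdot m x.
Proof. exact: dotZr. Qed.
Lemma zdotNr m x : zdot m (- x) = - zdot m x.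
Proof. exact: dotNr. Qed.
Lemma zdotDl m k x : zdot (m + k) x = zdot m x + zdot k x.
Proof. by rewrite !zdotE !mxE !intrD; ring. Qed.
Lemma zdotBl m k x : zdot (m - k) x = zdot m x - zdot k x.
Proof. by rewrite !zdotE !mxE !intrD !rmorphN /=; ring. Qed.
Lemma zdot0l x : zdot 0 x = 0.
Proof. by rewrite !zdotE !mxE !mul0r addr0. Qed.
Lemma zdotMn m n x : zdot (m *+ n) x = n%:R * zdot m x.
Proof.
elim: n => [|n IH]; first by rewrite mulr0n zdot0l mul0r.
by rewrite mulrS zdotDl IH -natr1; ring.
Qed.

Lemma map_mx_intr_eq0 m : (map_mx intr m == 0 :> plane R) = (m == 0).
Proof.
apply/eqP/eqP => [e|->]; last by apply/plane_eq; rewrite !mxE.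
by apply/plane_eq; apply/(@intr_inj R); move: (congr1 (fun x : plane R => x 0 0) e)
  (congr1 (fun x : plane R => x 0 1) e); rewrite !mxE.
Qed.

Lemma continuous_dot u : continuous (dot u).
Proof.
move=> x; rewrite (_ : dot u = fun x => u 0 0 * x 0 0 + u 0 1 * x 0 1); last first.
  by apply/funext => y; rewrite dotE.
apply: (@cvgD _ _ _ (nbhs x)).
  by apply: (@cvgM _ _ (nbhs x)); [exact: cvg_cst|exact: coord_continuous].
by apply: (@cvgM _ _ (nbhs x)); [exact: cvg_cst|exact: coord_continuous].
Qed.

Definition lf (c : lattice -> R) m x := c m + zdot m x.

Lemma continuous_lf c m : continuous (lf c m).
Proof. by move=> x; apply: (@cvgD _ _ _ (nbhs x)); [exact: cvg_cst|exact: continuous_dot]. Qed.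

Lemma lf_mix c m x y t : lf c m (x + t *: (y - x)) = (1 - t) * lf c m x + t * lf c m y.
Proof. by rewrite /lf zdotDr zdotZr zdotBr; ring. Qed.
End Dot.

Lemma seq_argmax (R : realDomainType) (T : eqType) (s : seq T) (f : T -> R) (x0 : T) :
  x0 \in s -> exists2 x, x \in s & forall y, y \in s -> f y <= f x.
Proof.
elim: s x0 => // a s IH x0 _; case: s IH => [_|b s IH].
  by exists a; rewrite ?mem_head// => y; rewrite inE => /eqP ->.
have [x xs xm] := IH b (mem_head _ _).
have [le|lt] := leP (f a) (f x).
  by exists x; [rewrite inE xs orbT|move=> y; rewrite inE => /predU1P[->|/xm]].
exists a; first exact: mem_head.
by move=> y; rewrite inE => /predU1P[->|/xm /le_trans]; last apply; rewrite // ltW.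
Qed.

Lemma seq_argmin (R : realDomainType) (T : eqType) (s : seq T) (f : T -> R) (x0 : T) :
  x0 \in s -> exists2 x, x \in s & forall y, y \in s -> f x <= f y.
Proof.
by move=> /(@seq_argmax R _ s (fun x => - f x))[x xs xm]; exists x => // y /xm; rewrite lerN2.
Qed.

Lemma near_line (R : realType) m n (x a : 'M[R]_(m, n)) (A : set 'M[R]_(m, n)) :
  nbhs x A -> \forall t \near (0 : R), A (x + t *: a).
Proof.
move=> xA; have : (fun t : R => x + t *: a) t @[t --> 0] --> x.
  rewrite -[X in _ --> X]addr0 -(scale0r a).
  by apply: (@cvgD _ _ _ (nbhs (0:R))); [exact: cvg_cst|apply: cvgZr_tmp; exact: cvg_id].
by move=> /(_ _ xA).
Qed.

Lemma near_dir (R : realType) m n (x a : 'M[R]_(m, n)) (A : set 'M[R]_(m, n)) :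
  nbhs x A -> \forall t \near (0 : R)^'+, A (x + t *: a).
Proof. by move=> /(near_line a); exact: cvg_at_right_filter. Qed.

Lemma continuous_sum (K : numFieldType) (T : topologicalType) (V : normedModType K)
    (I : Type) (r : seq I) (f : I -> T -> V) :
  (forall i, continuous (f i)) -> continuous (fun x => \sum_(i <- r) f i x).
Proof.
by move=> fc; apply: (@continuous_big V I +%R 0 predT) => //; exact: add_continuous.
Qed.

(** * Convex hulls and rational polygons *)

Section Hull.
Variables (R : realType) (n : nat) (p : 'I_n -> plane R).

(** Weights are indexed by the whole family and vanish off [J], so discarding points only shrinks
    [J]. *)
Definition hull (J : {set 'I_n}) : set (plane R) :=
  [set x | exists t : 'I_n -> R, [/\ forall i, 0 <= t i, forall i, i \notin J -> t i = 0,
           \sum_i t i = 1 & x = \sum_i t i *: p i]].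

Lemma hull_point (J : {set 'I_n}) j : j \in J -> hull J (p j).
Proof.
move=> jJ; exists (fun i => (i == j)%:R); split.
- by move=> i; rewrite ler0n.
- by move=> i iJ; case: eqP => // e; rewrite e jJ in iJ.
- by rewrite (bigD1 j)//= eqxx big1 ?addr0// => i /negPf ->.
- by rewrite (bigD1 j)//= eqxx scale1r big1 ?addr0// => i /negPf ->; rewrite scale0r.
Qed.

(** Some weight is positive. If it is below 1, the vertex is a proper convex combination of [p i]
    and the renormalised remaining sum, and extremality makes these two equal; if it is 1, nothing
    else contributes. *)
Lemma hull_vertex J v : polygon_vertex (hull J) v -> exists i, v = p i.
Proof.
move=> [[t [t0 tJ t1 vE]] vext].
have [i ti] : exists i, 0 < t i.
  apply: contrapT => /forallNP t0'.
  move: t1; rewrite big1 => [/eqP|i _]; first by rewrite eq_sym oner_eq0.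
  by apply/eqP; rewrite eq_le t0 andbT leNgt; apply/negP.
exists i.
have tiJ : i \in J by apply: contraT => /tJ ti0; move: ti; rewrite ti0 ltxx.
have si : t i + \sum_(j | j != i) t j = 1 by rewrite -t1 [RHS](bigD1 i).
have s0 : 0 <= \sum_(j | j != i) t j by apply: sumr_ge0.
have piD := hull_point tiJ.
have [ti1|ti1] := leP 1 (t i).
  have sz : \sum_(j | j != i) t j = 0 by lra.
  have tz j : j != i -> t j = 0.
    by move: j; apply/psumr_eq0P => // j _; exact: t0.
  rewrite vE (bigD1 i)//= big1 => [|j /tz ->]; last by rewrite scale0r.
  by rewrite (_ : t i = 1) ?scale1r ?addr0//; lra.
pose y := (1 - t i)^-1 *: \sum_(j | j != i) t j *: p j.
have u0 : 1 - t i != 0 by rewrite subr_eq0 eq_sym lt_eqF.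
have yD : hull J y.
  exists (fun j => if j == i then 0 else (1 - t i)^-1 * t j); split.
  - by move=> j; case: ifP => // _; rewrite mulr_ge0// invr_ge0 subr_ge0 ltW.
  - by move=> j /tJ ->; rewrite mulr0; case: ifP.
  - rewrite (bigD1 i)//= eqxx add0r (eq_bigr (fun j => (1 - t i)^-1 * t j)); last first.
      by move=> j /negPf ->.
    by rewrite -mulr_sumr (_ : \sum_(_ | _) _ = 1 - t i) ?mulVf//; lra.
  - rewrite (bigD1 i)//= eqxx scale0r add0r /y scaler_sumr; apply: eq_bigr => j /negPf ->.
    by rewrite scalerA.
have vE' : v = t i *: p i + (1 - t i) *: y.
  by rewrite /y scalerA divff// scale1r vE (bigD1 i).
have := vext _ _ _ piD yD _ vE'; rewrite ti ti1 => /(_ erefl) e.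
by rewrite vE' -e -scalerDl addrC subrK scale1r.
Qed.

Lemma minimal_hull_vertex (J : {set 'I_n}) j : j \in J -> hull (J :\ j) != hull J ->
  polygon_vertex (hull J) (p j).
Proof.
move=> jJ /eqP neq; split; first exact: hull_point.
move=> x y t [a [a0 aJ a1 xE]] [b [b0 bJ b1 yE]] /andP[t0 t1] pE.
have le1 (c : 'I_n -> R) : (forall i, 0 <= c i) -> \sum_i c i = 1 -> c j <= 1.
  by move=> c0 <-; rewrite (bigD1 j)//= lerDl sumr_ge0.
have a1' := le1 _ a0 a1; have b1' := le1 _ b0 b1.
pose w i := t * a i + (1 - t) * b i.
have w0 i : 0 <= w i by rewrite addr_ge0 ?mulr_ge0 ?a0 ?b0//; lra.
have w1 : \sum_i w i = 1 by rewrite big_split/= -!mulr_sumr a1 b1; ring.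
have wJ i : i \notin J -> w i = 0 by move=> iJ; rewrite /w aJ// bJ// !mulr0 addr0.
have pw : p j = \sum_i w i *: p i.
  rewrite {1}pE xE yE !scaler_sumr -big_split/=; apply: eq_bigr => i _.
  by rewrite !scalerA -scalerDl.
have [wj1|wj1] := ltP (w j) 1.
  exfalso; apply: neq; apply/seteqP; split => z [c [c0 cJ c1 zE]].
    exists c; split => // i iJ; apply: cJ; rewrite !inE negb_and iJ orbT//.
  have u0 : 1 - w j != 0 by rewrite subr_eq0 eq_sym lt_eqF.
  exists (fun i => if i == j then 0 else c i + c j * (w i / (1 - w j))); split.
  - move=> i; case: ifP => // _; rewrite addr_ge0// mulr_ge0// divr_ge0//; lra.
  - move=> i; rewrite !inE negb_and negbK; case: eqP => //= _ iJ.
    by rewrite cJ// wJ// mul0r mulr0 addr0.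
  - rewrite (bigD1 j)//= eqxx add0r.
    rewrite (eq_bigr (fun i => c i + (c j / (1 - w j)) * w i)); last first.
      by move=> i /negPf ->; ring.
    rewrite big_split/= -mulr_sumr.
    have : c j + \sum_(i | i != j) c i = 1 by rewrite -c1 [RHS](bigD1 j).
    have : w j + \sum_(i | i != j) w i = 1 by rewrite -w1 [RHS](bigD1 j).
    move=> /(canRL (addKr _)) -> /(canRL (addKr _)) ->; field; lra.
  - rewrite (bigD1 j)//= eqxx scale0r add0r.
    rewrite (eq_bigr (fun i => c i *: p i + (c j / (1 - w j)) *: (w i *: p i))); last first.
      by move=> i /negPf ->; rewrite scalerA -scalerDl; congr (_ *: _); ring.
    rewrite big_split/= -scaler_sumr zE (bigD1 j)//= addrC; congr (_ + _).
    have -> : \sum_(i | i != j) w i *: p i = (1 - w j) *: p j.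
      by rewrite scalerBl scale1r [X in _ = X - _]pw [in RHS](bigD1 j)//= addrAC subrr add0r.
    by rewrite scalerA divfK.
have aj : a j = 1.
  apply/eqP; rewrite eq_le a1' leNgt; apply/negP => h; move: wj1; rewrite leNgt => /negP; apply.
  rewrite /w; nra.
have bj : b j = 1.
  apply/eqP; rewrite eq_le b1' leNgt; apply/negP => h; move: wj1; rewrite leNgt => /negP; apply.
  rewrite /w; nra.
have sup (c : 'I_n -> R) : (forall i, 0 <= c i) -> \sum_i c i = 1 -> c j = 1 ->
    \sum_i c i *: p i = p j.
  move=> c0 c1 cj; have : \sum_(i | i != j) c i = 0.
    by move: c1; rewrite (bigD1 j)//= cj => /(canRL (addKr _)) ->; ring.
  move=> /psumr_eq0P cz; rewrite (bigD1 j)//= cj scale1r big1 ?addr0// => i ij.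
  by rewrite cz ?scale0r.
by rewrite xE yE !sup.
Qed.

Lemma hull_setT : hull finset.setT =
  [set x | exists t : 'I_n -> R, [/\ forall i, 0 <= t i, \sum_i t i = 1 & x = \sum_i t i *: p i]].
Proof.
apply/seteqP; split => x [t].
  by move=> [t0 _ t1 xE]; exists t.
by move=> [t0 t1 xE]; exists t; split => // i; rewrite inE.
Qed.

Lemma hull_dot J u c x : hull J x -> (forall i, i \in J -> 0 <= c + dot u (p i)) -> 0 <= c + dot u x.
Proof.
move=> [t [t0 tJ t1 ->]] pos.
have -> : c + dot u (\sum_i t i *: p i) = \sum_i t i * (c + dot u (p i)).
  rewrite (eq_bigr (fun i => t i * c + t i * dot u (p i))); last by move=> i _; rewrite mulrDr.
  rewrite big_split/= -mulr_suml t1 mul1r; congr (_ + _).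
  by elim/big_rec2: _ => [|i y1 y2 _ <-]; rewrite ?dot0r// dotDr dotZr.
apply: sumr_ge0 => i _; have [iJ|iJ] := boolP (i \in J); first by rewrite mulr_ge0 ?pos.
by rewrite tJ ?mul0r.
Qed.

Lemma hull_dot_gt0 J u c x : hull J x -> (forall i, i \in J -> 0 < c + dot u (p i)) -> 0 < c + dot u x.
Proof.
move=> Jx pos.
have [J0|/set0Pn[i0 i0J]] := eqVneq J finset.set0.
  case: Jx => t [_ tJ t1 _]; move: t1; rewrite big1 => [/eqP|i _]; first by rewrite eq_sym oner_eq0.
  by apply: tJ; rewrite J0 inE.
have [i iJ imin] := @seq_argmin R _ (enum J) (fun i => c + dot u (p i)) i0 (eq_ind_r is_true i0J (mem_enum _ _)).
have /(@hull_dot J u (c - (c + dot u (p i))) x Jx) : forall k, k \in J -> 0 <= c - (c + dot u (p i)) + dot u (p k).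
  by move=> k; rewrite -mem_enum => /imin; lra.
by move: iJ; rewrite mem_enum => /pos; lra.
Qed.

Lemma hull_mix J x y t : hull J x -> hull J y -> 0 <= t <= 1 -> hull J (x + t *: (y - x)).
Proof.
move=> [a [a0 aJ a1 xE]] [b [b0 bJ b1 yE]] /andP[t0 t1].
exists (fun i => a i + t * (b i - a i)); split.
- move=> i; have := a0 i; have := b0 i => h1 h2; nra.
- by move=> i iJ; rewrite aJ// bJ// subr0 mulr0 addr0.
- by rewrite big_split/= -mulr_sumr sumrB a1 b1 subrr mulr0 addr0.
- rewrite xE yE -sumrB scaler_sumr -big_split/=; apply: eq_bigr => i _.
  by rewrite scalerDl -scalerA scalerBl.
Qed.

Lemma hull_compact J : compact (hull J).
Proof.
pose K : set 'rV[R]_n := [set t | [/\ forall i, 0 <= t 0 i, forall i, i \notin J -> t 0 i = 0 & \sum_i t 0 i = 1]].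
have -> : hull J = (fun t : 'rV[R]_n => \sum_i t 0 i *: p i) @` K.
  apply/seteqP; split => x.
    move=> [t [t0 tJ t1 ->]]; exists (\row_i t i).
      by split => [i|i iJ|]; rewrite ?mxE ?t0 ?tJ// -[RHS]t1; apply: eq_bigr => i _; rewrite mxE.
    by apply: eq_bigr => i _; rewrite mxE.
  by move=> [t [t0 tJ t1] <-]; exists (t 0).
apply: continuous_compact.
  apply: continuous_subspaceT; apply: (@continuous_sum R) => i t.
  have ct : (fun t : 'rV[R]_n => t 0 i) @ t --> t 0 i by exact: coord_continuous.
  have := @cvgZr_tmp _ _ _ _ _ _ _ (p i) ct; exact.
apply: bounded_closed_compact.
  exists 1; split; first exact: num_real.
  move=> M M1 t [t0 tJ t1]; apply/(le_trans _ (ltW M1)).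
  rewrite [leLHS]/Num.norm/= mx_normrE; apply/bigmax_leP; split => // -[i j] _ /=.
  rewrite (ord1 i) ger0_norm// -t1 (bigD1 j)//= lerDl sumr_ge0//.
have -> : K = \bigcap_i [set t | 0 <= t 0 i] `&` \bigcap_(i in [set i | i \notin J]) [set t | t 0 i = 0]
    `&` [set t | \sum_i t 0 i = 1].
  apply/seteqP; split => t; first by move=> [t0 tJ t1]; split => //; split => i; [move=> _; exact: t0|exact: tJ].
  by move=> [[t0 tJ] t1]; split => [i|i|//]; [exact: (t0 i I)|exact: (tJ i)].
have cc i : continuous (fun t : 'rV[R]_n => t 0 i) by move=> t; exact: coord_continuous.
apply: closedI; first apply: closedI.
- apply: closed_bigI => i _; apply: (preimage_closed _ (@closed_ge R 0)) => t _; exact: cc.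
- apply: closed_bigI => i _; apply: (preimage_closed _ (@closed_eq R 0)) => t _; exact: cc.
- apply: (preimage_closed _ (@closed_eq R 1)) => t _.
  by apply: continuous_sum => i; exact: cc.
Qed.
End Hull.

(** * Half-plane description of a rational polygon, by gift wrapping *)

Section PolyData.
Variable R : realType.

Definition cross (a b : plane R) : R := a 0 0 * b 0 1 - a 0 1 * b 0 0.

Definition af (s : lattice * R) (x : plane R) : R := s.2 + zdot s.1 x.

(* [V] are the vertices and [L] the inner normals with their offsets. *)
Record polygon_data (D : set (plane R)) (V : seq (plane R)) (L : seq (lattice * R)) : Prop :=
  PolygonData {
    pd_pos : forall m c, (forall v, v \in V -> 0 < c + zdot m v) ->
      forall x, D x -> 0 < c + zdot m x;
    pd_V : forall v, v \in V -> D v;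
    pd_rat : forall v, v \in V -> forall j, exists q : rat, v 0 j = ratr q;
    pd_L : forall x, D x <-> forall s, s \in L -> 0 <= af s x;
    pd_Li : forall x, D° x <-> forall s, s \in L -> 0 < af s x;
    pd_n0 : forall s, s \in L -> s.1 != 0;
    pd_touch : forall s, s \in L -> exists2 x, D x & af s x = 0;
    pd_ne : D° !=set0;
    pd_L0 : exists s, s \in L;
    pd_compact : compact D }.

Lemma af_mix s x y t : af s (x + t *: (y - x)) = (1 - t) * af s x + t * af s y.
Proof. by rewrite /af zdotDr zdotZr zdotBr; ring. Qed.

Lemma continuous_af s : continuous (af s).
Proof. by move=> x; apply: (@cvgD _ _ _ (nbhs x)); [exact: cvg_cst|exact: continuous_dot]. Qed.

Lemma near_gt0 (T : topologicalType) (f : T -> R) x : {for x, continuous f} -> 0 < f x ->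
  \forall y \near x, 0 < f y.
Proof. by move=> fc f0; have := fc _ (lt_nbhsr f0). Qed.

Lemma pos_ex (P : R -> Prop) : (\forall t \near 0^'+, P t) -> exists t, [/\ 0 < t, t < 1 & P t].
Proof.
move=> h; have lt1 := @nbhs_right_lt R 0 1 ltr01; have gt0 := @nbhs_right_gt R 0.
have FF : ProperFilter (0 : R)^'+ by exact: at_right_proper_filter.
have [t [[t1 t0] Pt]] := @filter_ex _ _ FF _ (@filterI _ _ _ _ _ (@filterI _ _ _ _ _ lt1 gt0) h).
by exists t.
Qed.

Lemma near_all (T : Type) (F : set_system T) (FF : Filter F) (I : eqType) (s : seq I) (P : I -> T -> Prop) :
  (forall i, i \in s -> \forall x \near F, P i x) -> \forall x \near F, forall i, i \in s -> P i x.
Proof.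
elim: s => [|a s IH] h; first by apply: filterE.
have h1 := h a (mem_head _ _).
have h2 : \forall x \near F, forall i, i \in s -> P i x.
  by apply: IH => i is_; apply: h; rewrite inE is_ orbT.
by apply: filterS2 h1 h2 => x Pa Ps i; rewrite inE => /predU1P[->|/Ps].
Qed.

Lemma interior_af (D : set (plane R)) s x : (forall y, D y -> 0 <= af s y) -> s.1 != 0 ->
  D° x -> 0 < af s x.
Proof.
move=> sD s0 Dx; rewrite lt_neqAle sD ?andbT; last exact: interior_subset.
apply/negP => /eqP e.
have [t [t0 _ Dt]] := pos_ex (near_dir (- map_mx intr s.1) Dx).
have := sD _ Dt.
rewrite leNgt => /negP; apply; rewrite /af zdotDr zdotZr zdotNr addrA -[s.2 + _]/(af s x) -e add0r.
rewrite mulrN oppr_lt0 mulr_gt0// -/(zdot _ _); apply: dot_gt0.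
by rewrite map_mx_intr_eq0.
Qed.

(** Multiplying the rational edge vector by both denominators makes its quarter turn an integer
    vector; [d] is the product of the denominators. *)
Lemma int_cross (v w : plane R) : v != w ->
  (forall j, exists q : rat, v 0 j = ratr q) -> (forall j, exists q : rat, w 0 j = ratr q) ->
  exists2 s, s.1 != 0 & exists2 d, 0 < d & forall x, af s x = d * cross (w - v) (x - v).
Proof.
move=> vw vr wr.
have dr j : exists q : rat, (w - v) 0 j = ratr q.
  by have [a ae] := vr j; have [b be] := wr j; exists (b - a); rewrite !mxE ae be rmorphB.
have [a ae] := dr 0; have [b be] := dr 1.
pose da : R := (denq a)%:~R; pose db : R := (denq b)%:~R.
have da0 : 0 < da by rewrite ltr0z denq_gt0.
have db0 : 0 < db by rewrite ltr0z denq_gt0.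
pose m : lattice := \row_j (if j == 0 then - (numq b * denq a) else numq a * denq b).
have ne : da != 0 /\ db != 0 by rewrite !gt_eqF.
have mE x : zdot m x = da * db * cross (w - v) x.
  rewrite zdotE /cross ae be !mxE /=.
  rewrite /ratr rmorphN !rmorphM /= -/da -/db; by field; case: ne => -> ->.
exists (m, - zdot m v).
  apply/negP => /eqP /= m0; move/negP: vw; apply; apply/eqP.
  have key x : cross (w - v) x = 0.
    apply/eqP; have := mE x; rewrite m0 zdot0l => /esym/eqP.
    by rewrite mulf_eq0 gt_eqF ?mulr_gt0.
  have := key (\row_j (if j == 0 then 0 else 1)); have := key (\row_j (if j == 0 then 1 else 0)).
  by rewrite /cross !mxE /= => h1 h2; apply/plane_eq; lra.
exists (da * db); first by rewrite mulr_gt0.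
by move=> x; rewrite -mE zdotBr /af /= addrC.
Qed.

Lemma mulr_lt0_gt (a b : R) : 0 < a -> a * b < 0 -> b < 0.
Proof. by move=> a0; rewrite pmulr_rlt0. Qed.

Lemma mulr_ge0_gt (a b : R) : 0 < a -> 0 <= a * b -> 0 <= b.
Proof. by move=> a0; rewrite pmulr_rge0. Qed.

Section Gift.
Variables (D : set (plane R)) (V : seq (plane R)).
Hypothesis Dc : compact D.
Hypothesis Dmix : forall x y t, D x -> D y -> 0 <= t <= 1 -> D (x + t *: (y - x)).
Hypothesis VD : forall v, v \in V -> D v.
Hypothesis DV : forall u c, (forall v, v \in V -> 0 <= c + dot u v) -> forall x, D x -> 0 <= c + dot u x.
Hypothesis D0 : D° !=set0.

(** The direction is from the nearest point [b] of [D] to [x]: were some [y] at an acute angle, a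
    small step from [b] towards [y] would come nearer to [x]. *)
Lemma separate x : ~ D x -> exists u, forall y, D y -> dot u y < dot u x.
Proof.
move=> Dx; pose f y := dot (y - x) (y - x).
have fc : continuous f.
  move=> y; rewrite (_ : f = fun y => (dot y y + (- 2) * dot x y) + dot x x); last first.
    by apply/funext => z; rewrite /f !dotE !mxE; ring.
  have c2 : (fun z => dot z z) @ y --> dot y y.
    rewrite (_ : (fun z => dot z z) = fun z : plane R => z 0 0 * z 0 0 + z 0 1 * z 0 1); last first.
      by apply/funext => z; rewrite dotE.
    rewrite dotE.
    by apply: (@cvgD _ _ _ (nbhs y)); apply: (@cvgM _ _ (nbhs y)); exact: coord_continuous.
  apply: (@cvgD _ _ _ (nbhs y)); last exact: cvg_cst.
  apply: (@cvgD _ _ _ (nbhs y)) => //.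
  by apply: (@cvgM _ _ (nbhs y)); [exact: cvg_cst|exact: continuous_dot].
have [z0 Dz0] := D0.
have [|b /set_mem Db bmin] := @compact_EVT_min _ _ f D _ Dc (continuous_subspaceT fc).
  by exists z0; exact: interior_subset.
exists (x - b) => y Dy.
have h : dot (x - b) (y - b) <= 0.
  rewrite leNgt; apply/negP => h.
  have q0 : 0 < dot (y - b) (y - b) by apply: dot_gt0; apply/eqP => e; move: h; rewrite e dot0r ltxx.
  (* The minimiser of the quadratic [f (b + t *: (y - b))], truncated to stay on the segment. *)
  pose t := Num.min 1 (dot (x - b) (y - b) / dot (y - b) (y - b)).
  have t0 : 0 < t by rewrite lt_min ltr01 divr_gt0.
  have t1 : 0 <= t <= 1 by rewrite (ltW t0)/= ge_min lexx.
  have tq : t * dot (y - b) (y - b) <= dot (x - b) (y - b).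
    by rewrite -ler_pdivlMr// ge_min lexx orbT.
  have := bmin _ (mem_set (Dmix Db Dy t1)).
  have -> : f (b + t *: (y - b)) = f b - 2 * t * dot (x - b) (y - b) + t * (t * dot (y - b) (y - b)).
    by rewrite /f !dotE !mxE; ring.
  move: tq h t0; clearbody t; move: (dot (x - b) (y - b)) (dot (y - b) (y - b)) (f b) => A B C; nra.
have u0 : 0 < dot (x - b) (x - b).
  by apply: dot_gt0; rewrite subr_eq0; apply/eqP => e; apply: Dx; rewrite e.
by move: h u0; rewrite !dotBr; lra.
Qed.

(** [D] would lie on a line, but an interior point can be moved along [u]. *)
Lemma not_flat u v : u != 0 -> (forall z, z \in V -> dot u z = dot u v) -> False.
Proof.
move=> u0 uV; have [z0 Dz0] := D0.
have Dv y : D y -> dot u y = dot u v.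
  move=> Dy; apply/eqP; rewrite eq_le; apply/andP; split.
    have : 0 <= dot u v + dot (- u) y by apply: DV Dy => z /uV e; rewrite dotNl e subrr.
    by rewrite dotNl; lra.
  have : 0 <= - dot u v + dot u y by apply: DV Dy => z /uV ->; rewrite addNr.
  by lra.
have [t [t0 _ Dt]] := pos_ex (near_dir u Dz0).
have := Dv _ Dt; rewrite -(Dv _ (interior_subset Dz0)) dotDr dotZr => h.
have : 0 < t * dot u u by rewrite mulr_gt0// dot_gt0.
by lra.
Qed.

(* One step of gift wrapping at a vertex [v] that is extremal in a direction
   separating [x] from [D]; [rho] measures the angle at [v]. *)
Lemma gift x : ~ D x -> exists v w, [/\ v \in V, w \in V, v != w,
  forall z, z \in V -> 0 <= cross (w - v) (z - v) & cross (w - v) (x - v) < 0].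
Proof.
move=> Dx; have [u us] := separate Dx.
have [z0 Dz0] := D0.
have [v0 v0V] : exists v, v \in V.
  apply: contrapT => /forallNP h.
  have : 0 <= -1 + dot 0 z0 by apply: DV (interior_subset Dz0) => v /h.
  by rewrite dotC dot0r; lra.
have [v vV vmax] := seq_argmax (dot u) v0V.
have ux : 0 < dot u (x - v) by rewrite dotBr subr_gt0; exact/us/VD.
have uu : 0 < dot u u.
  by apply: dot_gt0; apply/eqP => e; move: ux; rewrite e dotC dot0r ltxx.
pose al z := dot u (z - v); pose si z := cross u (z - v).
have al0 z : z \in V -> al z <= 0 by move=> /vmax; rewrite /al dotBr subr_le0.
(* Up to the length of [u], [al] and [si] are coordinates relative to [v] along [u] and its quarter
   turn; all of [V] has [al <= 0]. *)
have crE z y : dot u u * cross (z - v) (y - v) = al z * si y - si z * al y.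
  by rewrite /al /si /cross !dotE !mxE; ring.
have [[z [zV zv zal]]|no] := pselect (exists z, [/\ z \in V, z != v & al z = 0]).
  have siz : si z != 0.
    apply: contraNneq zv => e; rewrite -subr_eq0.
    have : dot u u * dot (z - v) (z - v) = 0.
      have -> : dot u u * dot (z - v) (z - v) = al z ^+ 2 + si z ^+ 2.
        by rewrite /al /si /cross !dotE !mxE; ring.
      by rewrite zal e; ring.
    by move/eqP; rewrite mulf_eq0 gt_eqF//=; apply: contraTT => /dot_gt0/gt_eqF ->.
  have [s0|s0] := ltP 0 (si z).
    exists v, z; split => // [|y yV|].
    + by rewrite eq_sym.
    + apply: (mulr_ge0_gt uu); rewrite crE zal mul0r sub0r.
      have := al0 _ yV; nra.
    + by apply: (mulr_lt0_gt uu); rewrite crE zal mul0r sub0r oppr_lt0 mulr_gt0.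
  have {}s0 : si z < 0 by rewrite lt_neqAle siz.
  have cE y : cross (v - z) (y - z) = - cross (z - v) (y - v).
    by rewrite /cross !mxE; ring.
  exists z, v; split => // [y yV|].
  + apply: (mulr_ge0_gt uu); rewrite cE mulrN crE zal mul0r sub0r opprK.
    have := al0 _ yV; nra.
  + by apply: (mulr_lt0_gt uu); rewrite cE mulrN crE zal mul0r sub0r opprK nmulr_rlt0.
have alN z : z \in V -> z != v -> al z < 0.
  move=> zV zv; rewrite lt_neqAle al0// andbT; apply/eqP => e; apply: no; exists z; split => //.
(* The extreme values of [rho] single out the two neighbours [w] and [w'] of [v] on the hull. *)
pose rho z := si z / (- al z).
have [v1 v1V] : exists z, z \in [seq z <- V | z != v].
  apply: contrapT => /forallNP h.
  have e z : z \in V -> z = v.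
    by move=> zV; apply/eqP; apply: contraT => zv; exfalso; apply: (h z); rewrite mem_filter zv.
  by apply: (@not_flat u v) => [|z /e ->//]; apply: contraTneq uu => ->; rewrite dot0l ltxx.
have [w + wmax] := seq_argmax rho v1V; rewrite mem_filter => /andP[wv wV].
have [w' + wmin] := seq_argmin rho v1V; rewrite mem_filter => /andP[wv' wV'].
have siE z : z \in V -> z != v -> si z = - rho z * al z.
  by move=> zV zv; rewrite /rho; field; rewrite lt_eqF// alN.
have crw y : dot u u * cross (w - v) (y - v) = al w * (si y + rho w * al y).
  by rewrite crE (siE w)//; ring.
have cE y : cross (v - w') (y - w') = - cross (w' - v) (y - v).
  by rewrite /cross !mxE; ring.
have crw' y : dot u u * cross (v - w') (y - w') = - al w' * (si y + rho w' * al y).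
  by rewrite cE mulrN crE (siE w')//; ring.
have zv z : z \in V -> (z = v) \/ [/\ al z < 0, rho w' <= rho z, rho z <= rho w & si z = - rho z * al z].
  move=> zV; have [->|zv] := eqVneq z v; first by left.
  by right; split; rewrite ?alN ?siE// ?wmax ?wmin// mem_filter zv.
have siv : si v = 0 by rewrite /si /cross !mxE; ring.
have alv : al v = 0 by rewrite /al subrr dot0r.
have [lt|ge] := ltP 0 (si x + rho w * al x).
  exists v, w; split => // [|z zV|].
  + by rewrite eq_sym.
  + apply: (mulr_ge0_gt uu); rewrite crw.
    have a0 := alN _ wV wv; case: (zv z zV) => [->|[a1 r1 r2 ->]]; first by rewrite siv alv; nra.
    rewrite [X in 0 <= X](_ : _ = (al w * al z) * (rho w - rho z)); last by ring.
    by rewrite mulr_ge0 ?subr_ge0// ltW// nmulr_rgt0.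
  + by apply: (mulr_lt0_gt uu); rewrite crw nmulr_rlt0// alN.
have [lt|ge'] := ltP (si x + rho w' * al x) 0.
  exists w', v; split => // [z zV|].
  + apply: (mulr_ge0_gt uu); rewrite crw'.
    have a0 := alN _ wV' wv'; case: (zv z zV) => [->|[a1 r1 r2 ->]]; first by rewrite siv alv; nra.
    rewrite [X in 0 <= X](_ : _ = (al w' * al z) * (rho z - rho w')); last by ring.
    by rewrite mulr_ge0 ?subr_ge0// ltW// nmulr_rgt0.
  + by apply: (mulr_lt0_gt uu); rewrite crw' pmulr_rlt0// oppr_gt0 alN.
(* Now [x] is beyond neither edge at [v]; since [0 < al x], the two extreme values agree and all of
   [V] lies on one line. *)
have re : rho w = rho w'.
  apply/eqP; rewrite eq_le wmin ?mem_filter ?wv// andbT.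
  have : rho w * al x <= rho w' * al x by lra.
  by rewrite ler_pM2r.
exfalso.
pose h : plane R := rot u + rho w *: u.
have hE y : dot h (y - v) = si y + rho w * al y.
  by rewrite /h dotDl [dot (_ *: _) _]dotC dotZr /al /si /cross !dotE !mxE /=; ring.
have hV z : z \in V -> dot h z = dot h v.
  move=> zV; apply/eqP; rewrite -subr_eq0 -dotBr hE.
  case: (zv z zV) => [->|[a1 r1 r2 ->]]; first by rewrite siv alv; apply/eqP; ring.
  rewrite (_ : rho z = rho w); first by apply/eqP; ring.
  by apply/eqP; rewrite eq_le r2 re r1.
apply: not_flat hV; apply/eqP => h0.
have : dot u u = dot h (rot u) by rewrite /h !dotE !mxE /=; ring.
by rewrite h0 dot0l => e; move: uu; rewrite e ltxx.
Qed.
End Gift.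
End PolyData.

Lemma coord_le_norm (R : realType) m n (x : 'M[R]_(m, n)) i j : `|x i j| <= `|x|.
Proof. by rewrite [leRHS]/Num.norm/= mx_normrE; apply/bigmax_geP; right => /=; exists (i, j). Qed.

Section PolyDataP.
Variable R : realType.

(** An inclusion-minimal set of points with hull [D] consists of vertices, by
    [minimal_hull_vertex]. *)
Lemma polygon_min_hull (D : set (plane R)) : polygon D ->
  exists n (p : 'I_n -> plane R) J, D = hull p J /\ forall j, j \in J -> polygon_vertex D (p j).
Proof.
move=> [n [p DE]].
have DT : D = hull p finset.setT by rewrite hull_setT.
pose good := [pred J : {set 'I_n} | `[< D = hull p J >]].
have [J /minsetP[/asboolP DJ Jmin] _] : {J | minset good J & J \subset finset.setT}.
  by apply: minset_exists; apply/asboolP.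
exists n, p, J; split => // j jJ; rewrite DJ; apply: minimal_hull_vertex => //.
apply/eqP => e; have := Jmin (J :\ j)%SET; rewrite subsetDl => /(_ _ isT).
have -> : good (J :\ j)%SET by apply/asboolP; rewrite DJ e.
by move=> /(_ isT) /setP/(_ j); rewrite !inE eqxx jJ.
Qed.

(** The sides come from all ordered pairs of distinct vertices with [V] on their left; by [gift],
    every exterior point violates one of them. *)
Lemma polygon_dataP (Omega D : set (plane R)) : rational_polygon_in Omega D ->
  exists V L, polygon_data D V L.
Proof.
move=> [/polygon_min_hull[n [p [J [DJ pv]]]] D0 _ vr].
pose V := [seq p j | j <- enum J].
have VP v : v \in V -> exists2 j, j \in J & v = p j.
  by move=> /mapP[j]; rewrite mem_enum; exists j.
have VD v : v \in V -> D v by move=> /VP[j /pv[? _] ->].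
have Vrat v : v \in V -> forall j, exists q : rat, v 0 j = ratr q.
  by move=> /VP[j /pv/vr h ->].
have DV u c : (forall v, v \in V -> 0 <= c + dot u v) -> forall x, D x -> 0 <= c + dot u x.
  move=> h x; rewrite DJ => xJ; apply: (hull_dot xJ) => i iJ; apply: h.
  by apply: map_f; rewrite mem_enum.
have Dpos m c : (forall v, v \in V -> 0 < c + zdot m v) -> forall x, D x -> 0 < c + zdot m x.
  move=> h x; rewrite DJ => xJ; apply: (hull_dot_gt0 xJ) => i iJ; apply: h.
  by apply: map_f; rewrite mem_enum.
have Dc : compact D by rewrite DJ; exact: hull_compact.
have Dmix x y t : D x -> D y -> 0 <= t <= 1 -> D (x + t *: (y - x)).
  by rewrite DJ; exact: hull_mix.
pose rep (vw : plane R * plane R) (s : lattice * R) := s.1 != 0 /\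
  exists2 d, 0 < d & forall x, af s x = d * cross (vw.2 - vw.1) (x - vw.1).
pose f vw := xget (0, 0) (rep vw).
have fP v w : v \in V -> w \in V -> v != w -> rep (v, w) (f (v, w)).
  move=> /Vrat vV /Vrat wV vw; have [s s0 sE] := int_cross vw vV wV.
  by rewrite /f; case: xgetP => [s' _ //|/(_ s)]; case.
pose L := [seq f vw | vw <- [seq vw <- [seq (v, w) | v <- V, w <- V] |
  (vw.1 != vw.2) && all (fun z => 0 <= cross (vw.2 - vw.1) (z - vw.1)) V]].
have LP s : s \in L -> exists v w, [/\ v \in V, w \in V, v != w, s = f (v, w) &
    forall z, z \in V -> 0 <= cross (w - v) (z - v)].
  move=> /mapP[vw]; rewrite mem_filter => /andP[/andP[ne /allP va]] /allpairsP[[v w] /= [vV wV e]].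
  by move: ne va; rewrite e /= => ne va sE; exists v, w; split.
have LD s : s \in L -> s.1 != 0 /\ forall x, D x -> 0 <= af s x.
  move=> /LP[v [w [vV wV vw -> vval]]]; have [n0 [d d0 dE]] := fP _ _ vV wV vw.
  split => //; apply: DV => z zV; rewrite -/(zdot _ _) -/(af _ _) dE; apply: mulr_ge0; [exact: ltW|exact: vval].
have DL x : D x <-> forall s, s \in L -> 0 <= af s x.
  split=> [Dx s /LD[_]|h]; first exact.
  apply: contrapT => Dx.
  have [v [w [vV wV vw vval neg]]] := gift Dc Dmix VD DV D0 Dx.
  have [n0 [d d0 dE]] := fP _ _ vV wV vw.
  have : f (v, w) \in L.
    apply: map_f; rewrite mem_filter /= vw /=; apply/andP; split; first by apply/allP => z; exact: vval.
    by apply/allpairsP; exists (v, w).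
  by move=> /h; rewrite dE pmulr_rge0// leNgt neg.
have DLi x : D° x <-> forall s, s \in L -> 0 < af s x.
  split=> [Dx s /LD[s0 sD]|h]; first exact: (interior_af sD s0 Dx).
  have : \forall y \near x, forall s, s \in L -> 0 < af s y.
    apply: (@near_all _ (nbhs x) _ _ L (fun s y => 0 < af s y)) => s sL; exact: (near_gt0 (@continuous_af R s x) (h s sL)).
  by apply: filterS => y yL; apply/DL => s /yL /ltW.
have L0 : exists s, s \in L.
  apply: contrapT => /forallNP L0.
  have allD x : D x by apply/DL => s /L0.
  have [M [Mr MB]] := compact_bounded Dc.
  have := MB (M + 1) _ (const_mx (M + 2)) (allD _).
  rewrite ltrDl ltr01 => /(_ isT).
  move=> nle; have := le_trans (ler_norm _) (le_trans (coord_le_norm (const_mx (M + 2) : plane R) 0 0) nle).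
  by rewrite mxE; lra.
exists V, L; split => // [s /LD[]//|s].
move=> /LP[v [w [vV wV vw -> _]]]; have [n0 [d d0 dE]] := fP _ _ vV wV vw.
by exists v; [exact: VD|rewrite dE /= subrr /cross !mxE !mulr0 subrr mulr0].
Qed.
End PolyDataP.

(** * Tropical polynomials and admissible coefficients *)

Section Trop.
Variable R : realType.
Implicit Types (m : lattice) (s : seq lattice) (c : lattice -> R) (x y z v : plane R) (G : plane R -> R).

Lemma trop_min m0 s c x :
  (forall m, m \in m0 :: s -> tropical_poly m0 s c x <= lf c m x) /\
  exists2 m, m \in m0 :: s & tropical_poly m0 s c x = lf c m x.
Proof.
rewrite /tropical_poly -/(lf c m0 x).
elim: s => [|a s [IHl [b bs IHe]]].
  rewrite big_nil; split; last by exists m0; rewrite ?mem_head.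
  by move=> m; rewrite inE => /eqP ->.
rewrite big_cons -/(lf c a x); split.
  move=> m; rewrite !inE orbCA => /predU1P[->|mS]; first by rewrite ge_min lexx.
  by rewrite ge_min IHl ?orbT// inE.
rewrite /Num.min; case: ifP => _; first by exists a; rewrite // !inE eqxx orbT.
by exists b => //; rewrite !inE orbCA; move: bs; rewrite inE => ->; rewrite orbT.
Qed.

Lemma continuous_trop m0 s c : continuous (tropical_poly m0 s c : plane R -> R).
Proof.
elim: s => [|a s IH].
  rewrite (_ : tropical_poly m0 [::] c = lf c m0); first exact: continuous_lf.
  by apply/funext => x; rewrite /tropical_poly big_nil.
rewrite (_ : tropical_poly m0 (a :: s) c = fun x => Num.min (lf c a x) (tropical_poly m0 s c x)); last first.
  by apply/funext => x; rewrite /tropical_poly big_cons.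
by move=> x; apply: continuous_min; [exact: continuous_lf|exact: IH].
Qed.

Lemma trop_line m0 s c x v : exists a b, a <= b /\ \forall t \near (0 : R),
  tropical_poly m0 s c (x + t *: v) = tropical_poly m0 s c x + (if 0 <= t then a else b) * t.
Proof.
set F := tropical_poly m0 s c.
have [Fl [m mS Fe]] := trop_min m0 s c x.
pose act := [seq k <- m0 :: s | lf c k x == F x].
have mact : m \in act by rewrite mem_filter mS /F Fe eqxx.
have [ka + kamin] := seq_argmin (fun k => zdot k v) mact.
have [kb + kbmax] := seq_argmax (fun k => zdot k v) mact.
rewrite !mem_filter => /andP[/eqP kbe kbS] /andP[/eqP kae kaS].
exists (zdot ka v), (zdot kb v); split; first by apply: kamin; rewrite mem_filter kbS kbe eqxx.
have nearlt : \forall t \near (0 : R), forall k, k \in [seq k <- m0 :: s | lf c k x != F x] ->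
    F (x + t *: v) < lf c k (x + t *: v).
  apply: (@near_line _ _ _ _ _ (fun y => forall k, k \in [seq k <- m0 :: s | lf c k x != F x] ->
    F y < lf c k y)).
  apply: (@near_all _ (nbhs x) _ _ _ (fun k y => F y < lf c k y)) => k.
  rewrite mem_filter => /andP[kF kS].
  have pos : 0 < lf c k x - F x by rewrite subr_gt0 lt_neqAle eq_sym kF; exact: Fl.
  have : {for x, continuous (fun y => lf c k y - F y)}.
    by apply: (@cvgB _ _ _ (nbhs x)); [exact: continuous_lf|exact: continuous_trop].
  by move=> /near_gt0/(_ pos); apply: filterS => y; rewrite subr_gt0.
apply: filterS nearlt => t tlt.
have [Fl' [k kS Fe']] := trop_min m0 s c (x + t *: v).
have kact : lf c k x = F x.
  apply/eqP; apply: contraT => kF.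
  by have := tlt k; rewrite mem_filter kF kS -Fe' -/F ltxx => /(_ isT).
have lfE j : lf c j (x + t *: v) = lf c j x + zdot j v * t.
  by rewrite /lf zdotDr zdotZr; ring.
have kA : k \in act by rewrite mem_filter kact eqxx kS.
apply/eqP; rewrite eq_le; apply/andP; split.
  by case: ifP => _; [rewrite -kae -lfE|rewrite -kbe -lfE]; exact: Fl'.
rewrite {2}/F Fe' lfE kact lerD2l.
case: ifPn => t0; first by rewrite ler_wpM2r// kamin.
by rewrite ler_wnM2r// ?kbmax// ltW// ltNge.
Qed.

(* If the inequality fails, subtracting the chord and adding a small parabola
   gives a function on the segment with an interior minimum, impossible at a
   point where the slopes can only decrease. *)
Lemma local_supergradient (U : set (plane R)) G x y m :
  (forall z, U z -> exists m0 s c, \forall w \near z, G w = tropical_poly m0 s c w) ->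
  (forall t, 0 <= t <= 1 -> U (x + t *: (y - x))) ->
  (\forall z \near x, G z <= G x + zdot m (z - x)) ->
  G y <= G x + zdot m (y - x).
Proof.
move=> loc seg lsup; rewrite leNgt; apply/negP => neg.
set v := y - x in neg *; pose h t := G (x + t *: v) - G x - t * zdot m v.
have h0 : h 0 = 0 by rewrite /h scale0r addr0 mul0r !subrr.
have h1 : 0 < h 1.
  have xv : x + v = y by rewrite /v addrC subrK.
  by rewrite /h scale1r mul1r xv; move: neg; lra.
have hline t : 0 <= t <= 1 -> exists a b, a <= b /\ \forall e \near (0 : R),
    h (t + e) = h t + (if 0 <= e then a else b) * e.
  move=> t01; have [m0 [s [c cE]]] := loc _ (seg _ t01).
  have [a [b [ab abE]]] := trop_line m0 s c (x + t *: v) v.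
  exists (a - zdot m v), (b - zdot m v); split; first by rewrite lerB.
  have := near_line v cE; apply: filterS2 abE => e e1 e2.
  rewrite /h scalerDl addrA e2 e1 (nbhs_singleton cE).
  by case: ifP => _; ring.
(* Half of [h 1]: near 0 the chord term [- h 1 * t] then outweighs the parabola, and [g] takes
   negative values inside. *)
pose eps := h 1 / 2.
pose g t := h t - h 1 * t + eps * (t * (1 - t)).
have gline t : 0 <= t <= 1 -> exists a b, a <= b /\ \forall e \near (0 : R),
    g (t + e) = g t + (if 0 <= e then a else b) * e - eps * e ^+ 2.
  move=> /hline[a [b [ab abE]]].
  exists (a - h 1 + eps * (1 - 2 * t)), (b - h 1 + eps * (1 - 2 * t)); split; first by rewrite !lerD2r.
  by apply: filterS abE => e eE; rewrite /g eE; case: ifP => _; ring.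
have lc : continuous (fun t : R => x + t *: v).
  move=> t; apply: (@cvgD _ _ _ (nbhs t)); first exact: cvg_cst.
  have tt : (fun t : R => t) @ t --> t by exact: cvg_id.
  by have := @cvgZr_tmp _ _ _ _ _ _ _ v tt; exact.
have gc : {within `[0, 1], continuous g}.
  apply: continuous_in_subspaceT => t; rewrite inE /= in_itv /= => t01.
  have [m0 [s [c cE]]] := loc _ (seg _ t01).
  have Gc : (fun t : R => G (x + t *: v)) @ t --> G (x + t *: v).
    rewrite (nbhs_singleton cE).
    apply: cvg_trans (continuous_comp (lc t) (@continuous_trop m0 s c _)).
    by apply: near_eq_cvg; apply: (@filterS _ (nbhs t) _ _ _ _ (lc t _ cE)) => u ue; exact: esym ue.
  have ti : (fun t : R => t) @ t --> t by exact: cvg_id.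
  have ti1 : (fun t : R => 1 - t) @ t --> 1 - t.
    by apply: (@cvgB _ _ _ (nbhs t)); [exact: cvg_cst|exact: ti].
  rewrite /g /h; apply: (@cvgD _ _ _ (nbhs t)); [apply: (@cvgB _ _ _ (nbhs t)); [apply: (@cvgB _ _ _ (nbhs t)); [apply: (@cvgB _ _ _ (nbhs t))|]|]|].
  - exact: Gc.
  - exact: cvg_cst.
  - by apply: cvgM; [exact: ti|exact: cvg_cst].
  - by apply: cvgM; [exact: cvg_cst|exact: ti].
  - apply: cvgM; first exact: cvg_cst.
    by apply: cvgM; [exact: ti|exact: ti1].
have [t t01 tmin] := EVT_min ler01 gc.
have g0 : g 0 = 0 by rewrite /g h0; ring.
have g1 : g 1 = 0 by rewrite /g; ring.
have eps0 : 0 < eps by rewrite divr_gt0.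
have gneg : exists2 u, 0 <= u <= 1 & g u < 0.
  have hle : \forall u \near 0^'+, h u <= 0.
    have := near_dir v lsup; apply: filterS => u.
    by rewrite addrAC subrr add0r zdotZr /h; lra.
  have [u [u0 u1 hu]] := pos_ex hle.
  exists u; first by rewrite !ltW.
  rewrite /g; have -> : h 1 = 2 * eps by rewrite /eps; field.
  have : 0 < eps * u by rewrite mulr_gt0.
  have : 0 < eps * u * u by rewrite !mulr_gt0.
  move: hu; lra.
have gt : g t < 0 by case: gneg => u u01; apply: le_lt_trans; apply: tmin; rewrite in_itv.
have t0 : 0 < t.
  move: t01; rewrite in_itv /= => /andP[t0 _]; rewrite lt_neqAle t0 andbT.
  by apply/eqP => e; move: gt; rewrite -e g0 ltxx.
have t1 : t < 1.
  move: t01; rewrite in_itv /= => /andP[_ t1]; rewrite lt_neqAle t1 andbT.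
  by apply/eqP => e; move: gt; rewrite e g1 ltxx.
have t01' : 0 <= t <= 1 by rewrite !ltW.
have [a [b [ab [d /= d0 dP]]]] := gline t t01'.
pose e := Num.min (d / 2) (Num.min t (1 - t)).
have e0 : 0 < e by rewrite !lt_min t0 subr_gt0 t1 divr_gt0.
have ed : e < d.
  by apply: (@le_lt_trans _ _ (d / 2)); [rewrite ge_min lexx|rewrite ltr_pdivrMr// ltr_pMr// ltr1n].
have et : e <= t by rewrite !ge_min lexx !orbT.
have et1 : e <= 1 - t by rewrite !ge_min lexx !orbT.
(* Both neighbouring values are at least [g t], yet they add up to [2 g t + (a - b) e - 2 eps e^2],
   which is less than [2 g t]. *)
have gp : g t <= g (t + e) by apply: tmin; rewrite in_itv /=; lra.
have gm : g t <= g (t - e) by apply: tmin; rewrite in_itv /=; lra.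
have Ep := dP e; have Em := dP (- e).
move: Ep Em; rewrite /ball_ /= !sub0r opprK normrN gtr0_norm// => /(_ ed) Ep /(_ ed) Em.
have ne : (0 <= - e) = false by rewrite oppr_ge0 leNgt e0.
move: gp gm; rewrite Ep Em (ltW e0) ne => gp gm.
have q : 0 < eps * e ^+ 2 by rewrite mulr_gt0// exprn_gt0.
have ae : a * e <= b * e by rewrite ler_wpM2r// ltW.
by move: gp gm; rewrite sqrrN mulrN; lra.
Qed.
End Trop.

(** * Admissible coefficient vectors *)

Section Admissible.
Variables (R : realType) (D : set (plane R)) (V : seq (plane R)) (L : seq (lattice * R)) (N : nat).
Hypothesis pd : polygon_data D V L.
Implicit Types (m k : lattice) (c : lattice -> R) (x y z v : plane R) (H G : plane R -> R) (Q : config R N).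

Lemma interior_mix x y t : D x -> D° y -> 0 < t <= 1 -> D° (x + t *: (y - x)).
Proof.
move=> /(pd_L pd) Dx /(pd_Li pd) Dy /andP[t0 t1]; apply/(pd_Li pd) => s sL.
rewrite af_mix; have := Dx _ sL; have := Dy _ sL => h1 h2.
have : 0 < t * af s y by rewrite mulr_gt0.
have : 0 <= (1 - t) * af s x by rewrite mulr_ge0// subr_ge0.
by lra.
Qed.

Lemma not_interior x : ~ D° x -> exists2 s, s \in L & af s x <= 0.
Proof.
move=> Dix; apply: contrapT => h; apply: Dix; apply/(pd_Li pd) => s sL; rewrite ltNge; apply/negP => ?.
by apply: h; exists s.
Qed.

(* Slopes of supergradients of functions below [N] times the distances to the
   sides; the condition bounds [m]. *)
Definition slopes (A : seq lattice) := forall m,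
  (forall v (K : R), 0 <= K -> (forall s, s \in L -> zdot s.1 v <= K) -> zdot m v <= N%:R * K) -> m \in A.

(** Testing the condition on the four signed unit vectors, with [K] the sum [B] of the absolute
    entries of all normals, bounds both coordinates of [m] by [N * B]. *)
Lemma slopes_ex : exists A, slopes A.
Proof.
pose B := (\sum_(s <- L) (`|s.1 0%R 0%R| + `|s.1 0%R 1%R|))%N.
pose M := (N * B)%N.
pose rng := [seq (i%:Z - M%:Z : int) | i <- iota 0 (2 * M + 1)].
have rngP (z : int) : - M%:Z <= z <= M%:Z -> z \in rng.
  move=> /andP[z1 z2]; apply/mapP; exists (absz (z + M%:Z)); last by lia.
  by rewrite mem_iota; lia.
exists [seq \row_(j < 2) (if j == 0 then a else b) | a <- rng, b <- rng] => m h.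
apply/allpairsP; exists (m 0 0, m 0 1).
have sB (s : lattice * R) : s \in L -> (`|s.1 0%R 0%R| + `|s.1 0%R 1%R| <= B)%N.
  by move=> sL; rewrite /B (big_rem s)//= leq_addr.
have e (a b : R) : (`|a| + `|b| <= 1) -> zdot m (\row_j (if j == 0 then a else b)) <= (M%:Z)%:~R.
  move=> ab; rewrite /M PoszM intrM; apply: h => // s /sB sL.
  rewrite zdotE !mxE /=.
  have h1 : (s.1 0 0)%:~R * a <= `|s.1 0 0|%:~R * `|a|.
    by apply: (le_trans (ler_norm _)); rewrite normrM intr_norm.
  have h2 : (s.1 0 1)%:~R * b <= `|s.1 0 1|%:~R * `|b|.
    by apply: (le_trans (ler_norm _)); rewrite normrM intr_norm.
  have h3 : `|s.1 0 0|%:~R <= (B%:Z)%:~R :> R.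
    by rewrite ler_int -abszE lez_nat (leq_trans _ sL)// leq_addr.
  have h4 : `|s.1 0 1|%:~R <= (B%:Z)%:~R :> R.
    by rewrite ler_int -abszE lez_nat (leq_trans _ sL)// leq_addl.
  have b0 : 0 <= (B%:Z)%:~R :> R by rewrite ler0z.
  have a0 := normr_ge0 a; have a1 := normr_ge0 b.
  apply: (le_trans (lerD h1 h2)).
  apply: (@le_trans _ _ ((B%:Z)%:~R * (`|a| + `|b|))); last by rewrite -[leRHS]mulr1 ler_wpM2l.
  by rewrite mulrDr lerD// ler_wpM2r.
have e1 := e 1 0; have e2 := e (-1) 0; have e3 := e 0 1; have e4 := e 0 (-1).
move: e1 e2 e3 e4; rewrite !zdotE !mxE /= !normrN !normr1 !normr0 !addr0 !add0r => e1 e2 e3 e4.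
split.
- apply: rngP; rewrite -!(ler_int R) mulrNz.
  by have := e1 (lexx _); have := e2 (lexx _); lra.
- apply: rngP; rewrite -!(ler_int R) mulrNz.
  by have := e3 (lexx _); have := e4 (lexx _); lra.
- by apply: plane_eq; rewrite !mxE.
Qed.

Variable A : seq lattice.
Hypothesis HA : slopes A.

Definition supg H x m := forall y, D y -> H y <= H x + zdot m (y - x).

(** Walk from [x] along [- v] until the first side [s] is hit, at time [t]: nonnegativity of [H]
    there gives [t <m, v> <= H x], while [H x <= N af s x = N t <s.1, v>]. If no side is approached,
    the ray stays in [D] and [<m, v> <= 0]. *)
Lemma supg_slope H x m : (forall y, D y -> 0 <= H y) ->
  (forall y s, D y -> s \in L -> H y <= N%:R * af s y) -> D° x -> supg H x m -> m \in A.
Proof.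
move=> H0 HN Dx sup; apply: HA => v K K0 vK.
have afm s t : af s (x - t *: v) = af s x - t * zdot s.1 v.
  by rewrite /af zdotBr zdotZr; ring.
have supt t : D (x - t *: v) -> t * zdot m v <= H x.
  move=> Dt; have := sup _ Dt; rewrite addrAC subrr add0r zdotNr zdotZr.
  have := H0 _ Dt; lra.
have af0 := (pd_Li pd x).1 Dx.
have [[s0 s0L]|none] := pselect (exists s, s \in [seq s <- L | 0 < zdot s.1 v]).
  have [s + smin] := seq_argmin (fun s => af s x / zdot s.1 v) s0L.
  rewrite mem_filter => /andP[sv sL].
  set t := af s x / zdot s.1 v in smin.
  have t0 : 0 < t by rewrite divr_gt0// af0.
  have Dt : D (x - t *: v).
    apply/(pd_L pd) => s' s'L; rewrite afm subr_ge0.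
    have [s'v|s'v] := ltP 0 (zdot s'.1 v).
      by rewrite -ler_pdivlMr// smin// mem_filter s'v.
    by apply: (@le_trans _ _ 0); [rewrite mulr_ge0_le0// ltW|rewrite ltW// af0].
  have := supt _ Dt; have := HN _ _ (interior_subset Dx) sL => h1 h2.
  have e : af s x = t * zdot s.1 v by rewrite /t divfK// gt_eqF.
  rewrite -(ler_pM2l t0); apply: (le_trans h2); apply: (le_trans h1).
  rewrite e mulrCA ler_wpM2l ?(ltW t0)// ler_wpM2l// vK//.
have {}none s : s \in L -> zdot s.1 v <= 0.
  by move=> sL; rewrite leNgt; apply/negP => sv; apply: none; exists s; rewrite mem_filter sv.
apply: (@le_trans _ _ 0); last by rewrite mulr_ge0.
rewrite leNgt; apply/negP => mv.
have Hx0 := H0 _ (interior_subset Dx).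
have t0 : 0 <= (H x + 1) / zdot m v by rewrite divr_ge0 ?ltW//; lra.
have : D (x - ((H x + 1) / zdot m v) *: v).
  apply/(pd_L pd) => s sL; rewrite afm; have := af0 _ sL; have := none _ sL => h1 h2.
  have : (H x + 1) / zdot m v * zdot s.1 v <= 0 by rewrite mulr_ge0_le0.
  by lra.
by move=> /supt; rewrite divfK ?gt_eqF//; lra.
Qed.

Definition tie c x : set lattice :=
  [set m | m \in A /\ forall k, k \in A -> lf c m x <= lf c k x].

Lemma tie_lt c x j k : tie c x j -> k \in A -> ~ tie c x k -> lf c j x < lf c k x.
Proof.
move=> tj kA tk; rewrite lt_neqAle tj.2// andbT; apply/eqP => e; apply: tk; split => // l lA.
by rewrite -e tj.2.
Qed.

(** The second clause keeps the function of slope [s.1 *+ N] below [N] times [af s]; with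
    nonnegativity, this makes the minimum vanish on the side [s]. The third clause encodes corners
    at the points. *)
Definition admissible Q c := [/\ forall m x, m \in A -> D x -> 0 <= lf c m x,
  forall s, s \in L -> c (s.1 *+ N) <= N%:R * s.2 &
  forall i, exists m m', [/\ m != m', tie c (row i Q) m & tie c (row i Q) m']].

Lemma normal_slope s : s \in L -> s.1 *+ N \in A.
Proof. by move=> sL; apply: HA => v K K0 h; rewrite zdotMn ler_wpM2l ?h. Qed.

(** Let [c m] be the concave conjugate, the least constant keeping [lf c m] above [H] on [D]. A
    supergradient at a point is a slope whose function touches [H] there, so corners of [H] become
    ties. *)
Lemma coef_admissible H Q : (forall y, D y -> 0 <= H y) ->
  (forall y s, D y -> s \in L -> H y <= N%:R * af s y) ->
  (forall x, D° x -> exists m, supg H x m) ->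
  (forall i, D° (row i Q) /\ exists m m', [/\ m != m', supg H (row i Q) m & supg H (row i Q) m']) ->
  exists c, admissible Q c /\ forall x, D x -> exists2 m, m \in A & lf c m x <= H x.
Proof.
move=> H0 HN Hsup HQ.
pose E m := [set H y - zdot m y | y in D].
have [z0 Dz0] := pd_ne pd; have [s0 s0L] := pd_L0 pd.
have Eb m : has_sup (E m).
  split; first by exists (H z0 - zdot m z0), z0 => //; exact: interior_subset.
  have fc : continuous (fun y => N%:R * af s0 y - zdot m y).
    move=> y; apply: (@cvgB _ _ _ (nbhs y)); last exact: continuous_dot.
    by apply: (@cvgM _ _ (nbhs y)); [exact: cvg_cst|exact: continuous_af].
  have [|b /set_mem Db bmax] := @compact_EVT_max _ _ _ D _ (pd_compact pd) (continuous_subspaceT fc).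
    by exists z0; exact: interior_subset.
  exists (N%:R * af s0 b - zdot m b) => _ [y Dy <-].
  apply: le_trans (bmax _ (mem_set Dy)); rewrite lerD2r; exact: HN.
pose c m := sup (E m).
have clf m y : D y -> H y <= lf c m y.
  move=> Dy; rewrite /lf -lerBlDr; apply: ub_le_sup; first by case: (Eb m).
  by exists y.
have csup x m : D x -> supg H x m -> lf c m x = H x.
  move=> Dx sx; apply/eqP; rewrite eq_le clf// andbT /lf -lerBrDr.
  apply: ge_sup; first by case: (Eb m).
  by move=> _ [y Dy <-]; have := sx _ Dy; rewrite zdotBr; lra.
have cN s : s \in L -> c (s.1 *+ N) <= N%:R * s.2.
  move=> sL; apply: ge_sup; first by case: (Eb (s.1 *+ N)).
  by move=> _ [y Dy <-]; have := HN _ _ Dy sL; rewrite /af zdotMn; lra.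
exists c; split; first split => //.
- by move=> m x mA Dx; apply: le_trans (clf _ _ Dx); exact: H0.
- move=> i; have [Di [m [m' [mm' sm sm']]]] := HQ i.
  have tieP k : supg H (row i Q) k -> tie c (row i Q) k.
    move=> sk; split; first exact: supg_slope sk.
    by move=> j jA; rewrite csup//; [exact: clf (interior_subset Di)|exact: interior_subset].
  by exists m, m'; split => //; exact: tieP.
move=> x Dx; have [Dix|Dix] := pselect (D° x).
  have [m sm] := Hsup _ Dix; exists m; first exact: supg_slope sm.
  by rewrite csup.
(* No supergradient is provided on the boundary; the normal slope of a side through [x] already
   gives a value at most 0. *)
have [s sL s0x] := not_interior Dix.
exists (s.1 *+ N); first exact: normal_slope.
apply: (@le_trans _ _ 0); last exact: H0.
rewrite /lf zdotMn; apply: (@le_trans _ _ (N%:R * af s x)); last by rewrite mulr_ge0_le0.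
by rewrite /af mulrDr lerD2r cN.
Qed.
End Admissible.

Lemma seq_pos_lb (R : realFieldType) (T : eqType) (s : seq T) (f : T -> R) :
  (forall x, x \in s -> 0 < f x) -> exists2 e, 0 < e & forall x, x \in s -> e <= f x.
Proof.
case: s => [|a s] fs; first by exists 1.
have [x xs xm] := seq_argmin f (mem_head a s).
by exists (f x) => //; exact: fs.
Qed.

Lemma ge0_limit (R : realFieldType) (a b : R) :
  (forall t, 0 < t <= 1 -> 0 <= a + t * b) -> 0 <= a.
Proof.
move=> h; rewrite leNgt; apply/negP => a0.
have b0 : 0 < b by have := h 1; rewrite ltr01 lexx mul1r => /(_ isT); lra.
pose t := Num.min 1 (- a / (2 * b)).
have d0 : 0 < - a / (2 * b) by rewrite divr_gt0 ?mulr_gt0 ?oppr_gt0.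
have t0 : 0 < t by rewrite lt_min ltr01.
have t1 : t <= 1 by rewrite ge_min lexx.
have tb : t * (2 * b) <= - a by rewrite -ler_pdivlMr ?mulr_gt0// ge_min lexx orbT.
by have := h t; rewrite t0 t1 => /(_ isT); lra.
Qed.

(** * The least admissible vector computes the relaxation *)

Section Minimal.
Variables (R : realType) (D : set (plane R)) (V : seq (plane R)) (L : seq (lattice * R)) (N : nat).
Hypothesis pd : polygon_data D V L.
Variable A : seq lattice.
Hypothesis HA : slopes L N A.
Implicit Types (m k : lattice) (c : lattice -> R) (x y z v : plane R) (H G : plane R -> R) (Q : config R N).

Definition ell x := xget 0 [set y | (exists2 s, s \in L & y = af s x) /\ forall s, s \in L -> y <= af s x].

Lemma ellP x : (exists2 s, s \in L & ell x = af s x) /\ forall s, s \in L -> ell x <= af s x.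
Proof.
have [s0 s0L] := pd_L0 pd; have [s sL smin] := seq_argmin (fun s => af s x) s0L.
by rewrite /ell; case: xgetP => [y _ //|/(_ (af s x))]; case; split => //; exists s.
Qed.

(* A series-like function with corners at the points of [Q] that is bounded by
   [N] times the distance to each side; taking minima with it confines the
   slopes of any competitor to [A]. *)
Definition barrier Q x := \sum_(i < N) Num.min (ell x) (ell (row i Q)).

(** A summand below its cap contributes the normal [s.1], a capped one contributes 0, and one
    exactly at its cap admits both; hence [J] is only bounded from either side. *)
Lemma barrier_supg Q x s (J : {set 'I_N}) : s \in L -> ell x = af s x ->
  (forall i, ell x < ell (row i Q) -> i \in J) ->
  (forall i, i \in J -> ell x <= ell (row i Q)) -> supg D (barrier Q) x (s.1 *+ #|J|).
Proof.
move=> sL se J1 J2 y Dy.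
have -> : zdot (s.1 *+ #|J|) (y - x) = \sum_(i < N) (if i \in J then zdot s.1 (y - x) else 0).
  by rewrite -big_mkcond /= sumr_const zdotMn mulr_natl.
rewrite /barrier -big_split /=; apply: ler_sum => i _.
case: ifPn => iJ.
  rewrite (min_idPl (J2 _ iJ)) ge_min; apply/orP; left.
  apply: le_trans ((ellP y).2 _ sL) _; rewrite se /af zdotBr; lra.
rewrite addr0 (_ : Num.min (ell x) _ = ell (row i Q)); first by rewrite ge_min lexx orbT.
by apply/min_idPr; rewrite leNgt; apply: contra iJ; exact: J1.
Qed.

Lemma barrier_ge0 Q x : (forall i, D° (row i Q)) -> D x -> 0 <= barrier Q x.
Proof.
have l0 z : D z -> 0 <= ell z.
  by move=> Dz; have [[s sL ->] _] := ellP z; exact: (pd_L pd z).1.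
move=> DQ Dx; apply: sumr_ge0 => i _; rewrite le_min; apply/andP; split; apply: l0 => //.
exact: interior_subset (DQ i).
Qed.

Lemma barrier_le Q x s : s \in L -> barrier Q x <= N%:R * af s x.
Proof.
move=> sL; rewrite -[X in X%:R]card_ord mulr_natl -sumr_const; apply: ler_sum => i _.
by rewrite ge_min (ellP x).2.
Qed.

Lemma barrier_supg_ex Q x : exists m, supg D (barrier Q) x m.
Proof.
have [[s sL se] _] := ellP x.
exists (s.1 *+ #|[set i | ell x < ell (row i Q)]%SET|).
by apply: barrier_supg => // i; rewrite inE // => /ltW.
Qed.

(** At [row j Q] the summand [j] is exactly at its cap and may be counted or not; the two resulting
    slopes differ by [s.1]. *)
Lemma barrier_corner Q j : exists m m', [/\ m != m', supg D (barrier Q) (row j Q) m &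
  supg D (barrier Q) (row j Q) m'].
Proof.
have [[s sL se] _] := ellP (row j Q).
pose J := [set i | ell (row j Q) < ell (row i Q)]%SET.
have jJ : j \notin J by rewrite inE ltxx.
exists (s.1 *+ #|J|), (s.1 *+ #|j |: J|%SET); split.
- rewrite cardsU1 jJ mulrS eq_sym -subr_eq0 addrK; exact: pd_n0 pd _ sL.
- by apply: barrier_supg => // i; rewrite inE // => /ltW.
- by apply: barrier_supg => // i; rewrite !inE; [move=> ->; rewrite orbT|move=> /predU1P[->|/ltW]].
Qed.

Lemma admissible_ex Q : (forall i, D° (row i Q)) -> exists c, admissible D L A Q c.
Proof.
move=> DQ; have [|||i|c [cQ _]] := @coef_admissible R D V L N pd A HA (barrier Q) Q.
- by move=> y; exact: barrier_ge0.
- by move=> y s _; exact: barrier_le.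
- by move=> x _; exact: barrier_supg_ex.
- by split => //; exact: barrier_corner.
- by exists c.
Qed.

(** [local_supergradient] covers the interior. At a boundary point [G] vanishes, so the affine bound
    has to be nonnegative there; this is the limit of [0 <= G] along a segment from the interior. *)
Lemma series_supg G x m : tropical_series D G -> D° x ->
  (\forall z \near x, G z <= G x + zdot m (z - x)) -> supg D G x m.
Proof.
move=> [_ G0 Gb Gloc] Dx sx.
have key y : D° y -> G y <= G x + zdot m (y - x).
  move=> Dy; apply: (@local_supergradient R D°) => // t /andP[].
  rewrite le_eqVlt => /predU1P[<- _|t0 t1]; first by rewrite scale0r addr0.
  by apply: (interior_mix pd) => //; [exact: interior_subset|rewrite t0].
move=> y Dy; have [|Dyb] := pselect (D° y); first exact: key.
rewrite (Gb _ (conj Dy Dyb)).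
apply: (@ge0_limit _ _ (zdot m (x - y))) => t t01.
have Dt := interior_mix pd Dy Dx t01.
apply: le_trans (G0 _ (interior_subset Dt)) _; apply: le_trans (key _ Dt) _.
by rewrite !zdotBr zdotDr zdotZr zdotBr; lra.
Qed.

Lemma corner_supg G x m : tropical_series D G -> D° x ->
  forall m0 s c, (\forall y \near x, G y = tropical_poly m0 s c y) ->
  m \in m0 :: s -> G x = c m + zdot m x -> supg D G x m.
Proof.
move=> GT Dx m0 s c Gc mS Gm; apply: series_supg => //.
apply: filterS Gc => z ->; have [le _] := trop_min m0 s c z.
by apply: le_trans (le _ mS) _; rewrite Gm /lf zdotBr; lra.
Qed.

(** Apply [coef_admissible] to the minimum [H] of [G] and [barrier Q]: it obeys the growth bounds of
    the barrier, lies below [G], and at each point whichever of the two is smaller supplies two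
    supergradients. *)
Lemma series_admissible G Q : tropical_series D G -> points Q `<=` corner_locus D G ->
  exists c, admissible D L A Q c /\ forall x, D x -> exists2 m, m \in A & lf c m x <= G x.
Proof.
move=> GT QG; have [_ G0 _ Gloc] := GT.
have Qc i : corner_locus D G (row i Q) by apply: QG; exists i.
have DQ i : D° (row i Q) by have [] := Qc i.
pose H x := Num.min (G x) (barrier Q x).
have HG x m : G x <= barrier Q x -> supg D G x m -> supg D H x m.
  by move=> le sG y Dy; rewrite /H (min_idPl le) ge_min sG.
have HB x m : barrier Q x <= G x -> supg D (barrier Q) x m -> supg D H x m.
  by move=> le sG y Dy; rewrite /H (min_idPr le) ge_min sG// orbT.
have Gex x : D° x -> exists m, supg D G x m.
  move=> Dx; have [m0 [s [c Gc]]] := Gloc _ Dx.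
  have [_ [m mS me]] := trop_min m0 s c x.
  by exists m; apply: (corner_supg GT Dx Gc mS); rewrite (nbhs_singleton Gc).
have [|||i|c [cQ cH]] := @coef_admissible R D V L N pd A HA H Q.
- by move=> y Dy; rewrite le_min G0// barrier_ge0.
- by move=> y s Dy sL; rewrite ge_min barrier_le// orbT.
- move=> x Dx; have [le|/ltW le] := leP (G x) (barrier Q x).
    by have [m /(HG _ _ le)] := Gex _ Dx; exists m.
  by have [m /(HB _ _ le)] := barrier_supg_ex Q x; exists m.
- split => //; have [le|/ltW le] := leP (G (row i Q)) (barrier Q (row i Q)).
    have [_ [m0 [s [c [Gc [m [m' [mS m'S mm' me me']]]]]]]] := Qc i.
    by exists m, m'; split => //; apply: HG => //; [exact: (corner_supg GT (DQ i) Gc mS me)|exact: (corner_supg GT (DQ i) Gc m'S me')].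
  have [m [m' [mm' sm sm']]] := barrier_corner Q i.
  by exists m, m'; split => //; exact: HB.
exists c; split => // x Dx; have [m mA mH] := cH _ Dx.
by exists m => //; apply: (le_trans mH); rewrite ge_min lexx.
Qed.

(** [tropical_poly] takes a first slope separately; [A] is nonempty by [slopes_cons], so the default
    of [head] never enters. *)
Definition Fm c := tropical_poly (head 0 A) (behead A) c.

Lemma slopes_cons : A = head 0 A :: behead A.
Proof.
have [s sL] := pd_L0 pd; have := @normal_slope R L N A HA _ sL.
by case: (A).
Qed.

Lemma Fm_min c x : (forall m, m \in A -> Fm c x <= lf c m x) /\
  exists2 m, m \in A & Fm c x = lf c m x.
Proof. by have := trop_min (head 0 A) (behead A) c x; rewrite -slopes_cons. Qed.

Lemma tieP c x m : tie A c x m <-> m \in A /\ Fm c x = lf c m x.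
Proof.
have [le [k kA ke]] := Fm_min c x; split.
  by move=> [mA mle]; split => //; apply/eqP; rewrite eq_le le//= ke mle.
by move=> [mA me]; split => // j jA; rewrite -me le.
Qed.

Lemma tie_ex c x : exists m, tie A c x m.
Proof. by have [_ [m mA me]] := Fm_min c x; exists m; apply/tieP. Qed.

Lemma admissible_Fm Q c x : admissible D L A Q c -> D x ->
  0 <= Fm c x /\ (~ D° x -> Fm c x = 0).
Proof.
move=> [ca cb _] Dx; have [le [k kA ke]] := Fm_min c x.
have F0 : 0 <= Fm c x by rewrite ke ca.
split => // Dix; apply/eqP; rewrite eq_le F0 andbT.
have [s sL s0x] := not_interior pd Dix.
apply: le_trans (le _ (normal_slope HA sL)) _.
rewrite /lf zdotMn; apply: (@le_trans _ _ (N%:R * af s x)); last by rewrite mulr_ge0_le0.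
by rewrite /af mulrDr lerD2r cb.
Qed.

Lemma admissible_series Q c : (forall i, D° (row i Q)) -> admissible D L A Q c ->
  tropical_series D (Fm c) /\ points Q `<=` corner_locus D (Fm c).
Proof.
move=> DQ cQ; split.
  split.
  - by apply: continuous_subspaceT; exact: continuous_trop.
  - by move=> x Dx; have [] := admissible_Fm cQ Dx.
  - by move=> x [Dx Dix]; have [_] := admissible_Fm cQ Dx; apply.
  - by move=> x _; exists (head 0 A), (behead A), c; by apply: filterE.
move=> _ [i _ <-]; split => //; exists (head 0 A), (behead A), c; split; first by apply: filterE.
have [_ _ /(_ i)[m [m' [mm' /tieP[mA me] /tieP[m'A m'e]]]]] := cQ.
by exists m, m'; rewrite -slopes_cons.
Qed.

Definition minimal_coef Q c := admissible D L A Q c /\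
  forall c', admissible D L A Q c' -> forall m, m \in A -> c m <= c' m.

(** The coefficientwise infimum inherits the inequalities; the ties need an argument. If [m] attains
    the minimum for [c] at a point, every admissible [c'] has some [k != m] with [lf c k <= lf c' m]
    there. Only finitely many [k] occur, so the lowest one serves all [c'] and is tied with [m]. *)
Lemma minimal_coef_ex Q : (forall i, D° (row i Q)) -> exists c, minimal_coef Q c.
Proof.
move=> DQ; have [c0 c0Q] := admissible_ex DQ.
pose E m := [set c m | c in admissible D L A Q].
have [z0 Dz0] := pd_ne pd.
have Ei m : m \in A -> has_inf (E m).
  move=> mA; split; first by exists (c0 m), c0.
  exists (- zdot m z0) => _ [c [ca _ _] <-].
  by have := ca _ _ mA (interior_subset Dz0); rewrite /lf; lra.
pose c m := inf (E m).
have cle c' m : admissible D L A Q c' -> m \in A -> c m <= c' m.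
  by move=> c'Q mA; apply: ge_inf; [case: (Ei _ mA)|exists c'].
have lec m b : m \in A -> (forall c', admissible D L A Q c' -> b <= c' m) -> b <= c m.
  move=> mA h; apply: lb_le_inf; first by case: (Ei _ mA).
  by move=> _ [c' c'Q <-]; exact: h.
exists c; split; last by move=> c' c'Q m mA; exact: cle.
split.
- move=> m x mA Dx; rewrite /lf -lerBlDr; apply: lec => // c' [ca _ _].
  by rewrite lerBlDr; exact: ca.
- by move=> s sL; apply: le_trans (cle _ _ c0Q (normal_slope HA sL)) _; case: c0Q => _ + _; apply.
move=> i; set x := row i Q.
have [m [mA mmin]] := tie_ex c x.
have other c' : admissible D L A Q c' -> exists k, [/\ k \in A, k != m & lf c k x <= lf c' m x].
  move=> c'Q; have [_ _ /(_ i)[k1 [k2 [k12 [k1A k1m] [k2A k2m]]]]] := c'Q.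
  have leK k : k \in A -> lf c k x <= lf c' k x by move=> kA; rewrite lerD2r cle.
  have [e|k1m'] := eqVneq k1 m.
    exists k2; split; rewrite // -?e 1?eq_sym//.
    by apply: le_trans (leK _ k2A) _; exact: k2m.
  by exists k1; split => //; apply: le_trans (leK _ k1A) _; exact: k1m.
have [k0 [k0A k0m _]] := other _ c0Q.
have k0f : k0 \in [seq k <- A | k != m] by rewrite mem_filter k0m.
have [k + kmin] := seq_argmin (fun k => lf c k x) k0f.
rewrite mem_filter => /andP[km kA].
have lekm : lf c k x <= lf c m x.
  rewrite -lerBlDr; apply: lec => // c' c'Q; rewrite lerBlDr.
  have [k' [k'A k'm /(le_trans _)]] := other _ c'Q; apply.
  by apply: kmin; rewrite mem_filter k'm.
exists m, k; split; first by rewrite eq_sym.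
- by split.
- by split => // j jA; apply: (le_trans lekm); exact: mmin.
Qed.

Lemma relaxation_minimal Q c x : (forall i, D° (row i Q)) -> minimal_coef Q c -> D x ->
  relaxation D (points Q) x = Fm c x.
Proof.
move=> DQ [cQ cmin] Dx; have [FT FQ] := admissible_series DQ cQ.
apply/eqP; rewrite eq_le; apply/andP; split.
  apply: ge_inf; last by exists (Fm c).
  by exists 0 => _ [G [[_ G0 _ _] _] <-]; exact: G0.
apply: lb_le_inf; first by exists (Fm c x), (Fm c).
move=> _ [G [GT GQ] <-].
have [c' [c'Q c'G]] := series_admissible GT GQ.
have [m mA mG] := c'G _ Dx; apply: le_trans mG.
have [le _] := Fm_min c x; apply: le_trans (le _ mA) _.
by rewrite lerD2r cmin.
Qed.

(** Otherwise, at every point, the tied slopes in [C] number zero or at least two, and lowering all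
    of [C] by a small [e] gives an admissible vector below the minimal one. *)
Lemma blocking Q c (C : seq lattice) m0 : minimal_coef Q c -> m0 \in C -> {subset C <= A} ->
  (forall m x, m \in C -> D x -> 0 < lf c m x) ->
  exists i m, [/\ m \in C, tie A c (row i Q) m & forall k, k \in C -> tie A c (row i Q) k -> k = m].
Proof.
move=> [cQ cmin] m0C CA Cpos; apply: contrapT => none.
have [ca cb cc] := cQ.
(* [e1] bounds the functions of [C] from below at the vertices, [e2] the gaps between tied and
   untied slopes at the points; [e] is below both bounds. *)
have [e1 e1pos e1le] : exists2 e, 0 < e & forall mv, mv \in [seq (m, v) | m <- C, v <- V] -> e <= lf c mv.1 mv.2.
  apply: seq_pos_lb => mv /allpairsP[[m v] /= [mC vV ->]] /=.
  by apply: Cpos => //; exact: pd_V pd _ vV.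
pose T := [seq t <- [seq (i, jk) | i <- enum 'I_N, jk <- [seq (j, k) | j <- A, k <- A]] |
  `[< tie A c (row t.1 Q) t.2.1 /\ ~ tie A c (row t.1 Q) t.2.2 >]].
have [e2 e2pos e2le] : exists2 e, 0 < e & forall t, t \in T -> e <= lf c t.2.2 (row t.1 Q) - lf c t.2.1 (row t.1 Q).
  apply: seq_pos_lb => -[i [j k]]; rewrite mem_filter => /andP[/asboolP /= [tj tk] /allpairsP[[i' jk'] /= [_ jk'A e]]].
  have [jA kA] : j \in A /\ k \in A.
    by move: jk'A; case: e => _ <- /allpairsP[[? ?] /= [? ? [-> ->]]].
  by rewrite subr_gt0; exact: tie_lt tj kA tk.
have e2P i j k : tie A c (row i Q) j -> k \in A -> ~ tie A c (row i Q) k -> lf c j (row i Q) + e2 <= lf c k (row i Q).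
  move=> tj kA tk; rewrite addrC -lerBrDr; apply: (e2le (i, (j, k))).
  rewrite mem_filter; apply/andP; split; first by apply/asboolP.
  apply/allpairsP; exists (i, (j, k)); split => //=; first by rewrite mem_enum.
  by apply/allpairsP; exists (j, k); split => //; exact: tj.1.
pose e := Num.min (e1 / 2) e2.
have e0 : 0 < e by rewrite lt_min divr_gt0.
have ee1 : e < e1.
  by apply: (@le_lt_trans _ _ (e1 / 2)); [rewrite ge_min lexx|rewrite ltr_pdivrMr// ltr_pMr// ltr1n].
have ee2 : e <= e2 by rewrite ge_min lexx orbT.
pose c' m := if m \in C then c m - e else c m.
have c'in m x : m \in C -> lf c' m x = lf c m x - e by move=> mC; rewrite /lf /c' mC; lra.
have c'out m x : m \notin C -> lf c' m x = lf c m x by move=> mC; rewrite /lf /c' (negPf mC).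
have c'ge m x : lf c m x - e <= lf c' m x.
  by have [mC|mC] := boolP (m \in C); [rewrite c'in|rewrite c'out//; lra].
have c'Q : admissible D L A Q c'.
  split.
  - move=> m x mA Dx; have [mC|mC] := boolP (m \in C); last by rewrite c'out// ca.
    rewrite /lf /c' mC; apply/ltW/(pd_pos pd) => // v vV.
    have := e1le (m, v); rewrite /lf /= => /(_ _)/wrap[].
      by apply/allpairsP; exists (m, v).
    by lra.
  - by move=> s sL; apply: le_trans (cb _ sL); rewrite /c'; case: ifP => _ //; lra.
  move=> i; have [m1 [m2 [m12 t1 t2]]] := cc i.
  (* If some tied slope is lowered, at least two are, and they become the new minimum; if none is,
     the gap [e2] keeps the old ties lowest. *)
  have [[m mC tm]|noC] := pselect (exists2 m, m \in C & tie A c (row i Q) m).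
    have [k [kC tk km]] : exists k, [/\ k \in C, tie A c (row i Q) k & k <> m].
      apply: contrapT => h; apply: none; exists i, m; split => // k kC tk.
      by apply: contrapT => km; apply: h; exists k.
    have low j : j \in C -> tie A c (row i Q) j -> tie A c' (row i Q) j.
      move=> jC [jA jle]; split => // l lA; rewrite c'in//.
      by apply: le_trans (c'ge _ _); rewrite lerD2r jle.
    by exists m, k; split; [apply/eqP => /esym|exact: low..].
  have keep j : tie A c (row i Q) j -> tie A c' (row i Q) j.
    move=> tj; have jC : j \notin C by apply/negP => jC; apply: noC; exists j.
    split; first exact: tj.1; move=> l lA; rewrite c'out//.
    have [lC|lC] := boolP (l \in C); last by rewrite c'out// tj.2.
    rewrite c'in//.
    have : ~ tie A c (row i Q) l by move=> tl; apply: noC; exists l.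
    by move=> /(e2P _ _ _ tj lA); lra.
  by exists m1, m2; split => //; exact: keep.
have := cmin _ c'Q _ (CA _ m0C); rewrite /c' m0C; lra.
Qed.
End Minimal.

(** * Generic configurations and the deformation of coefficients *)

Section Generic.
Variables (R : realType) (N : nat).
Implicit Types (K : 'M[int]_(N, 2)) (P Q : config R N) (J : {set 'I_N}) (x y : R) (n : lattice).

Definition lin K P : R := \sum_i zdot (row i K) (row i P).

Definition generic P := forall K (q : int), K != 0 -> lin K P != q%:~R.

Lemma zdotMz n (a : int) (x : plane R) : zdot (n *~ a) x = a%:~R * zdot n x.
Proof.
case: a => a; first by rewrite -pmulrn zdotMn.
rewrite NegzE mulrNz -pmulrn; have := zdotBl 0 (n *+ a.+1) x; rewrite sub0r => ->.
by rewrite zdot0l sub0r zdotMn rmorphN mulNr.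
Qed.

Lemma lattice_mulz n (d : int) b : (n *~ d) 0 b = n 0 b * d.
Proof.
case: d => k; first by rewrite -pmulrn mulmxnE -mulr_natr natz.
by rewrite NegzE mulrNz -pmulrn mxE mulmxnE -mulr_natr natz mulrN.
Qed.

Lemma linD K K' P : lin (K + K') P = lin K P + lin K' P.
Proof. by rewrite -big_split; apply: eq_bigr => i _; rewrite linearD zdotDl. Qed.

Lemma linMz K (a : int) P : lin (K *~ a) P = a%:~R * lin K P.
Proof. by rewrite mulr_sumr; apply: eq_bigr => i _; rewrite raddfMz zdotMz. Qed.

Lemma lin0 P : lin 0 P = 0.
Proof. by apply: big1 => i _; rewrite linear0 zdot0l. Qed.

Definition single (i : 'I_N) n : 'M[int]_(N, 2) := \matrix_(a, b) (if a == i then n 0 b else 0).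

Lemma lin_single i n P : lin (single i n) P = zdot n (row i P).
Proof.
rewrite /lin (bigD1 i)//= big1 ?addr0 => [|j /negPf ji].
  by congr (zdot _ _); apply/rowP => b; rewrite !mxE eqxx.
by rewrite [row j _](_ : _ = 0) ?zdot0l//; apply/rowP => b; rewrite !mxE ji.
Qed.

(* The rational span of 1 and the coordinates of the points p_i, i in J. *)
Definition qspan P J x := exists (d : int) K (q : int),
  [/\ d != 0, forall i, i \notin J -> row i K = 0 & d%:~R * x = lin K P + q%:~R].

Lemma qspanD P J x y : qspan P J x -> qspan P J y -> qspan P J (x + y).
Proof.
move=> [d [K [q [d0 KJ e]]]] [d' [K' [q' [d0' KJ' e']]]].
exists (d * d'), (K *~ d' + K' *~ d), (q * d' + q' * d); split; first exact: mulf_neq0.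
  by move=> i iJ; rewrite linearD !raddfMz /= KJ// KJ'// !mul0rz addr0.
rewrite linD !linMz intrD !intrM mulrDr.
transitivity (d'%:~R * (d%:~R * x) + d%:~R * (d'%:~R * y)); first by ring.
by rewrite e e'; ring.
Qed.

Lemma qspanM P J x (a : int) : qspan P J x -> qspan P J (a%:~R * x).
Proof.
move=> [d [K [q [d0 KJ e]]]]; exists d, (K *~ a), (q * a); split => //.
  by move=> i iJ; rewrite raddfMz /= KJ// mul0rz.
by rewrite linMz intrM mulrCA e; ring.
Qed.

Lemma qspanN P J x : qspan P J x -> qspan P J (- x).
Proof. by move=> /(qspanM (-1)); rewrite mulN1r. Qed.

Lemma qspan_rat P J (q : rat) : qspan P J (ratr q).
Proof.
exists (denq q), 0, (numq q); split; first by rewrite denq_eq0.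
  by move=> i _; rewrite linear0.
by rewrite lin0 add0r /ratr mulrC divfK// intr_eq0 denq_eq0.
Qed.

Lemma qspan0 P J : qspan P J 0.
Proof. by rewrite -(rmorph0 (@ratr R)); exact: qspan_rat. Qed.

Lemma qspan_dot P J i n : i \in J -> qspan P J (zdot n (row i P)).
Proof.
move=> iJ; exists 1, (single i n), 0; split => //.
  move=> j jJ; apply/rowP => b; rewrite !mxE; case: eqP => // e.
  by rewrite e iJ in jJ.
by rewrite lin_single addr0 mul1r.
Qed.

Lemma qspanS P J J' x : J \subset J' -> qspan P J x -> qspan P J' x.
Proof.
move=> /fintype.subsetP JJ [d [K [q [d0 KJ e]]]]; exists d, K, q; split => // i iJ.
by apply: KJ; apply: contra iJ; exact: JJ.
Qed.

Lemma qspan_sum P J (T : eqType) (s : seq T) (f : T -> R) :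
  (forall i, i \in s -> qspan P J (f i)) -> qspan P J (\sum_(i <- s) f i).
Proof.
elim: s => [|a s IH] h; first by rewrite big_nil; exact: qspan0.
rewrite big_cons; apply: qspanD; first by apply: h; rewrite mem_head.
by apply: IH => i is_; apply: h; rewrite inE is_ orbT.
Qed.

(** Clearing the denominator [d] yields an integer relation whose row [i] is [d] times [n], since
    [K] vanishes in that row; genericity makes it trivial. *)
Lemma generic_qspan P J i n : generic P -> i \notin J -> qspan P J (zdot n (row i P)) -> n = 0.
Proof.
move=> gP iJ [d [K [q [d0 KJ e]]]]; apply/eqP; apply: contraT => n0.
pose K' := single i (n *~ d) + K *~ (-1).
have K'0 : K' != 0.
  apply/eqP => /(congr1 (row i)); rewrite linearD raddfMz /= KJ// mul0rz addr0 linear0.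
  have -> : row i (single i (n *~ d)) = n *~ d by apply/rowP => b; rewrite !mxE eqxx.
  move=> /rowP nd; move/eqP: n0; apply; apply/rowP => b; rewrite mxE.
  have := nd b; rewrite mxE lattice_mulz => /eqP.
  by rewrite mulf_eq0 (negPf d0) orbF => /eqP.
have := gP K' q K'0; rewrite linD linMz lin_single zdotMz e => /negP[]; apply/eqP.
by rewrite intrN; ring.
Qed.

Lemma continuous_zdot_row n i : continuous (fun Q => zdot n (row i Q)).
Proof.
move=> Q; rewrite (_ : (fun Q => _) = (fun Q : config R N => (n 0 0)%:~R * Q i 0 + (n 0 1)%:~R * Q i 1)).
  by apply: (@cvgD _ _ _ (nbhs Q)); apply: (@cvgM _ _ (nbhs Q));
    [exact: cvg_cst|exact: coord_continuous|exact: cvg_cst|exact: coord_continuous].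
by apply/funext => Q'; rewrite zdotE !mxE.
Qed.
End Generic.

(** * Removing slopes one at a time *)

Section Peel.
Variables (R : realType) (N : nat) (A B : seq lattice) (c : lattice -> R) (P : config R N).
Hypothesis gP : generic P.
Hypothesis two : forall i, exists m m', [/\ m != m', tie A c (row i P) m & tie A c (row i P) m'].
Hypothesis block : forall (C : seq lattice) m0, m0 \in C -> {subset C <= B} ->
  exists i m, [/\ m \in C, tie A c (row i P) m & forall k, k \in C -> tie A c (row i P) k -> k = m].

Lemma tie_lf x m k : tie A c x m -> tie A c x k -> lf c m x = lf c k x.
Proof. by move=> [mA mm] [kA km]; apply/eqP; rewrite eq_le mm// km. Qed.

(* [C] are the slopes not yet removed and [J] the points not yet used. *)
Lemma peel (n : nat) (C : seq lattice) (J : {set 'I_N}) : size C = n -> uniq C -> {subset C <= B} ->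
  (forall m, m \in A -> m \notin C -> qspan P J (c m)) ->
  (forall i m, i \in J -> m \in C -> ~ tie A c (row i P) m) ->
  [/\ forall i, i \notin J -> exists m k, m != k /\ forall l, tie A c (row i P) l <-> l = m \/ l = k,
    forall al : lattice -> int, qspan P J (\sum_(m <- undup A) (al m)%:~R * c m) ->
      forall m, m \in C -> m \in A -> al m = 0 &
    forall c0 : config R N -> lattice -> R,
      (forall m, m \in A -> m \notin C -> {for P, continuous (c0^~ m)} /\ c0 P m = c m) ->
      exists ct : config R N -> lattice -> R, [/\ forall Q m, m \notin C -> ct Q m = c0 Q m,
        forall m, m \in A -> {for P, continuous (ct^~ m)} /\ ct P m = c m &
        forall Q i m k, i \notin J -> tie A c (row i P) m -> tie A c (row i P) k ->
          lf (ct Q) m (row i Q) = lf (ct Q) k (row i Q)]].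
Proof.
elim: n C J => [|n IH] C J Cn Cu CB CJ JC.
  have C0 : C = [::] by exact: size0nil.
  have Jall i : i \in J.
    apply: contraT => iJ; have [m [m' [/eqP mm' tm tm']]] := two i; exfalso; apply: mm'.
    apply/eqP; rewrite -subr_eq0; apply/eqP; apply: (generic_qspan gP iJ).
    have -> : zdot (m - m') (row i P) = c m' - c m.
      by have := tie_lf tm tm'; rewrite /lf zdotBl; lra.
    by apply: qspanD; [|apply: qspanN]; apply: CJ; rewrite ?C0//; [case: tm'|case: tm].
  split=> [i|al _ m|c0 h]; rewrite ?Jall// ?C0//.
  by exists c0; split => // [m mA|Q i m k]; [apply: h; rewrite ?C0|rewrite Jall].
have [m0 m0C] : exists m0, m0 \in C by case: (C) Cn => // a s _; exists a; rewrite mem_head.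
have [i [m [mC tm mu]]] := block m0C CB.
have iJ : i \notin J by apply/negP => iJ; exact: (JC i m iJ mC tm).
have [k [km tk]] : exists k, k != m /\ tie A c (row i P) k.
  have [a [b [ab ta tb]]] := two i.
  have [e|am] := eqVneq a m; last by exists a.
  by exists b; split => //; rewrite eq_sym -e.
have notC l : tie A c (row i P) l -> l != m -> l \notin C.
  by move=> tl lm; apply/negP => lC; move/eqP: lm; apply; exact: mu.
have kC := notC _ tk km.
have kA : k \in A by case: tk.
have tieE l : tie A c (row i P) l <-> l = m \/ l = k.
  split=> [tl|[->|->]//]; have [|lm] := eqVneq l m; first by left.
  right; apply/eqP; rewrite -subr_eq0; apply/eqP; apply: (generic_qspan gP iJ).
  have -> : zdot (l - k) (row i P) = c k - c l.
    by have := tie_lf tl tk; rewrite /lf zdotBl; lra.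
  apply: qspanD; [|apply: qspanN]; apply: CJ => //; first by case: tl.
  exact: notC.
have cm : c m = c k + zdot (k - m) (row i P).
  by have := tie_lf tm tk; rewrite /lf zdotBl; lra.
pose C' := rem m C; pose J' := (i |: J)%SET.
have C'C : {subset C' <= C} by exact: mem_rem.
have JJ' : J \subset J' by exact: finset.subsetUr.
have C'P l : l \notin C' -> l = m \/ l \notin C.
  have [->|lm] := eqVneq l m; first by left.
  by rewrite mem_rem_uniq// inE lm /=; right.
have mC' : m \notin C' by rewrite mem_rem_uniq// inE eqxx.
have [||||| IHa IHb IHc] := IH C' J'.
- by rewrite size_rem// Cn.
- exact: rem_uniq.
- by move=> l /C'C /CB.
- move=> l lA /C'P[->|lC]; last by apply: qspanS JJ' _; exact: CJ.
  rewrite cm; apply: qspanD; last by apply: qspan_dot; rewrite !inE eqxx.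
  by apply: qspanS JJ' _; exact: CJ.
- move=> j l; rewrite in_setU1 => /predU1P[->|jJ] lC'; last by apply: JC => //; exact: C'C.
  by move=> /(mu _ (C'C _ lC')) e; move: lC'; rewrite e (negPf mC').
split.
- move=> j jJ; have [->|ji] := eqVneq j i; last by apply: IHa; rewrite !inE negb_or ji.
  by exists m, k; rewrite eq_sym.
- move=> al alS.
  have alC' l : l \in C' -> l \in A -> al l = 0 by apply: IHb; exact: qspanS JJ' _.
  move=> l lC lA; have [lC'|/C'P[lm|]] := boolP (l \in C'); [exact: alC'| |by rewrite lC].
  rewrite {}lm in lC lA *.
  have : qspan P J ((al m)%:~R * c m).
    have mU : m \in undup A by rewrite mem_undup.
    have rest : qspan P J (\sum_(l <- rem m (undup A)) (al l)%:~R * c l).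
      apply: qspan_sum => j; rewrite mem_rem_uniq ?undup_uniq// !inE mem_undup => /andP[jm jA].
      have [jC'|/C'P[e|jC]] := boolP (j \in C').
      + by rewrite (alC' j) ?mul0r//; exact: qspan0.
      + by rewrite e eqxx in jm.
      + by apply: qspanM; exact: CJ.
    have := qspanD alS (qspanN rest).
    by rewrite (perm_big _ (perm_to_rem mU)) /= big_cons addrK.
  rewrite cm mulrDr => h.
  have := qspanD h (qspanN (qspanM (al m) (CJ _ kA kC))).
  rewrite addrAC subrr add0r -zdotMz => /(generic_qspan gP iJ) kmz.
  apply/eqP; apply: contraT => al0; move/negP: km; case; rewrite -subr_eq0; apply/eqP/rowP => b.
  have /eqP := congr1 (fun n : lattice => n 0 b) kmz.
  by rewrite lattice_mulz [X in _ == X]mxE mulf_eq0 (negPf al0) orbF [RHS]mxE => /eqP.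
move=> c0 c0P.
(* The tie of [m] and [k] at the moved point is solved for the coefficient of [m]. *)
pose c1 Q l := if l == m then c0 Q k + zdot (k - m) (row i Q) else c0 Q l.
have [|ct [ct1 ct2 ct3]] := IHc c1.
  move=> l lA lC'; rewrite /c1; have [->|lm] := eqVneq l m.
    have [kc ke] := c0P _ kA kC; split; last by rewrite ke.
    by apply: (@cvgD _ _ _ (nbhs P)) => //; exact: continuous_zdot_row.
  by case: (C'P _ lC') => [/eqP|lC]; [rewrite (negPf lm)|exact: c0P].
exists ct; split => //.
  move=> Q l lC; rewrite ct1; last by apply: contra lC; exact: C'C.
  by rewrite /c1; case: eqP => // e; rewrite e mC in lC.
move=> Q j l l' jJ; have [->|ji] := eqVneq j i; last by apply: ct3; rewrite !inE negb_or ji.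
have kC' : k \notin C' by apply: contra kC; exact: C'C.
have e : lf (ct Q) m (row i Q) = lf (ct Q) k (row i Q).
  rewrite /lf !ct1// /c1 eqxx (negPf km) zdotBl; lra.
by move=> /tieE[->|->] /tieE[->|->].
Qed.
End Peel.

(** * Minimality of the deformed coefficients *)

Section Deform.
Variables (R : realType) (D : set (plane R)) (V : seq (plane R)) (L : seq (lattice * R)) (N : nat).
Hypothesis pd : polygon_data D V L.
Variable A : seq lattice.
Hypothesis HA : slopes L N A.
Variables (P : config R N) (c : lattice -> R).
Hypothesis gP : generic P.
Hypothesis DP : forall i, D° (row i P).
Hypothesis cmin : minimal_coef D L A P c.
Implicit Types (m k : lattice) (x y z v : plane R) (Q : config R N).

Definition free_slopes := [seq m <- undup A | `[< forall x, D x -> 0 < lf c m x >]].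
Let B := free_slopes.

Lemma free_slopesP m : m \in B <-> m \in A /\ forall x, D x -> 0 < lf c m x.
Proof.
rewrite mem_filter mem_undup; split; first by move=> /andP[/asboolP].
by move=> [mA h]; rewrite mA andbT; apply/asboolP.
Qed.

(** An affine function positive at all vertices is positive on the polygon, so a nonnegative one
    that is not free vanishes at a vertex. *)
Lemma fixed_vertex m : m \in A -> m \notin B -> exists2 v, v \in V & lf c m v = 0.
Proof.
move=> mA mB; apply: contrapT => h; move/negP: mB; apply; apply/free_slopesP; split => //.
move=> x Dx; apply: (pd_pos pd) Dx => v vV; rewrite -/(lf c m v) lt_neqAle.
have [[ca _ _] _] := cmin; rewrite ca ?andbT//; last exact: pd_V pd _ vV.
by apply/eqP => e; apply: h; exists v.
Qed.

Lemma fixed_rational m J : m \in A -> m \notin B -> qspan P J (c m).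
Proof.
move=> mA /(fixed_vertex mA)[v vV e].
have [q0 e0] := pd_rat pd vV 0; have [q1 e1] := pd_rat pd vV 1.
have -> : c m = ratr (- ((m 0 0)%:~R * q0 + (m 0 1)%:~R * q1)).
  move: e; rewrite /lf zdotE e0 e1 rmorphN rmorphD !rmorphM /= !ratr_int; lra.
exact: qspan_rat.
Qed.

Lemma free_block (C : seq lattice) m0 : m0 \in C -> {subset C <= B} ->
  exists i m, [/\ m \in C, tie A c (row i P) m & forall k, k \in C -> tie A c (row i P) k -> k = m].
Proof.
move=> m0C CB; apply: (blocking pd cmin m0C); first by move=> m /CB/free_slopesP[].
by move=> m x /CB/free_slopesP[_]; apply.
Qed.

Let two i : exists m m', [/\ m != m', tie A c (row i P) m & tie A c (row i P) m'].
Proof. by have [[_ _ h] _] := cmin; exact: h. Qed.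

Let B_uniq : uniq B. Proof. by rewrite filter_uniq// undup_uniq. Qed.

Let B_rational m : m \in A -> m \notin B -> qspan P finset.set0 (c m).
Proof. exact: fixed_rational. Qed.

Let none_used (i : 'I_N) m : i \in finset.set0 -> m \in B -> ~ tie A c (row i P) m.
Proof. by rewrite inE. Qed.

Let peelB := @peel R N A B c P gP two free_block (size B) B finset.set0 erefl B_uniq
  (fun m h => h) B_rational none_used.

Lemma tie_pair i : exists m k, m != k /\ forall l, tie A c (row i P) l <-> l = m \/ l = k.
Proof. by have [h _ _] := peelB; apply: h; rewrite inE. Qed.

Lemma free_independent (al : lattice -> int) : \sum_(m <- undup A) (al m)%:~R * c m = 0 ->
  forall m, m \in B -> al m = 0.
Proof.
have [_ h _] := peelB; move=> e m mB; have [mA _] := (free_slopesP m).1 mB.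
by apply: (h al _ m mB mA); rewrite e; exact: qspan0.
Qed.

Lemma deformation_ex : exists ct : config R N -> lattice -> R,
  [/\ forall Q m, m \notin B -> ct Q m = c m,
      forall m, m \in A -> {for P, continuous (ct^~ m)} /\ ct P m = c m &
      forall Q i m k, tie A c (row i P) m -> tie A c (row i P) k ->
        lf (ct Q) m (row i Q) = lf (ct Q) k (row i Q)].
Proof.
have [_ _ h] := peelB; have [|ct [c1 c2 c3]] := h (fun _ => c).
  by move=> m _ _; split => //; exact: (@cst_continuous (config R N) R (c m) P).
exists ct; split; [exact: c1|exact: c2|] => Q i m k; apply: c3; first by rewrite inE.
Qed.

Variable ct : config R N -> lattice -> R.
Hypothesis ct_fix : forall Q m, m \notin B -> ct Q m = c m.
Hypothesis ct_cont : forall m, m \in A -> {for P, continuous (ct^~ m)} /\ ct P m = c m.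
Hypothesis ct_tie : forall Q i m k, tie A c (row i P) m -> tie A c (row i P) k ->
        lf (ct Q) m (row i Q) = lf (ct Q) k (row i Q).

Lemma near_free : \forall Q \near P, forall m, m \in B -> forall x, D x -> 0 < lf (ct Q) m x.
Proof.
have : \forall Q \near P, forall mv, mv \in [seq (m, v) | m <- B, v <- V] -> 0 < lf (ct Q) mv.1 mv.2.
  apply: (@near_all _ (nbhs P) _ _ _ (fun mv Q => 0 < lf (ct Q) mv.1 mv.2)) => -[m v].
  move=> /allpairsP[[m' v'] /= [mB vV [? ?]]]; subst m' v'.
  have [mA mpos] := (free_slopesP _).1 mB; have [mc me] := ct_cont mA.
  apply: (@near_gt0 R (config R N) (fun Q => lf (ct Q) m v)); last by rewrite /lf me; apply: mpos; exact: pd_V pd _ vV.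
  by apply: (@cvgD _ _ _ (nbhs P)) => //; exact: cvg_cst.
apply: filterS => Q h m mB x; apply: (pd_pos pd) => v vV.
by apply: (h (m, v)); apply/allpairsP; exists (m, v).
Qed.

Lemma near_interior : \forall Q \near P, forall i, D° (row i Q).
Proof.
have : \forall Q \near P, forall si, si \in [seq (s, i) | s <- L, i <- enum 'I_N] -> 0 < af si.1 (row si.2 Q).
  apply: (@near_all _ (nbhs P) _ _ _ (fun si Q => 0 < af si.1 (row si.2 Q))) => -[s i].
  move=> /allpairsP[[s' i'] /= [sL _ [? ?]]]; subst s' i'.
  apply: (@near_gt0 R (config R N) (fun Q => af s (row i Q))); last exact: (pd_Li pd _).1 (DP _) _ sL.
  by apply: (@cvgD _ _ _ (nbhs P)); [exact: cvg_cst|exact: continuous_zdot_row].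
apply: filterS => Q h i; apply/(pd_Li pd) => s sL; apply: (h (s, i)).
by apply/allpairsP; exists (s, i); split; rewrite ?mem_enum.
Qed.

Lemma near_nontie : \forall Q \near P, forall i m k, tie A c (row i P) m -> k \in A ->
  ~ tie A c (row i P) k -> lf (ct Q) m (row i Q) < lf (ct Q) k (row i Q).
Proof.
pose T := [seq t <- [seq (i, jk) | i <- enum 'I_N, jk <- [seq (j, k) | j <- A, k <- A]] |
  `[< tie A c (row t.1 P) t.2.1 /\ ~ tie A c (row t.1 P) t.2.2 >]].
have : \forall Q \near P, forall t, t \in T ->
    0 < lf (ct Q) t.2.2 (row t.1 Q) - lf (ct Q) t.2.1 (row t.1 Q).
  apply: (@near_all _ (nbhs P) _ _ _ (fun t Q => 0 < lf (ct Q) t.2.2 (row t.1 Q) - lf (ct Q) t.2.1 (row t.1 Q))).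
  move=> [i [j k]]; rewrite mem_filter => /andP[/asboolP /= [tj tk] /allpairsP[[i' jk'] /= [_ jk'A e]]].
  have [jA kA] : j \in A /\ k \in A.
    by move: jk'A; case: e => _ <- /allpairsP[[? ?] /= [? ? [-> ->]]].
  have lfc l : l \in A -> {for P, continuous (fun Q => lf (ct Q) l (row i Q))}.
    move=> lA; apply: (@cvgD _ _ _ (nbhs P)); last exact: continuous_zdot_row.
    by have [] := ct_cont lA.
  apply: (@near_gt0 R (config R N) (fun Q => lf (ct Q) k (row i Q) - lf (ct Q) j (row i Q))); first by apply: (@cvgB _ _ _ (nbhs P)); exact: lfc.
  have lfe l : l \in A -> lf (ct P) l (row i P) = lf c l (row i P).
    by move=> lA; rewrite /lf (ct_cont lA).2.
  by rewrite !lfe// subr_gt0; exact: tie_lt tj kA tk.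
apply: filterS => Q h i m k tm kA tk; rewrite -subr_gt0; apply: (h (i, (m, k))).
rewrite mem_filter; apply/andP; split; first by apply/asboolP.
apply/allpairsP; exists (i, (m, k)); split => //=; first by rewrite mem_enum.
by apply/allpairsP; exists (m, k); split => //; exact: tm.1.
Qed.

Lemma deform_tie Q : (forall i m k, tie A c (row i P) m -> k \in A ->
  ~ tie A c (row i P) k -> lf (ct Q) m (row i Q) < lf (ct Q) k (row i Q)) ->
  forall i, tie A (ct Q) (row i Q) = tie A c (row i P).
Proof.
move=> h i; have [m [_ [_ tm _]]] := two i.
apply/seteqP; split => k tk.
  apply: contrapT => ntk; have := h i m k tm tk.1 ntk.
  by rewrite ltNge tk.2//; exact: tm.1.
split; first exact: tk.1.
move=> l lA; have [tl|ntl] := pselect (tie A c (row i P) l); first by rewrite (ct_tie Q tk tl).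
by apply: ltW; exact: h.
Qed.

(** A maximum principle. If an admissible [c'] is lower somewhere, let [C] be the slopes where
    [ct Q - c'] is largest. A function vanishing at a vertex cannot be lowered, so [C] is free and
    some point has a single tied slope [m] in [C]. A second slope tied there for [c'] would have to
    be tied at [P] and belong to [C] as well. *)
Lemma deform_minimal : \forall Q \near P, minimal_coef D L A Q (ct Q).
Proof.
have [[ca cb cc] _] := cmin.
have := near_nontie; have := near_free; apply: filterS2 => Q hB hT.
have hTE := deform_tie hT.
split.
  split.
  - move=> m x mA Dx; have [mB|mB] := boolP (m \in B); first exact/ltW/hB.
    by rewrite /lf ct_fix//; exact: ca.
  (* The function of slope [s.1 *+ N] is at most 0 where the side touches the polygon, so this slope
     is not free. *)
  - move=> s sL; rewrite ct_fix; first exact: cb.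
    apply/negP => /free_slopesP[_ pos]; have [x Dx sx] := pd_touch pd sL.
    have := pos _ Dx; rewrite ltNge => /negP; apply.
    rewrite /lf zdotMn; have := cb _ sL; have : N%:R * af s x = 0 by rewrite sx mulr0.
    by rewrite /af; lra.
  - by move=> i; rewrite hTE; exact: cc.
move=> c' [ca' cb' cc'] m1 m1A; rewrite leNgt; apply/negP => neg.
pose d m := ct Q m - c' m.
have [m2 m2A m2max] := seq_argmax d m1A.
have d0 : 0 < d m2 by apply: lt_le_trans (m2max _ m1A); rewrite subr_gt0.
pose C := [seq m <- A | d m == d m2].
have m2C : m2 \in C by rewrite mem_filter eqxx.
have CB : {subset C <= B}.
  move=> m; rewrite mem_filter => /andP[/eqP dm mA]; apply: contraT => mB.
  have [v vV e] := fixed_vertex mA mB.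
  have := ca' m v mA (pd_V pd vV); move: e d0; rewrite -dm /d ct_fix// /lf; lra.
have [i [m [mC tm mu]]] := free_block m2C CB.
have mA : m \in A by case: tm.
have dm : d m = d m2 by move: mC; rewrite mem_filter => /andP[/eqP].
have [k [km tk]] : exists k, k != m /\ tie A c' (row i Q) k.
  have [a [b [ab ta tb]]] := cc' i.
  have [e|am] := eqVneq a m; last by exists a.
  by exists b; split => //; rewrite eq_sym -e.
have kA : k \in A by case: tk.
have := tk.2 _ mA; have dk := m2max _ kA.
have lfd l : lf c' l (row i Q) = lf (ct Q) l (row i Q) - d l by rewrite /lf /d; lra.
rewrite !lfd => le.
have [tk'|ntk] := pselect (tie A c (row i P) k); last by have := hT i m k tm kA ntk; lra.
have e := ct_tie Q tm tk'.
move/eqP: km; apply; apply: mu => //; rewrite mem_filter kA andbT eq_le dk /=; lra.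
Qed.
End Deform.

(** * Absorbing coefficient changes by a translation *)

Lemma clear_denominators (n : nat) (b : 'I_n -> rat) :
  exists (d : int) (a : 'I_n -> int), d != 0 /\ forall j, (a j)%:~R = d%:~R * b j :> rat.
Proof.
exists (\prod_j denq (b j)), (fun j => numq (b j) * \prod_(k | k != j) denq (b k)); split.
  by apply/prodf_neq0 => j _; rewrite denq_eq0.
by move=> j; rewrite [in RHS](bigD1 j)//= !intrM numqE; ring.
Qed.

Section Solve.
Variables (R : realType) (A B : seq lattice) (T : pred lattice).
Hypothesis Au : uniq A.
Hypothesis indep : forall al : lattice -> int, (forall m, ~~ T m -> al m = 0) ->
  \sum_(m <- A) al m = 0 -> \sum_(m <- A) m *~ al m = 0 -> forall m, m \in B -> al m = 0.

(* Coefficient changes supported on [B] can be absorbed, on [T], by a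
   translation depending linearly on them: by [indep] they are orthogonal to all
   rational affine dependencies of [T]. *)
Lemma absorb_translation : exists (g : 'I_(size A) -> plane R) (h : 'I_(size A) -> R),
  forall e : lattice -> R, (forall m, m \notin B -> e m = 0) -> forall m, m \in A -> T m ->
  zdot m (\sum_(j < size A) e A`_j *: g j) + e m = \sum_(j < size A) e A`_j * h j.
Proof.
set n := size A.
(* The columns are the slopes in [T] extended by 1, so the row space consists of the restrictions to
   [T] of affine functions of the slope. [W] is rational, hence so is its cokernel. *)
pose W : 'M[rat]_(3, n) := \matrix_(a, j) (if T A`_j then
  (if a == 0 then (A`_j 0 0)%:~R else if a == 1 then (A`_j 0 1)%:~R else 1) else 0).
pose WR := map_mx ratr W : 'M[R]_(3, n).
pose p := pinvmx WR.
pose g (j : 'I_n) : plane R := if T A`_j then \row_b (if b == 0 then - p j 0 else - p j 1) else 0.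
exists g, (fun j : 'I_n => if T A`_j then p j (lift 0 1) else 0).
move=> e eB m mA Tm.
pose e' : 'rV[R]_n := \row_j (if T A`_j then e A`_j else 0).
have W0 i : W 0 i = if T A`_i then (A`_i 0 0)%:~R else 0 by rewrite mxE.
have W1 i : W 1 i = if T A`_i then (A`_i 0 1)%:~R else 0 by rewrite mxE.
have W2 i : W (lift 0 1) i = if T A`_i then 1 else 0 by rewrite mxE.
(* Membership in the row space is orthogonality to the cokernel. Each cokernel column, cleared of
   denominators, is a dependency [al], which [indep] makes vanish on [B], while [e] vanishes off
   [B]. *)
have sub : (e' <= WR)%MS.
  rewrite submxE /WR -map_cokermx; apply/eqP/rowP => l; rewrite mxE [RHS]mxE big1// => j _.
  rewrite [X in X * _]mxE [X in _ * X]mxE; case: ifPn => [Tj|_]; last by rewrite mul0r.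
  have [jB|/eB ->] := boolP (A`_j \in B); last by rewrite mul0r.
  set K := cokermx W.
  have [d [a [d0 aE]]] := clear_denominators (fun j : 'I_n => K j l).
  have K0 i : \sum_(j < n) W i j * K j l = 0.
    by have := congr1 (fun M : 'M[rat]_(3, n) => M i l) (mulmx_coker W); rewrite !mxE.
  pose al k := \sum_(j < n) (if (A`_j == k) && T k then a j else 0).
  have alE (i : 'I_n) : al A`_i = if T A`_i then a i else 0.
    rewrite /al (bigD1 i)//= eqxx /= big1 ?addr0// => k ki.
    by move: ki; rewrite -val_eqE => /negPf kv; rewrite nth_uniq// kv.
  have big (M : zmodType) (f : lattice -> M) : \sum_(k <- A) f k = \sum_(j < n) f A`_j.
    by rewrite (big_nth 0) big_mkord.
  have al0 : al A`_j = 0.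
    apply: indep => //.
    - by move=> k /negPf Tk; apply: big1 => i _; rewrite Tk andbF.
    - apply: (@intr_inj rat); rewrite big rmorph_sum /= (eq_bigr (fun i => d%:~R * (W (lift 0 1) i * K i l))).
        by rewrite -mulr_sumr K0 mulr0.
      by move=> i _; rewrite alE W2; case: ifP => _; rewrite ?aE; ring.
    - apply/rowP => b; rewrite big summxE [RHS]mxE.
      apply: (@intr_inj rat); rewrite rmorph_sum /=.
      case: (ord2P b) => ->.
        rewrite (eq_bigr (fun i => d%:~R * (W 0 i * K i l))).
          by rewrite -mulr_sumr K0 mulr0.
        by move=> i _; rewrite lattice_mulz alE W0 intrM; case: ifP => _; rewrite ?aE; ring.
      rewrite (eq_bigr (fun i => d%:~R * (W 1 i * K i l))).
        by rewrite -mulr_sumr K0 mulr0.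
      by move=> i _; rewrite lattice_mulz alE W1 intrM; case: ifP => _; rewrite ?aE; ring.
  have : d%:~R * K j l = 0 by rewrite -aE; move: al0; rewrite alE Tj => ->.
  move=> /eqP; rewrite mulf_eq0 intr_eq0 (negPf d0) /= => /eqP ->.
  by rewrite rmorph0 mulr0.
have uE := mulmxKpV sub.
have mn : (index m A < n)%N by rewrite index_mem.
have AE : A`_(Ordinal mn) = m by rewrite /= nth_index.
(* The first two components of the solution give minus the translation, the third one the common
   shift. *)
pose U a := \sum_(j < n) e' 0 j * p j a.
have key : (m 0 0)%:~R * U 0 + (m 0 1)%:~R * U 1 + U (lift 0 1) = e m.
  have := congr1 (fun M : 'rV[R]_n => M 0 (Ordinal mn)) uE.
  rewrite [RHS]mxE AE Tm => <-.
  rewrite mxE !big_ord_recl big_ord0 addr0 !(mxE _ _ _ (Ordinal mn)) !mxE AE Tm /= !ratr_int rmorph1.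
  have -> : lift ord0 ord0 = 1 :> 'I_3 by apply/val_inj.
  have -> : lift ord0 (lift ord0 ord0) = lift 0 1 :> 'I_3 by apply/val_inj.
  rewrite -/p -[\sum_(j < n) e' 0 j * p j ord0]/(U 0) -[\sum_(j < n) e' 0 j * p j 1]/(U 1).
  rewrite -[\sum_(j < n) e' 0 j * p j (lift 0 1)]/(U (lift 0 1)); ring.
have sumE (f : 'I_n -> R) : \sum_(j < n) e A`_j * (if T A`_j then f j else 0) = \sum_(j < n) e' 0 j * f j.
  by apply: eq_bigr => j _; rewrite mxE; case: ifP => _; ring.
rewrite sumE -/(U (lift 0 1)) -key zdotE !summxE.
have e0 (b : 'I_2) (f : 'I_n -> R) : (forall j, g j 0 b = if T A`_j then - f j else 0) ->
  \sum_(j < n) (e A`_j *: g j) 0 b = - \sum_(j < n) e' 0 j * f j.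
  move=> fE; rewrite -sumrN (eq_bigr (fun j => e' 0 j * (- f j))); first by apply: eq_bigr => j _; ring.
  by move=> j _; rewrite mxE fE mxE; case: ifP => _; ring.
rewrite (e0 0 (fun j => p j 0)) ?(e0 1 (fun j => p j 1)); last 2 first.
- by move=> j; rewrite /g; case: ifP; rewrite ?mxE.
- by move=> j; rewrite /g; case: ifP; rewrite ?mxE.
by rewrite -/(U 0) -/(U 1); ring.
Qed.
End Solve.

(** * Tie sets of the deformed polynomial *)

Section Families.
Variables (R : realType) (D : set (plane R)) (V : seq (plane R)) (L : seq (lattice * R)) (N : nat).
Hypothesis pd : polygon_data D V L.
Variable A : seq lattice.
Hypothesis HA : slopes L N A.
Variables (P : config R N) (c : lattice -> R).
Hypothesis gP : generic P.
Hypothesis cmin : minimal_coef D L A P c.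
Variable ct : config R N -> lattice -> R.
Hypothesis ct_fix : forall Q m, m \notin free_slopes D A c -> ct Q m = c m.
Hypothesis ct_cont : forall m, m \in A -> {for P, continuous (ct^~ m)} /\ ct P m = c m.
Implicit Types (m k : lattice) (x y z v : plane R) (Q : config R N).

Lemma tie_restrict (b : lattice -> R) x (T : set lattice) : T !=set0 -> T `<=` [set` A] ->
  (forall m k, T m -> k \in A -> ~ T k -> lf b m x < lf b k x) ->
  tie A b x = [set m | T m /\ forall k, T k -> lf b m x <= lf b k x].
Proof.
move=> [m0 Tm0] TA sep; apply/seteqP; split => m.
  move=> [mA mm]; split; last by move=> k /TA; exact: mm.
  apply: contrapT => nT; have := sep _ _ Tm0 mA nT.
  by rewrite ltNge mm//; exact: TA.
move=> [Tm mm]; split; first exact: TA.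
by move=> k kA; have [Tk|nTk] := pselect (T k); [exact: mm|exact/ltW/sep].
Qed.

(** At interior points [absorb_translation] applies. On the boundary the tied functions vanish, so
    their coefficients are fixed and no translation is made; the third clause keeps points near the
    boundary inside the polygon. *)
Lemma tie_shift y : D y -> exists d : config R N -> plane R,
  [/\ {for P, continuous d}, d P = 0, ~ D° y -> forall Q, d Q = 0 &
  forall Q, exists s, forall m x, tie A c y m -> lf (ct Q) m (x + d Q) = lf c m x + s].
Proof.
move=> Dy; have [Diy|Diy] := pselect (D° y); last first.
  exists (fun _ => 0); split => //; first exact: cst_continuous.
  move=> Q; exists 0 => m x /(tieP pd HA)[mA me].
  have [[adm _]] := cmin; have [_ /(_ Diy) F0] := admissible_Fm pd HA (proj1 cmin) Dy.
  rewrite !addr0 /lf ct_fix//; apply/negP => /free_slopesP[_ /(_ _ Dy)].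
  by rewrite -me F0 ltxx.
pose T m := `[< tie A c y m >].
have [m0 tm0] := tie_ex pd HA c y.
(* Tied slopes have equal values at [y], so an affine dependency among them is an integer relation
   among their coefficients. *)
have indep (al : lattice -> int) : (forall m, ~~ T m -> al m = 0) ->
    \sum_(m <- undup A) al m = 0 -> \sum_(m <- undup A) m *~ al m = 0 ->
    forall m, m \in free_slopes D A c -> al m = 0.
  move=> alT al0 al1; apply: (free_independent pd gP cmin).
  have e m : (al m)%:~R * c m = (al m)%:~R * lf c m0 y - zdot (m *~ al m) y.
    rewrite zdotMz; have [/asboolP tm|/alT ->] := boolP (T m); last by ring.
    by rewrite (tie_lf tm0 tm) /lf; ring.
  rewrite (eq_bigr _ (fun m _ => e m)) sumrB -mulr_suml -rmorph_sum /= al0 mul0r sub0r.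
  suff -> : \sum_(m <- undup A) zdot (m *~ al m) y = zdot (\sum_(m <- undup A) m *~ al m) y.
    by rewrite al1 zdot0l oppr0.
  by elim/big_rec2: _ => [|m u v _ ->]; rewrite ?zdot0l// zdotDl.
have [g [h gh]] := absorb_translation R (undup_uniq A) indep.
pose e Q m := ct Q m - c m.
have [adm _] := cmin.
have jA (j : 'I_(size (undup A))) : (undup A)`_j \in A by rewrite -mem_undup mem_nth.
exists (fun Q => \sum_(j < size (undup A)) e Q (undup A)`_j *: g j); split => //.
- apply: (@cvg_big (plane R) _ +%R 0 predT _ _ (nbhs P)) => [|j _]; first exact: add_continuous.
  have [cc _] := ct_cont (jA j).
  have ec : (fun Q => e Q (undup A)`_j) @ P --> e P (undup A)`_j.
    by apply: (@cvgB _ _ _ (nbhs P)); [exact: cc|exact: cvg_cst].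
  by have := @cvgZr_tmp _ _ _ _ _ _ _ (g j) ec; exact.
- by apply: big1 => j _; rewrite /e (ct_cont (jA j)).2 subrr scale0r.
move=> Q; exists (\sum_(j < size (undup A)) e Q (undup A)`_j * h j) => m x tm.
have mA : m \in undup A by rewrite mem_undup; case: tm.
have eB k : k \notin free_slopes D A c -> e Q k = 0 by move=> kB; rewrite /e ct_fix// subrr.
rewrite -(gh (e Q) eB m mA) ?/T; last by apply/asboolP.
by rewrite /lf zdotDr /e; ring.
Qed.

(** Close to [(y, P)] only slopes tied at [y] compete. Passing from [c] to [ct Q] and translating by
    [d Q] adds the same constant to all of them, so the witnesses are [y' + d Q] and [y' - d Q]. *)
Lemma near_tie y : D y -> \forall y' \near y & Q \near P, D° y' ->
  (exists2 z, D° z & tie A (ct Q) z = tie A c y') /\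
  (exists2 x, D° x & tie A c x = tie A (ct Q) y').
Proof.
move=> Dy; have [d [dc d0 dD ds]] := tie_shift Dy.
pose E (p : plane R * config R N) := forall m k, tie A c y m -> k \in A -> ~ tie A c y k ->
  lf (ct p.2) m p.1 < lf (ct p.2) k p.1.
have lfc k : k \in A -> {for (y, P), continuous (fun p => lf (ct p.2) k p.1)}.
  move=> kA; have [cc _] := ct_cont kA.
  apply: (@cvgD _ _ _ (nbhs (y, P))).
    by apply: (@cvg_comp _ _ _ snd (ct^~ k) _ (nbhs P)); [exact: cvg_snd|exact: cc].
  by apply: (@cvg_comp _ _ _ fst (zdot k) _ (nbhs y)); [exact: cvg_fst|exact: continuous_dot].
have lfP k x : k \in A -> lf (ct P) k x = lf c k x by move=> kA; rewrite /lf (ct_cont kA).2.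
have nE : \forall p \near (y, P), E p.
  pose T := [seq t <- [seq (j, k) | j <- A, k <- A] | `[< tie A c y t.1 /\ ~ tie A c y t.2 >]].
  have : \forall p \near (y, P), forall t, t \in T -> 0 < lf (ct p.2) t.2 p.1 - lf (ct p.2) t.1 p.1.
    apply: (@near_all _ (nbhs (y, P)) _ _ _ (fun t p => 0 < lf (ct p.2) t.2 p.1 - lf (ct p.2) t.1 p.1)).
    move=> [j k]; rewrite mem_filter => /andP[/asboolP /= [tj tk] /allpairsP[[j' k'] /= [jA kA [? ?]]]]; subst j' k'.
    apply: (@near_gt0 R _ (fun p => lf (ct p.2) k p.1 - lf (ct p.2) j p.1)).
      by apply: (@cvgB _ _ _ (nbhs (y, P))); exact: lfc.
    by rewrite /= !lfP// subr_gt0; exact: tie_lt tj kA tk.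
  apply: filterS => p h m k tm kA tk; rewrite -subr_gt0; apply: (h (m, k)).
  rewrite mem_filter; apply/andP; split; first by apply/asboolP.
  by apply/allpairsP; exists (m, k); split => //; exact: tm.1.
have fstc : fst @ nbhs (y, P) --> y by exact: cvg_fst.
have sndc : snd @ nbhs (y, P) --> P by exact: cvg_snd.
have dsc : (fun p : plane R * config R N => d p.2) @ nbhs (y, P) --> (0 : plane R).
  rewrite -d0; apply: (@cvg_comp _ _ _ snd d _ (nbhs P)); [exact: sndc|exact: dc].
have pc : (fun p : plane R * config R N => p.1 + d p.2) @ nbhs (y, P) --> y.
  by rewrite -[X in _ --> X]addr0; apply: (@cvgD _ _ _ (nbhs (y, P))).
have mc : (fun p : plane R * config R N => p.1 - d p.2) @ nbhs (y, P) --> y.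
  by rewrite -[X in _ --> X]subr0; apply: (@cvgB _ _ _ (nbhs (y, P))).
have n1 : \forall p \near (y, P), E (p.1 + d p.2, p.2).
  by have := cvg_pair pc sndc; apply.
have n2 : \forall p \near (y, P), E (p.1, P).
  by have := cvg_pair fstc (cvg_cst P); apply.
have n3 : \forall p \near (y, P), E (p.1 - d p.2, P).
  by have := cvg_pair mc (cvg_cst P); apply.
have n4 : \forall p \near (y, P), D° p.1 -> D° (p.1 + d p.2) /\ D° (p.1 - d p.2).
  have [Diy|Diy] := pselect (D° y).
    have Dyy := nbhs_interior Diy.
    by apply: (@filterS2 _ (nbhs (y, P)) _ _ _ _ _ (pc _ Dyy) (mc _ Dyy)) => p h1 h2 _.
  by apply: filterE => p Dp; rewrite dD// addr0 subr0.
have T0 : tie A c y !=set0 by exact: (tie_ex pd HA c y).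
have TA : tie A c y `<=` [set` A] by move=> m [].
suff : \forall p \near (y, P), D° p.1 -> (exists2 z, D° z & tie A (ct p.2) z = tie A c p.1) /\
  (exists2 x, D° x & tie A c x = tie A (ct p.2) p.1) by [].
near=> p => Dp.
have E1 : E (p.1 + d p.2, p.2) by near: p.
have E2 : E (p.1, P) by near: p.
have E3 : E (p.1 - d p.2, P) by near: p.
have E0 : E p by near: p.
have [D1 D2] : D° (p.1 + d p.2) /\ D° (p.1 - d p.2) by move: Dp; near: p.
have EP x : E (x, P) -> forall m k, tie A c y m -> k \in A -> ~ tie A c y k -> lf c m x < lf c k x.
  by move=> Ex m k tm kA tk; have := Ex m k tm kA tk; rewrite /= !lfP//; case: tm.
have [s sE] := ds p.2.
split.
  exists (p.1 + d p.2) => //; rewrite (tie_restrict T0 TA E1) (tie_restrict T0 TA (EP _ E2)).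
  apply/seteqP; split => m [tm mm]; split => // k tk; have := mm k tk; rewrite !sE// ?lerD2r//.
exists (p.1 - d p.2) => //; rewrite (tie_restrict T0 TA E0) (tie_restrict T0 TA (EP _ E3)).
have pE : p.1 = p.1 - d p.2 + d p.2 by rewrite subrK.
apply/seteqP; split => m [tm mm]; split => // k tk; have := mm k tk.
  by rewrite [X in lf (ct p.2) m X <= lf (ct p.2) k X]pE !sE// lerD2r.
by rewrite [X in lf (ct p.2) m X <= lf (ct p.2) k X]pE !sE// lerD2r.
Unshelve. all: by end_near. Qed.

(** Compactness of [D] turns the neighbourhoods of [P] depending on the point into a common one. *)
Lemma tie_families : \forall Q \near P, forall x, D° x ->
  (exists2 z, D° z & tie A (ct Q) z = tie A c x) /\
  (exists2 z, D° z & tie A c z = tie A (ct Q) x).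
Proof.
have cov := (compact_near_coveringP D).1 (pd_compact pd).
have := cov _ (nbhs P) (fun Q x => D° x -> (exists2 z, D° z & tie A (ct Q) z = tie A c x) /\
  (exists2 z, D° z & tie A c z = tie A (ct Q) x)) (nbhs_filter P) near_tie.
by apply: (@filterS _ (nbhs P)) => Q h x Dx; apply: h => //; exact: interior_subset.
Qed.
End Families.

(** * Cyclic orders *)

Section Ccw.
Variable R : realType.
Implicit Types (a b c u v w na nb nc : plane R) (x y z r s t : R).

Definition two_pos x y z := (0 < x /\ 0 < y) \/ (0 < y /\ 0 < z) \/ (0 < z /\ 0 < x).

Lemma cross_polar r r' t t' : cross (polar r t) (polar r' t') = r * r' * sin (t' - t).
Proof. by rewrite /cross !mxE /= sinB; ring. Qed.

Lemma sqrt_norm a : a != 0 -> exists2 r, 0 < r & r ^+ 2 = a 0 0 ^+ 2 + a 0 1 ^+ 2.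
Proof.
move=> /dot_gt0; rewrite dotE -!expr2 => h; exists (Num.sqrt (a 0 0 ^+ 2 + a 0 1 ^+ 2)).
  by rewrite sqrtr_gt0.
by rewrite sqr_sqrtr// ltW.
Qed.

Lemma circle_angle x y : x ^+ 2 + y ^+ 2 = 1 -> exists t, [/\ x = cos t, y = sin t & 0 < y -> 0 < t < pi].
Proof.
move=> xy1; have x1 : -1 <= x <= 1 by nra.
have sE : y ^+ 2 = sin (acos x) ^+ 2 by rewrite sin_acos// sqr_sqrtr; nra.
have s0 : 0 <= sin (acos x) by rewrite sin_acos// sqrtr_ge0.
have [y0|y0] := leP 0 y.
  exists (acos x); rewrite acosK//; split; [by []|by nra|move=> y0'].
  have x1' : -1 < x < 1.
    by rewrite !lt_neqAle; case/andP: x1 => -> ->; rewrite !andbT; apply/andP; split; apply/eqP => e; nra.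
  by rewrite acos_gt0 ?acos_ltpi//; lra.
by exists (- acos x); rewrite cosN acosK// sinN; split => //; [nra|lra].
Qed.

(* The polar angle of [b] measured from the direction [t]. *)
Lemma polar_from b t : b != 0 -> exists r s, [/\ 0 < r, b = polar r (t + s) &
  0 < b 0 1 * cos t - b 0 0 * sin t -> 0 < s < pi].
Proof.
move=> /sqrt_norm[r r0 rE]; have rn : r != 0 by rewrite gt_eqF.
pose x := (b 0 0 * cos t + b 0 1 * sin t) / r.
pose y := (b 0 1 * cos t - b 0 0 * sin t) / r.
have cs := cos2Dsin2 t.
have [|s [xs ys spi]] := @circle_angle x y.
  rewrite /x /y !expr_div_n -mulrDl.
  have -> : (b 0 0 * cos t + b 0 1 * sin t) ^+ 2 + (b 0 1 * cos t - b 0 0 * sin t) ^+ 2 =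
    (b 0 0 ^+ 2 + b 0 1 ^+ 2) * (cos t ^+ 2 + sin t ^+ 2) by ring.
  by rewrite cs mulr1 -rE divff// expf_neq0.
exists r, s; split => //; last by move=> y0; apply: spi; rewrite divr_gt0.
have xr : r * x = b 0 0 * cos t + b 0 1 * sin t by rewrite /x mulrC divfK.
have yr : r * y = b 0 1 * cos t - b 0 0 * sin t by rewrite /y mulrC divfK.
apply/plane_eq; rewrite !mxE /= ?cosD ?sinD -xs -ys.
  transitivity ((r * x) * cos t - (r * y) * sin t); last by ring.
  rewrite xr yr; transitivity (b 0 0 * (cos t ^+ 2 + sin t ^+ 2)); last by ring.
  by rewrite cs mulr1.
transitivity ((r * x) * sin t + (r * y) * cos t); last by ring.
rewrite xr yr; transitivity (b 0 1 * (cos t ^+ 2 + sin t ^+ 2)); last by ring.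
by rewrite cs mulr1.
Qed.

Lemma polar_next a b r t : 0 < r -> a = polar r t -> 0 < cross a b ->
  exists r' t', [/\ 0 < r', t < t', t' < t + pi & b = polar r' t'].
Proof.
move=> r0 aE ab.
have b0 : b != 0 by apply: contraTneq ab => ->; rewrite /cross !mxE !mulr0 subrr ltxx.
have [r' [s [r'0 bE spi]]] := polar_from t b0.
have /andP[s0 s1] : 0 < s < pi.
  apply: spi; move: ab; rewrite aE /cross !mxE /=.
  have -> : r * cos t * b 0 1 - r * sin t * b 0 0 = r * (b 0 1 * cos t - b 0 0 * sin t) by ring.
  by rewrite pmulr_rgt0.
by exists r', (t + s); split => //; lra.
Qed.

Lemma ccw_rot a b c : ccw a b c -> ccw b c a.
Proof.
move=> [r1 [r2 [r3 [t1 [t2 [t3 [[r10 r20 r30] [[t12 t23 t31] [aE bE cE]]]]]]]]].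
exists r2, r3, r1, t2, t3, (t1 + 2 * pi); split => //; split.
  by split => //; lra.
split => //; rewrite aE; apply/plane_eq; rewrite !mxE /=.
  by rewrite mulr_natl cosD2pi.
by rewrite mulr_natl sinD2pi.
Qed.

Lemma ccw_of_cross a b c : 0 < cross a b -> 0 < cross b c -> ccw a b c.
Proof.
move=> ab bc; have a0 : a != 0.
  by apply: contraTneq ab => ->; rewrite /cross !mxE !mul0r subrr ltxx.
have [r1 [t1 [r10 aE _]]] := polar_from 0 a0; rewrite add0r in aE.
have [r2 [t2 [r20 t12 t12' bE]]] := polar_next r10 aE ab.
have [r3 [t3 [r30 t23 t23' cE]]] := polar_next r20 bE bc.
by exists r1, r2, r3, t1, t2, t3; split => //; split => //; split => //; lra.
Qed.

(** The three angular gaps are positive with sum [2 * pi], so at most one reaches [pi], and a gap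
    below [pi] has positive sine. Conversely, two consecutive positive cross products turn by less
    than [2 * pi] in total. *)
Lemma ccwP a b c : ccw a b c <-> two_pos (cross a b) (cross b c) (cross c a).
Proof.
split; last first.
  case=> [[h1 h2]|[[h1 h2]|[h1 h2]]]; first exact: ccw_of_cross.
    by do 2 apply: ccw_rot; exact: ccw_of_cross.
  by apply: ccw_rot; exact: ccw_of_cross.
move=> [r1 [r2 [r3 [t1 [t2 [t3 [[r10 r20 r30] [[t12 t23 t31] [-> -> ->]]]]]]]]].
rewrite !cross_polar.
have pos x y t : 0 < x -> 0 < y -> 0 < t < pi -> 0 < x * y * sin t.
  by move=> x0 y0 /sin_gt0_pi s0; rewrite !mulr_gt0.
have sE : sin (t1 - t3) = sin (t1 + 2 * pi - t3).
  by rewrite addrAC mulr_natl sinD2pi.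
rewrite sE.
have [a1|a1] := ltP (t2 - t1) pi.
  have [b1|b1] := ltP (t3 - t2) pi.
    by left; split; apply: pos => //; lra.
  by right; right; split; apply: pos => //; lra.
by right; left; split; apply: pos => //; lra.
Qed.
End Ccw.

(** * Cyclic order of points and of their outer normals *)

Section Normals.
Variable R : realType.
Implicit Types (a b c u v w na nb nc : plane R) (x y z r s t : R).

Lemma two_pos_rot x y z : two_pos x y z -> two_pos y z x.
Proof. rewrite /two_pos; tauto. Qed.

Lemma cross_rel a b c v : cross b c * dot v a + cross c a * dot v b + cross a b * dot v c = 0.
Proof. by rewrite /cross !dotE; ring. Qed.

(** By [cross_rel], the sum times [dot nc c] equals [cross b c * (dot nc c - dot nc a) + cross c a *
    (dot nc c - dot nc b)]. The sum is twice the signed area of the triangle. *)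
Lemma orient_pos a b c nc : 0 < dot nc c -> dot nc a < dot nc c -> dot nc b < dot nc c ->
  0 < cross b c -> 0 < cross c a -> 0 < cross a b + cross b c + cross c a.
Proof.
move=> c0 ca cb al be; rewrite ltNge; apply/negP => h.
have e := cross_rel a b c nc.
have h1 : 0 < cross b c * (dot nc c - dot nc a) by rewrite mulr_gt0// subr_gt0.
have h2 : 0 < cross c a * (dot nc c - dot nc b) by rewrite mulr_gt0// subr_gt0.
have h3 : 0 <= (- (cross a b + cross b c + cross c a)) * dot nc c.
  by apply: mulr_ge0; [lra|exact: ltW].
by nra.
Qed.

(* The outer normals at the vertices of a counterclockwise triangle. *)
Lemma normals_of_triangle a b c na nb nc :
  dot na b < dot na a -> dot na c < dot na a ->
  dot nb a < dot nb b -> dot nb c < dot nb b ->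
  dot nc a < dot nc c -> dot nc b < dot nc c ->
  0 < cross a b + cross b c + cross c a -> cross na nb <= 0 ->
  0 < cross nb nc /\ 0 < cross nc na.
Proof.
move=> ab ac ba bc ca cb; set d := _ + cross c a => d0 nab.
have A1 : 0 < dot na a - dot na b by rewrite subr_gt0.
have A3 : 0 < dot na a - dot na c by rewrite subr_gt0.
have B1 : 0 < dot nb b - dot nb a by rewrite subr_gt0.
have B2 : 0 < dot nb b - dot nb c by rewrite subr_gt0.
have C2 : 0 < dot nc c - dot nc b by rewrite subr_gt0.
have C3 : 0 < dot nc c - dot nc a by rewrite subr_gt0.
(* [d] is the cross product of two edge vectors, so each product is the determinant of two normals
   evaluated on two edges. *)
have eab : cross na nb * d = (dot na a - dot na b) * ((dot nb b - dot nb c) - (dot nb b - dot nb a))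
    + (dot na a - dot na c) * (dot nb b - dot nb a).
  by rewrite /d /cross !dotE; ring.
have ebc : cross nb nc * d = (dot nb b - dot nb c) * (dot nc c - dot nc a)
    + ((dot nb b - dot nb a) - (dot nb b - dot nb c)) * (dot nc c - dot nc b).
  by rewrite /d /cross !dotE; ring.
have eca : cross nc na * d = (dot nc c - dot nc a) * ((dot na a - dot na b) - (dot na a - dot na c))
    + (dot nc c - dot nc b) * (dot na a - dot na c).
  by rewrite /d /cross !dotE; ring.
have nabd : cross na nb * d <= 0 by rewrite mulr_le0_ge0// ltW.
move: (dot na a - dot na b) (dot na a - dot na c) (dot nb b - dot nb a) (dot nb b - dot nb c)
  (dot nc c - dot nc b) (dot nc c - dot nc a) A1 A3 B1 B2 C2 C3 eab ebc eca.
move=> a1 a3 b1 b2 c2 c3 A1 A3 B1 B2 C2 C3 eab ebc eca.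
rewrite eab in nabd.
have a3b1 : 0 < a3 * b1 by rewrite mulr_gt0.
have b12 : b2 < b1.
  rewrite ltNge; apply/negP; rewrite -subr_ge0 => h.
  by have := mulr_ge0 (ltW A1) h; lra.
have a13 : a3 < a1.
  rewrite ltNge; apply/negP; rewrite -subr_ge0 => h.
  have := mulr_ge0 (ltW B1) h.
  have : 0 < a1 * b2 by rewrite mulr_gt0.
  by nra.
split; rewrite -(pmulr_lgt0 _ d0).
  rewrite ebc addr_gt0// mulr_gt0// subr_gt0//.
by rewrite eca addr_gt0// mulr_gt0// subr_gt0.
Qed.

(** [orient_pos] makes the triangle positively oriented; then at most one cross product of normals
    fails to be positive, by [normals_of_triangle]. *)
Lemma two_pos_normals a b c na nb nc :
  0 < dot na a -> 0 < dot nb b -> 0 < dot nc c ->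
  dot na b < dot na a -> dot na c < dot na a ->
  dot nb a < dot nb b -> dot nb c < dot nb b ->
  dot nc a < dot nc c -> dot nc b < dot nc c ->
  two_pos (cross a b) (cross b c) (cross c a) ->
  two_pos (cross na nb) (cross nb nc) (cross nc na).
Proof.
move=> a0 b0 c0 ab ac ba bc ca cb h.
have d0 : 0 < cross a b + cross b c + cross c a.
  case: h => [[h1 h2]|[[h1 h2]|[h1 h2]]].
  - by have := @orient_pos c a b nb b0 bc ba h1 h2; lra.
  - exact: (@orient_pos a b c nc).
  - by have := @orient_pos b c a na a0 ab ac h1 h2; lra.
have [nab|nab] := ltP 0 (cross na nb); last first.
  by have := normals_of_triangle ab ac ba bc ca cb d0 nab; right; left.
have [nbc|nbc] := ltP 0 (cross nb nc); first by left.
have [|h1 h2] := @normals_of_triangle b c a nb nc na bc ba cb ca ab ac _ nbc; first by lra.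
by right; right.
Qed.

Lemma near_pos_affine x y : 0 < x -> \forall s \near (0 : R)^'+, 0 < x + s * y.
Proof.
move=> x0; have xc : (fun s : R => x + s * y) @ (0 : R) --> x.
  have e : x = x + 0 * y by rewrite mul0r addr0.
  rewrite [X in _ --> X]e.
  have ss : (fun s : R => s) @ (0 : R) --> (0 : R) by exact: cvg_id.
  apply: (@cvgD _ _ _ (nbhs (0 : R))); first exact: cvg_cst.
  by apply: (@cvgM _ _ (nbhs (0 : R))); [exact: ss|exact: cvg_cst].
by move: (xc _ (lt_nbhsr x0)); exact: cvg_at_right_filter.
Qed.

(* [p] lies on an edge exactly when [ep]; an edge's normal is orthogonal to it,
   so the supporting inequality may degenerate only towards a vertex. *)
Definition supports (np : plane R) (ep : bool) (p q : plane R) (eq : bool) :=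
  dot np (q - p) < 0 \/ [/\ dot np (q - p) = 0, ep & ~~ eq].

Lemma near_shift np ep p q eq nq : supports np ep p q eq -> 0 < dot np np ->
  \forall s \near (0 : R)^'+, dot np (q + s *: (if eq then nq else 0)) < dot np (p + s *: (if ep then np else 0)).
Proof.
move=> h n0; pose y := dot np (if ep then np else 0) - dot np (if eq then nq else 0).
have e s : dot np (p + s *: (if ep then np else 0)) - dot np (q + s *: (if eq then nq else 0))
    = - dot np (q - p) + s * y.
  by rewrite !dotDr !dotZr dotNr /y; ring.
case: h => [h|[h0 ept /negPf eqf]].
  have : 0 < - dot np (q - p) by rewrite oppr_gt0.
  move=> /(near_pos_affine y); apply: filterS => s hs.
  by rewrite -subr_gt0 e.
apply: filterS (nbhs_right_gt 0) => s s0; rewrite -subr_gt0 e h0 oppr0 add0r /y ept eqf.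
by rewrite dot0r subr0 mulr_gt0.
Qed.

Lemma near_cross p q u v : 0 < cross p q -> \forall s \near (0 : R)^'+, 0 < cross (p + s *: u) (q + s *: v).
Proof.
move=> pq; have h1 := near_pos_affine (- (`|cross p v| + `|cross u q| + `|cross u v|)) pq.
have lt1 := @nbhs_right_lt R 0 1 ltr01; have gt0 := @nbhs_right_gt R 0.
apply: filterS3 h1 lt1 gt0 => s h1 s1 s0; apply: (lt_le_trans h1).
have -> : cross (p + s *: u) (q + s *: v) = cross p q + s * (cross p v + cross u q + s * cross u v).
  by rewrite /cross !mxE; ring.
rewrite lerD2l ler_wpM2l ?(ltW s0)//.
have a1 := ler_norm (- cross p v); have a2 := ler_norm (- cross u q).
have a3 : - `|cross u v| <= s * cross u v.
  have := ler_norm (- cross u v); rewrite normrN => a3; have := normr_ge0 (cross u v) => a4.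
  by have [c0|c0] := leP 0 (cross u v); nra.
by move: a1 a2; rewrite !normrN; lra.
Qed.

Section Triple.
Variables (a b c na nb nc : plane R) (ea eb ec : bool).
Hypotheses (a0 : 0 < dot na a) (b0 : 0 < dot nb b) (c0 : 0 < dot nc c).
Hypotheses (ab : supports na ea a b eb) (ac : supports na ea a c ec).
Hypotheses (ba : supports nb eb b a ea) (bc : supports nb eb b c ec).
Hypotheses (ca : supports nc ec c a ea) (cb : supports nc ec c b eb).

(* Pushing the points on edges slightly outwards makes all inequalities strict. *)
Lemma two_pos_supports : two_pos (cross a b) (cross b c) (cross c a) ->
  two_pos (cross na nb) (cross nb nc) (cross nc na).
Proof.
move=> h.
have nn (n p : plane R) : 0 < dot n p -> 0 < dot n n.
  by move=> np; apply: dot_gt0; apply: contraTneq np => ->; rewrite dot0l ltxx.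
have na0 := nn _ _ a0; have nb0 := nn _ _ b0; have nc0 := nn _ _ c0.
pose f (p n : plane R) (e : bool) s := p + s *: (if e then n else 0).
have ff (n p : plane R) e : 0 < dot n p -> \forall s \near (0 : R)^'+, 0 < dot n (f p n e s).
  move=> np; have := near_pos_affine (dot n (if e then n else 0)) np; apply: filterS => s.
  by rewrite /f dotDr dotZr.
have hc : \forall s \near (0 : R)^'+, two_pos (cross (f a na ea s) (f b nb eb s))
    (cross (f b nb eb s) (f c nc ec s)) (cross (f c nc ec s) (f a na ea s)).
  have g p n e q n' e' : 0 < cross p q -> \forall s \near (0 : R)^'+, 0 < cross (f p n e s) (f q n' e' s).
    exact: near_cross.
  case: h => [[h1 h2]|[[h1 h2]|[h1 h2]]].
  - have k1 := g _ na ea _ nb eb h1; have k2 := g _ nb eb _ nc ec h2.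
    by apply: filterS2 k1 k2 => s s1 s2; left; split.
  - have k1 := g _ nb eb _ nc ec h1; have k2 := g _ nc ec _ na ea h2.
    by apply: filterS2 k1 k2 => s s1 s2; right; left; split.
  - have k1 := g _ nc ec _ na ea h1; have k2 := g _ na ea _ nb eb h2.
    by apply: filterS2 k1 k2 => s s1 s2; right; right; split.
have FF : Filter (0 : R)^'+ by exact: (@filter_filter R _ (at_right_proper_filter 0)).
have fI A B (hA : \forall s \near (0 : R)^'+, A s) (hB : \forall s \near (0 : R)^'+, B s) :=
  @filterI _ _ FF A B hA hB.
have h1 := fI _ _ (fI _ _ (ff _ _ ea a0) (ff _ _ eb b0)) (ff _ _ ec c0).
have h2 := fI _ _ (near_shift nb ab na0) (near_shift nc ac na0).
have h3 := fI _ _ (near_shift na ba nb0) (near_shift nc bc nb0).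
have h4 := fI _ _ (near_shift na ca nc0) (near_shift nb cb nc0).
have [s [_ _ [[[[p1 p2] p3] [p4 p5]] [[p6 p7] [[p8 p9] p10]]]]] :=
  @pos_ex R _ (fI _ _ (fI _ _ h1 h2) (fI _ _ h3 (fI _ _ h4 hc))).
exact: (@two_pos_normals (f a na ea s) (f b nb eb s) (f c nc ec s)).
Qed.
End Triple.

(** With [q = r *: p], the inequality at [p] gives [r < 1] and the one at [q] gives [r > 1]; the
    flags let at most one of them degenerate to [r = 1]. *)
Lemma not_same_ray p q np nq ep eq r : 0 < dot np p -> 0 < dot nq q ->
  supports np ep p q eq -> supports nq eq q p ep -> 0 < r -> q <> r *: p.
Proof.
move=> p0 q0 pq qp r0 e; move: pq qp q0; rewrite /supports e !dotBr !dotZr => pq qp q0.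
have q0' : 0 < dot nq p by rewrite -(pmulr_rgt0 _ r0).
case: pq => [pq|[pq h1 h2]]; case: qp => [qp|[qp h3 h4]]; last by rewrite h1 in h4.
- have r1 : r < 1 by rewrite -subr_lt0 -(pmulr_llt0 _ p0) mulrBl mul1r.
  have : 0 < (1 - r) * dot nq p by rewrite mulr_gt0// subr_gt0.
  by lra.
- have r1 : r < 1 by rewrite -subr_lt0 -(pmulr_llt0 _ p0) mulrBl mul1r.
  have : 0 < (1 - r) * dot nq p by rewrite mulr_gt0// subr_gt0.
  by lra.
- have /eqP : (r - 1) * dot np p = 0 by rewrite mulrBl mul1r.
  rewrite mulf_eq0 (gt_eqF p0) orbF subr_eq0 => /eqP r1.
  by move: qp; rewrite r1 mul1r subrr ltxx.
Qed.

Lemma cross0_scale p q : p != 0 -> cross p q = 0 -> exists r, q = r *: p.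
Proof.
move=> /dot_gt0 p0 h; exists (dot p q / dot p p).
have e : dot p p != 0 by rewrite gt_eqF.
have e' : p 0 0 * p 0 0 + p 0 1 * p 0 1 != 0 by rewrite -dotE.
apply/plane_eq; rewrite !mxE; apply: (mulfI e); rewrite mulrA [X in _ = X * _]mulrC divfK//;
  move: h; rewrite /cross !dotE => h.
  by transitivity (p 0 0 * (p 0 0 * q 0 0 + p 0 1 * q 0 1) - p 0 1 * (p 0 0 * q 0 1 - p 0 1 * q 0 0));
    [ring|rewrite h; ring].
by transitivity (p 0 1 * (p 0 0 * q 0 0 + p 0 1 * q 0 1) + p 0 0 * (p 0 0 * q 0 1 - p 0 1 * q 0 0));
  [ring|rewrite h; ring].
Qed.

Section Converse.
Variables (a b c na nb nc : plane R) (ea eb ec : bool).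
Hypotheses (a0 : 0 < dot na a) (b0 : 0 < dot nb b) (c0 : 0 < dot nc c).
Hypotheses (ab : supports na ea a b eb) (ac : supports na ea a c ec).
Hypotheses (ba : supports nb eb b a ea) (bc : supports nb eb b c ec).
Hypotheses (ca : supports nc ec c a ea) (cb : supports nc ec c b eb).

Let nz (n p : plane R) : 0 < dot n p -> p != 0.
Proof. by apply: contraTneq => ->; rewrite dot0r ltxx. Qed.

(** Here [b] is a negative multiple of [a], since equal rays are excluded; so [cross b c] and
    [cross c a] have the same sign. Both vanishing would put [c] on the ray of [b]. *)
Lemma two_pos_or : cross a b = 0 -> two_pos (cross a b) (cross b c) (cross c a) \/
  two_pos (cross a c) (cross c b) (cross b a).
Proof.
move=> ab0; have [r br] := cross0_scale (nz a0) ab0.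
have r0 : r < 0.
  rewrite ltNge; apply/negP; rewrite le_eqVlt => /predU1P[r0|r0].
    by move: b0; rewrite br -r0 scale0r dot0r ltxx.
  exact: (not_same_ray a0 b0 ab ba r0 br).
have e : cross b c = - r * cross c a by rewrite br /cross !mxE; ring.
have e1 : cross a c = - cross c a by rewrite /cross; ring.
have e2 : cross c b = - cross b c by rewrite /cross; ring.
have [h|h|h] := ltgtP 0 (cross c a).
- by left; right; left; split => //; rewrite e mulr_gt0// oppr_gt0.
- by right; left; rewrite e1 e2 e !oppr_gt0; split => //; rewrite nmulr_llt0// oppr_gt0.
exfalso; have ca0 : cross a c = 0 by rewrite e1 -h oppr0.
have [s cs] := cross0_scale (nz a0) ca0.
have [s0|s0] := ltP 0 s; first exact: (not_same_ray a0 c0 ac ca s0 cs).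
have s0' : s < 0.
  rewrite lt_neqAle s0 andbT; apply/eqP => s00.
  by move: c0; rewrite cs s00 scale0r dot0r ltxx.
have sr : 0 < s / r by rewrite nmulr_rgt0// invr_lt0.
apply: (not_same_ray b0 c0 bc cb sr).
by rewrite br scalerA divfK ?lt_eqF.
Qed.
End Converse.

(** For the converse, the points are in one of the two cyclic orders. In the wrong one,
    [two_pos_supports] with [b] and [c] exchanged makes two of the three cross products of normals
    negative, although two are positive. *)
Lemma ccw_normals a b c na nb nc ea eb ec :
  0 < dot na a -> 0 < dot nb b -> 0 < dot nc c ->
  supports na ea a b eb -> supports na ea a c ec ->
  supports nb eb b a ea -> supports nb eb b c ec ->
  supports nc ec c a ea -> supports nc ec c b eb ->
  ccw a b c <-> ccw na nb nc.
Proof.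
move=> a0 b0 c0 ab ac ba bc ca cb; rewrite !ccwP; split.
  exact: (two_pos_supports a0 b0 c0 ab ac ba bc ca cb).
move=> h; have [//|neg] : two_pos (cross a b) (cross b c) (cross c a) \/
    two_pos (cross a c) (cross c b) (cross b a).
  have eN (p q : plane R) : cross q p = - cross p q by rewrite /cross; ring.
  have [h1|h1|h1] := ltgtP 0 (cross a b); last first.
  - exact: (two_pos_or a0 b0 c0 ab ac ba bc ca cb (esym h1)).
  - have [h2|h2|h2] := ltgtP 0 (cross b c); last first.
    + have [k|k] := two_pos_or b0 c0 a0 bc ba cb ca ab ac (esym h2).
        by left; do 2 apply: two_pos_rot.
      by right; apply: two_pos_rot.
    + right; right; left; rewrite (eN a b) (eN b c) !oppr_gt0; split => //.
    + have [h3|h3|h3] := ltgtP 0 (cross c a); last first.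
      * have [k|k] := two_pos_or c0 a0 b0 ca cb ac ab bc ba (esym h3).
          by left; apply: two_pos_rot.
        by right; do 2 apply: two_pos_rot.
      * by right; right; right; rewrite (eN a b) (eN c a) !oppr_gt0.
      * by left; right; left.
  - have [h2|h2|h2] := ltgtP 0 (cross b c); last first.
    + have [k|k] := two_pos_or b0 c0 a0 bc ba cb ca ab ac (esym h2).
        by left; do 2 apply: two_pos_rot.
      by right; apply: two_pos_rot.
    + have [h3|h3|h3] := ltgtP 0 (cross c a); last first.
      * have [k|k] := two_pos_or c0 a0 b0 ca cb ac ab bc ba (esym h3).
          by left; apply: two_pos_rot.
        by right; do 2 apply: two_pos_rot.
      * by right; left; rewrite (eN c a) (eN b c) !oppr_gt0.
      * by left; right; right.
    + by left; left.
have neg' := two_pos_supports a0 c0 b0 ac ab ca cb ba bc neg.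
have eN (p q : plane R) : cross q p = - cross p q by rewrite /cross; ring.
move: neg' h; rewrite /two_pos (eN nc na) (eN nb nc) (eN na nb) !oppr_gt0.
move: (cross na nb) (cross nb nc) (cross nc na) => x y z.
by case=> [[? ?]|[[? ?]|[? ?]]]; case=> [[? ?]|[[? ?]|[? ?]]]; exfalso; lra.
Qed.
End Normals.

(** * Faces as level sets of the tie set *)

Section Strata.
Variables (R : realType) (D : set (plane R)) (V : seq (plane R)) (L : seq (lattice * R)) (N : nat).
Hypothesis pd : polygon_data D V L.
Variable A : seq lattice.
Hypothesis HA : slopes L N A.
Variables (c : lattice -> R) (F : plane R -> R).
Hypothesis FE : forall x, D x -> F x = Fm A c x.
Implicit Types (m k l : lattice) (x y z v w a : plane R) (T : set lattice).

Definition face_of T : set (plane R) := [set x | D° x /\ tie A c x = T].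

(** [a] is orthogonal to the line carrying the slopes, hence the direction of an edge with these
    ties; a single slope also qualifies. *)
Definition collinear T := exists2 a : plane R, a != 0 &
  forall m k, T m -> T k -> zdot m a = zdot k a.

Lemma near_tie_sub x : \forall y \near x, tie A c y `<=` tie A c x.
Proof.
have [m tm] := tie_ex pd HA c x.
have : \forall y \near x, forall k, k \in [seq k <- A | `[< ~ tie A c x k >]] -> 0 < lf c k y - lf c m y.
  apply: (@near_all _ (nbhs x) _ _ _ (fun k y => 0 < lf c k y - lf c m y)) => k.
  rewrite mem_filter => /andP[/asboolP ntk kA].
  apply: (@near_gt0 R (plane R) (fun y => lf c k y - lf c m y)).
    by apply: (@cvgB _ _ _ (nbhs x)); exact: continuous_lf.
  by rewrite subr_gt0; exact: tie_lt tm kA ntk.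
apply: filterS => y h k [kA kmin]; apply: contrapT => ntk.
have := h k; rewrite mem_filter kA andbT subr_gt0 => /(_ (asboolT ntk)).
by rewrite ltNge kmin//; case: tm.
Qed.

(** The gap of [k] above [m] is affine along the segment and nonnegative at both ends, so it
    vanishes inside only if it vanishes at both ends. *)
Lemma tie_mix x y t m : tie A c x m -> tie A c y m -> 0 < t < 1 ->
  tie A c (x + t *: (y - x)) = tie A c x `&` tie A c y.
Proof.
move=> mx my /andP[t0 t1].
have mA : m \in A by case: mx.
have t1' : 0 < 1 - t by rewrite subr_gt0.
apply/seteqP; split => k.
  move=> [kA kmin]; have := kmin _ mA; rewrite !lf_mix => le.
  have h1 : lf c m x <= lf c k x by apply: mx.2.
  have h2 : lf c m y <= lf c k y by apply: my.2.
  have p1 : 0 <= (1 - t) * (lf c k x - lf c m x) by rewrite mulr_ge0 ?subr_ge0// ltW.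
  have p2 : 0 <= t * (lf c k y - lf c m y) by rewrite mulr_ge0 ?subr_ge0// ltW.
  have z1 : (1 - t) * (lf c k x - lf c m x) = 0 by lra.
  have z2 : t * (lf c k y - lf c m y) = 0 by lra.
  have e1 : lf c k x = lf c m x.
    by apply/eqP; rewrite -subr_eq0; move/eqP: z1; rewrite mulf_eq0 (gt_eqF t1').
  have e2 : lf c k y = lf c m y.
    by apply/eqP; rewrite -subr_eq0; move/eqP: z2; rewrite mulf_eq0 (gt_eqF t0).
  by split; split => // l lA; rewrite ?e1 ?e2; [exact: mx.2|exact: my.2].
move=> [kx ky]; split; first by case: kx.
by move=> l lA; rewrite !lf_mix lerD//; apply: ler_wpM2l; rewrite ?(ltW t0) ?(ltW t1')//; [exact: kx.2|exact: ky.2].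
Qed.

Lemma face_mix T x y t : T !=set0 -> face_of T x -> face_of T y -> 0 <= t <= 1 ->
  face_of T (x + t *: (y - x)).
Proof.
move=> [m Tm] [Dx tx] [Dy ty] /andP[t0 t1].
move: t0; rewrite le_eqVlt => /predU1P[<-|t0]; first by rewrite scale0r addr0.
split; first by apply: (interior_mix pd (interior_subset Dx) Dy); rewrite t0.
move: t1; rewrite le_eqVlt => /predU1P[->|t1]; first by rewrite scale1r addrC subrK.
by rewrite (@tie_mix _ _ _ m) ?tx ?ty ?setIid// t0.
Qed.

Lemma mix_connected (S : set (plane R)) : (forall x y t, S x -> S y -> 0 <= t <= 1 -> S (x + t *: (y - x))) ->
  connected S.
Proof.
move=> Smix; have [->|/set0P[x Sx]] := eqVneq S set0; first exact: connected0.
have -> : S = \bigcup_(y in S) ((fun t : R => x + t *: (y - x)) @` `[0, 1]).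
  apply/seteqP; split => y.
    by move=> Sy; exists y => //; exists 1; rewrite /= ?in_itv /= ?ler01 ?lexx// scale1r addrC subrK.
  by move=> [z Sz [t + <-]]; rewrite /= in_itv /=; exact: Smix.
apply: bigcup_connected.
  by exists x => y Sy; exists 0; rewrite /= ?in_itv /= ?ler01 ?lexx// scale0r addr0.
move=> y Sy; apply: connected_continuous_connected; first exact: segment_connected.
apply: continuous_subspaceT => t.
apply: (@cvgD _ _ _ (nbhs t)); first exact: cvg_cst.
have tt : (fun t : R => t) @ t --> t by exact: cvg_id.
by have := @cvgZr_tmp _ _ _ _ _ _ _ (y - x) tt; exact.
Qed.

Lemma face_connected T : T !=set0 -> connected (face_of T).
Proof. by move=> T0; apply: mix_connected => x y t; exact: face_mix. Qed.

Lemma zdot_dir_eq0 m x (P : set (plane R)) : nbhs x P ->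
  (forall y, P y -> 0 <= zdot m (y - x)) -> m = 0.
Proof.
move=> xP h; apply/eqP; rewrite -(@map_mx_intr_eq0 R); apply/negPn/negP => /dot_gt0.
have [t [t0 _ Pt]] := pos_ex (near_dir (- map_mx intr m) xP).
have := h _ Pt; rewrite addrAC subrr add0r zdotZr zdotNr mulrN oppr_ge0 pmulr_rle0//.
by rewrite leNgt => /negP.
Qed.

(** If a single slope [k] is tied, [F] equals [lf c k] near the point; an affine function of any
    other representation that touches [F] from above there must then have slope [k]. *)
Lemma corner_locusP x : corner_locus D F x <-> D° x /\ exists m k, [/\ m != k, tie A c x m & tie A c x k].
Proof.
split; last first.
  move=> [Dx [m [k [mk tm tk]]]]; split => //; exists (head 0 A), (behead A), c; split.
    by apply: filterS (nbhs_interior Dx) => y Dy; rewrite FE//; exact: interior_subset.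
  have Dx' := interior_subset Dx.
  have [mA me] := (tieP pd HA c x m).1 tm; have [kA ke] := (tieP pd HA c x k).1 tk.
  by exists m, k; split; rewrite -?(slopes_cons pd HA)//= FE.
move=> [Dx [m0 [s [b [Fb [m [m' [mS m'S mm' me m'e]]]]]]]]; split => //.
have Dx' := interior_subset Dx.
have [k tk] := tie_ex pd HA c x.
apply: contrapT => none.
have only l : tie A c x l -> l = k.
  by move=> tl; apply: contrapT => /eqP lk; apply: none; exists l, k.
have near_k : \forall y \near x, F y = lf c k y.
  apply: filterS2 (near_tie_sub x) (nbhs_interior Dx) => y sub Dy.
  rewrite FE; last exact: interior_subset.
  have [l tl] := tie_ex pd HA c y; have [lA le] := (tieP pd HA c y l).1 tl.
  by rewrite le (only _ (sub _ tl)).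
have key l : l \in m0 :: s -> F x = b l + zdot l x -> l = k.
  move=> lS le; apply/eqP; rewrite -subr_eq0; apply/eqP.
  apply: (@zdot_dir_eq0 _ x [set y | F y = lf c k y /\ F y = tropical_poly m0 s b y]).
    by apply: filterI.
  move=> y /= [yk yb]; have [lle _] := trop_min m0 s b y.
  have := lle _ lS; rewrite -yb yk; move: le; rewrite (nbhs_singleton near_k) /lf.
  by rewrite zdotBl !zdotBr; lra.
by move/eqP: mm'; apply; rewrite (key _ mS me) (key _ m'S m'e).
Qed.

(** A tie of two distinct slopes at both points makes [y - x] orthogonal to [m - k], hence parallel
    to [a], and along [a] all slopes of [T] change equally. *)
Lemma tie_collinear x y m k T : collinear T -> T m -> T k -> m != k ->
  tie A c x m -> tie A c x k -> tie A c y m -> tie A c y k ->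
  forall l, T l -> tie A c x l -> tie A c y l.
Proof.
move=> [a a0 aT] Tm Tk mk xm xk ym yk l Tl xl.
have mk0 : zdot (m - k) (y - x) = 0.
  have := tie_lf xm xk; have := tie_lf ym yk; rewrite /lf zdotBl !zdotBr; lra.
have n0 : map_mx intr (m - k) != 0 :> plane R by rewrite map_mx_intr_eq0 subr_eq0.
have na : dot (map_mx intr (m - k)) a = 0.
  by rewrite -/(zdot _ _) zdotBl (aT _ _ Tm Tk) subrr.
have [r yxE] : exists r, y - x = r *: a.
  apply: cross0_scale => //.
  set n := map_mx intr (m - k) in n0 na.
  have n1 : dot n (y - x) = 0 by [].
  have : dot n n * cross a (y - x) = 0.
    have -> : dot n n * cross a (y - x) = cross n (y - x) * dot n a + - cross n a * dot n (y - x).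
      by rewrite /cross !dotE; ring.
    by rewrite na n1 !mulr0 addr0.
  by move/eqP; rewrite mulf_eq0 (gt_eqF (dot_gt0 n0)) => /eqP.
have : zdot (l - m) (y - x) = 0 by rewrite yxE zdotZr zdotBl (aT _ _ Tl Tm) subrr mulr0.
have := tie_lf xl xm; rewrite /lf zdotBl !zdotBr => e1 e2.
have e : lf c l y = lf c m y by rewrite /lf; lra.
split; first by case: xl.
by move=> j jA; rewrite e; exact: ym.2.
Qed.

Lemma supdiff_tie x m : D x -> tie A c x m -> superdifferential D F x (map_mx intr m).
Proof.
move=> Dx /(tieP pd HA)[mA me] y Dy; rewrite !FE// me -/(zdot _ _).
by have [le _] := Fm_min pd HA c y; apply: le_trans (le _ mA) _; rewrite /lf zdotBr; lra.
Qed.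

(** Near [x], along [a] and along [- a], [F] is affine with slope [zdot m a]; the supergradient
    inequality used both ways gives equality. *)
Lemma supdiff_dir x a u : D° x -> (forall m k, tie A c x m -> tie A c x k -> zdot m a = zdot k a) ->
  superdifferential D F x u -> forall m, tie A c x m -> dot u a = zdot m a.
Proof.
move=> Dx ta su m tm; have [mA me] := (tieP pd HA c x m).1 tm.
have Fdir (b : plane R) : (forall m k, tie A c x m -> tie A c x k -> zdot m b = zdot k b) -> zdot m b <= dot u b.
  move=> tb.
  have nb : nbhs x [set y | tie A c y `<=` tie A c x /\ D° y].
    by apply: filterI; [exact: near_tie_sub|exact: nbhs_interior].
  have [t [t0 _ [/= sub Dt]]] := pos_ex (near_dir b nb).
  have := su _ (interior_subset Dt); rewrite !FE; [|exact: interior_subset..].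
  have [l tl] := tie_ex pd HA c (x + t *: b); have [lA le] := (tieP pd HA c _ l).1 tl.
  have lx := sub _ tl; have [_ lxe] := (tieP pd HA c _ l).1 lx.
  have xx : x + t *: b - x = t *: b by rewrite addrAC subrr add0r.
  rewrite le lxe xx dotZr /lf zdotDr zdotZr (tb _ _ lx tm).
  by move=> h; rewrite -(ler_pM2l t0); lra.
apply/eqP; rewrite eq_le (Fdir a ta) andbT.
have := Fdir (- a); rewrite zdotNr dotNr lerN2; apply => j k tj tk.
by rewrite !zdotNr (ta _ _ tj tk).
Qed.

(** If the ties are collinear, all supergradients agree along [a] and so differ in one direction
    only; otherwise three tied slopes not on a line are themselves supergradients. *)
Lemma corner_vertexP x : corner_vertex D F x <-> D° x /\ ~ collinear (tie A c x).
Proof.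
split.
  move=> [Dx [u [v [w [su sv sw rf]]]]]; split => // -[a a0 ta].
  have [m tm] := tie_ex pd HA c x.
  have e (p : plane R) (sp : superdifferential D F x p) : dot p a = zdot m a := supdiff_dir Dx ta sp tm.
  move: rf; rewrite /row_free => rk.
  have /row_fullP[B BM] : row_full (col_mx (v - u) (w - u)) by rewrite /row_full (eqP rk).
  move/eqP: a0; apply; apply: trmx_inj; rewrite trmx0 -[a^T]mul1mx -BM -mulmxA.
  rewrite mul_col_mx.
  have z (p q : plane R) : superdifferential D F x p -> superdifferential D F x q -> (p - q) *m a^T = 0.
    move=> sp sq; apply/matrixP => i j; rewrite !ord1 !mxE.
    transitivity (dot (p - q) a); first by apply: eq_bigr => k _; rewrite [a^T _ _]mxE.
    by rewrite dotDl dotNl !e// subrr.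
  by rewrite !z// col_mx0 mulmx0.
move=> [Dx nc]; split => //; have Dx' := interior_subset Dx.
have [m tm] := tie_ex pd HA c x.
have [k [tk km]] : exists k, tie A c x k /\ k != m.
  apply: contrapT => h; apply: nc; exists (\row_j 1).
    by apply/eqP => /(congr1 (fun v : plane R => v 0 0)) /eqP; rewrite !mxE oner_eq0.
  have only l : tie A c x l -> l = m by move=> tl; apply: contrapT => /eqP lm; apply: h; exists l.
  by move=> j l /only -> /only ->.
pose p : plane R := map_mx intr (k - m).
have p0 : p != 0 by rewrite map_mx_intr_eq0 subr_eq0.
pose a := rot p; have a0 : a != 0 := rot_neq0 p0.
have [l [tl la]] : exists l, tie A c x l /\ zdot (l - m) a != 0.
  apply: contrapT => h; apply: nc; exists a => //.
  have only l : tie A c x l -> zdot l a = zdot m a.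
    move=> tl; apply/eqP; rewrite -subr_eq0 -zdotBl; apply: contraT => la; exfalso; apply: h.
    by exists l.
  by move=> j l /only -> /only ->.
exists (map_mx intr m), (map_mx intr k), (map_mx intr l).
split; [exact: (supdiff_tie Dx' tm)|exact: (supdiff_tie Dx' tk)|exact: (supdiff_tie Dx' tl)|].
apply: inj_row_free => r; rewrite -(hsubmxK r) mul_row_col => rE.
set r0 := lsubmx r 0 0; set r1 := rsubmx r 0 0.
have l0 : lsubmx r = const_mx r0 by apply/matrixP => i j; rewrite !ord1 [RHS]mxE.
have l1 : rsubmx r = const_mx r1 by apply/matrixP => i j; rewrite !ord1 [RHS]mxE.
have qE : map_mx intr l - map_mx intr m = map_mx intr (l - m) :> plane R.
  by apply/rowP => j; rewrite !mxE intrB.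
have pE : map_mx intr k - map_mx intr m = p by apply/rowP => j; rewrite !mxE intrB.
set q : plane R := map_mx intr (l - m) in qE.
have mulE (s : R) (v : plane R) : (const_mx s : 'M[R]_(1, 1)) *m v = s *: v.
  by apply/rowP => j; rewrite !mxE big_ord1 !mxE.
move: rE; rewrite l0 l1 pE qE !mulE => rE.
have pa : dot p a = 0 := dot_rot p.
have qa : dot q a != 0 by [].
have r10 : r1 = 0.
  have := congr1 (fun v => dot v a) rE; rewrite dot0l dotDl [dot (r0 *: p) a]dotC [dot (r1 *: q) a]dotC !dotZr.
  rewrite [dot a p]dotC pa mulr0 add0r dotC => /eqP; rewrite mulf_eq0 (negPf qa) orbF => /eqP //.
have r00 : r0 = 0.
  by move/eqP: rE; rewrite r10 scale0r addr0 scaler_eq0 (negPf p0) orbF => /eqP.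
by rewrite r00 r10; apply/matrixP => i j; rewrite !mxE; case: splitP => ? _; rewrite mxE.
Qed.
End Strata.

(** * Vertices, edges and cells from tie sets *)

Section Faces.
Variables (R : realType) (D : set (plane R)) (V : seq (plane R)) (L : seq (lattice * R)) (N : nat).
Hypothesis pd : polygon_data D V L.
Variable A : seq lattice.
Hypothesis HA : slopes L N A.
Variables (c : lattice -> R) (F : plane R -> R).
Hypothesis FE : forall x, D x -> F x = Fm A c x.
Implicit Types (m k l : lattice) (x y z v w a : plane R) (T : set lattice) (U W X : set (plane R)).
Notation tie := (tie A c).
Notation face_of := (face_of D A c).

Definition edge_points := corner_locus D F `\` corner_vertex D F.

Lemma edge_pointsP x : edge_points x <-> [/\ D° x, collinear R (tie x) &
  exists m k, [/\ m != k, tie x m & tie x k]].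
Proof.
rewrite /edge_points /setD /=; split.
  move=> [/(corner_locusP pd HA FE)[Dx two] /(corner_vertexP pd HA FE) h]; split => //.
  by apply: contrapT => nc; exact: h.
move=> [Dx co two]; split; first by apply/(corner_locusP pd HA FE).
by move=> /(corner_vertexP pd HA FE)[_].
Qed.

Lemma tie_neq0 x : tie x !=set0. Proof. exact: (tie_ex pd HA c x). Qed.

Lemma edge_near x : edge_points x -> \forall y \near x, edge_points y -> tie y = tie x.
Proof.
move=> /edge_pointsP[Dx co _]; apply: filterS (near_tie_sub pd HA c x) => y sub.
move=> /edge_pointsP[_ _ [m [k [mk ym yk]]]]; apply/seteqP; split => // l xl.
exact: (tie_collinear co (sub _ ym) (sub _ yk) mk (sub _ ym) (sub _ yk) ym yk xl xl).
Qed.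

(** By [edge_near], [tie] is locally constant on the edge points, hence constant on a connected
    component; conversely the level set is connected. *)
Lemma edge_component x : edge_points x -> connected_component edge_points x = face_of (tie x).
Proof.
move=> Ex; have [Dx co two] := (edge_pointsP x).1 Ex.
apply/seteqP; split; last first.
  apply: connected_component_max; first by split.
    by move=> y [Dy ty]; apply/edge_pointsP; rewrite ty.
  exact: (face_connected pd (tie_neq0 x)).
set C := connected_component edge_points x.
have CE : C `<=` edge_points by exact: connected_component_sub.
have Cx : C x by exact: connected_component_refl.
suff e : C `&` [set y | tie y = tie x] = C.
  move=> y Cy; have [Dy _ _] := (edge_pointsP y).1 (CE _ Cy); split => //.
  by move: Cy; rewrite -e => -[].
have Cc := @component_connected _ edge_points x.
pose O1 := [set y | edge_points y -> tie y = tie x]°.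
pose O2 := [set y | edge_points y -> tie y <> tie x]°.
apply: Cc; first by exists x.
  exists O1; first exact: open_interior.
  apply/seteqP; split => y [Cy h]; split => //.
    by rewrite /O1 /interior /= -h; exact/edge_near/CE.
  by have := interior_subset h; apply; exact: CE.
exists (~` O2); first exact/open_closedC/open_interior.
apply/seteqP; split => y [Cy h]; split => //.
  by move=> /interior_subset/(_ (CE _ Cy)).
apply: contrapT => ne; apply: h; rewrite /O2 /interior /=.
by apply: filterS (edge_near (CE _ Cy)) => z zE /zE ->.
Qed.

(** A small step along [k - m], for two tied slopes, removes [k] from the ties and adds none; repeat
    while two slopes are tied. *)
Lemma single_dense U : open U -> U !=set0 -> exists2 x, U x & exists m, tie x = [set m].
Proof.
move=> Uo [x0 Ux0].
pose cnt x := size [seq m <- undup A | `[< tie x m >]].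
have mem x m : (m \in [seq m <- undup A | `[< tie x m >]]) <-> tie x m.
  rewrite mem_filter mem_undup; split; first by move=> /andP[/asboolP].
  by move=> tm; rewrite asboolT//=; case: tm.
suff : forall n x, U x -> (cnt x <= n)%N -> exists2 x, U x & exists m, tie x = [set m].
  by move=> /(_ (cnt x0) x0 Ux0 (leqnn _)).
elim=> [|n IH] x Ux cx.
  have [m /mem tm] := tie_neq0 x.
  by move: cx tm; rewrite leqn0 size_eq0 => /eqP ->.
have [m tm] := tie_neq0 x.
have [only|] := pselect (forall k, tie x k -> k = m).
  by exists x => //; exists m; apply/seteqP; split => k; [exact: only|move=> ->].
move=> /existsNP[k /not_implyP[tk /eqP km]].
pose a : plane R := map_mx intr (k - m).
have nb : nbhs x [set y | tie y `<=` tie x /\ U y].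
  by apply: filterI; [exact: (near_tie_sub pd HA)|exact: open_nbhs_nbhs].
have [t [t0 _ [/= sub Ut]]] := pos_ex (near_dir a nb).
apply: (IH _ Ut).
have ntk : ~ tie (x + t *: a) k.
  move=> [_ kmin]; have := kmin m (proj1 tm); rewrite /lf !zdotDr !zdotZr.
  have := tie_lf tm tk; rewrite /lf => e.
  have p : 0 < t * zdot (k - m) a.
    by rewrite mulr_gt0//; apply: dot_gt0; rewrite map_mx_intr_eq0 subr_eq0.
  by move: p; rewrite zdotBl; lra.
rewrite -ltnS; apply: leq_trans cx; rewrite /cnt.
have kx : k \in [seq m <- undup A | `[< tie x m >]] by apply/mem.
rewrite (perm_size (perm_to_rem kx)) ltnS; apply: uniq_leq_size; first by rewrite filter_uniq ?undup_uniq.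
move=> l /mem tl; rewrite mem_rem_uniq ?filter_uniq ?undup_uniq// inE; apply/andP; split; last exact/mem/sub.
by apply/eqP => e; apply: ntk; rewrite -e.
Qed.

(** A point of [U] with a single tie identifies the slope of [F] on [U] as some [m]. A further slope
    tied at [y] would lie above [lf c m] near [y] with equality at [y], so it is [m] itself. *)
Lemma affine_region U : open U -> U !=set0 -> U `<=` D° -> affine_on U F ->
  exists m, U `<=` face_of [set m].
Proof.
move=> Uo U0 UD [u [b UF]]; have [x Ux [m tx]] := single_dense Uo U0.
have nx : nbhs x U by exact: open_nbhs_nbhs.
have tm : tie x m by rewrite tx.
have FU y : U y -> F y = Fm A c y by move=> /UD Dy; apply: FE; exact: interior_subset.
have nm : \forall y \near x, F y = lf c m y.
  apply: filterS2 (near_tie_sub pd HA c x) nx => y sub Uy.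
  have [l tl] := tie_neq0 y; have := sub _ tl; rewrite tx => lm; rewrite /= in lm.
  by move: tl; rewrite lm => /(tieP pd HA)[_ <-]; exact: FU.
have um a : zdot m a = dot u a.
  have [t [t0 _ [/= e1 e2]]] := pos_ex (near_dir a (filterI nm nx)).
  have := nbhs_singleton nm; move: e1; rewrite !UF// /lf zdotDr zdotZr dotDr dotZr => e1 e3.
  have /eqP : t * (zdot m a - dot u a) = 0 by lra.
  by rewrite mulf_eq0 (gt_eqF t0) subr_eq0 => /eqP.
have Um y : U y -> F y = lf c m y.
  by move=> Uy; have := nbhs_singleton nm; rewrite !UF// /lf !um; lra.
exists m => y Uy; split; first exact: UD.
have ty : tie y m by apply/(tieP pd HA); split; [case: tm|rewrite -FU// Um].
apply/seteqP; split => k; last by move=> ->.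
move=> tk; apply/eqP; rewrite -subr_eq0; apply/eqP.
apply: (@zdot_dir_eq0 R _ y U); first exact: open_nbhs_nbhs.
move=> z Uz; have [le _] := Fm_min pd HA c z.
have := le k (proj1 tk); rewrite -FU// Um//; have := tie_lf tk ty.
by rewrite /lf zdotBl !zdotBr; lra.
Qed.

Lemma face_open m : open (face_of [set m]).
Proof.
rewrite openE => x [Dx tx]; rewrite /interior /=.
apply: filterS2 (near_tie_sub pd HA c x) (nbhs_interior Dx) => y sub Dy.
split => //; have [l tl] := tie_neq0 y; have := sub _ tl; rewrite tx /= => lm.
by apply/seteqP; split => k; [move=> /sub; rewrite tx|move=> ->; rewrite -lm].
Qed.

Lemma face_lf m x : face_of [set m] x -> F x = lf c m x.
Proof.
move=> [Dx tx]; rewrite FE; last exact: interior_subset.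
by have [] := (tieP pd HA c x m).1 (eq_ind_r (fun T => T m) erefl tx).
Qed.

Lemma linearity_regionP U : linearity_region D F U <-> U !=set0 /\ exists m, U = face_of [set m].
Proof.
have faceN m : [set m] !=set0 by exists m.
have aff m : affine_on (face_of [set m]) F.
  by exists (map_mx intr m), (c m) => x /face_lf.
split.
  move=> [[Uo Uc U0 UD UF] Umax]; split => //.
  have [m Um] := affine_region Uo U0 UD UF; exists m; apply/esym; apply: Umax => //.
  - exact: face_open.
  - exact: (face_connected pd (faceN m)).
  - by move=> x [].
move=> [U0 [m UE]]; rewrite UE in U0 *; split.
  split; [exact: face_open|exact: (face_connected pd (faceN m))|by []|by move=> x []|exact: aff].
move=> W Wo Wc WD WF sub; have W0 : W !=set0 by case: U0 => x /sub; exists x.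
have [k Wk] := affine_region Wo W0 WD WF.
apply/seteqP; split => // x Wx.
have [y my] := U0; have [_ tk] := Wk _ (sub _ my); case: my => Dy ty.
have -> : m = k.
  by have : [set k] m by rewrite -tk ty.
exact: Wk.
Qed.

Definition kind (d : nat) T : Prop := match d with
  | 0 => ~ collinear R T
  | 1 => collinear R T /\ exists m k, [/\ m != k, T m & T k]
  | 2 => exists m, T = [set m]
  | _ => False
  end.

Lemma vertex_face x : ~ collinear R (tie x) -> D° x -> face_of (tie x) = [set x].
Proof.
move=> nc Dx; apply/seteqP; split => [y [Dy ty]|_ -> //].
apply: contrapT => /eqP yx; apply: nc; exists (y - x); first by rewrite subr_eq0.
move=> m k mx kx; have my : tie y m by rewrite ty.
have ky : tie y k by rewrite ty.
by have := tie_lf mx kx; have := tie_lf my ky; rewrite /lf !zdotBr; lra.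
Qed.

Lemma faceP d X : face D F d X <-> exists x, [/\ D° x, X = face_of (tie x) & kind d (tie x)].
Proof.
case: d => [|[|[|d]]] /=.
- split.
    move=> [x /(corner_vertexP pd HA FE)[Dx nc] <-]; exists x; split => //.
    by rewrite vertex_face.
  move=> [x [Dx -> nc]]; exists x; first by apply/(corner_vertexP pd HA FE).
  by rewrite vertex_face.
- split.
    move=> [x Ex ->]; have [Dx co two] := (edge_pointsP x).1 Ex.
    by exists x; split => //; exact: edge_component.
  move=> [x [Dx -> [co two]]]; have Ex : edge_points x by apply/edge_pointsP.
  by exists x => //; apply/esym; exact: edge_component.
- split.
    move=> /linearity_regionP[[x Ux] [m UE]]; exists x.
    by move: Ux; rewrite UE => -[Dx ->]; split => //; exists m.
  move=> [x [Dx -> [m tx]]]; apply/linearity_regionP; split; first by exists x.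
  by exists m; rewrite tx.
- by split=> [[]|[x []]].
Qed.

(** Ties can only grow in the limit. Conversely, a small step from [x] towards [y] has as tie set
    the intersection of those of [x] and [y], by [tie_mix]. *)
Lemma closure_face x y : D x -> D° y -> (closure (face_of (tie y)) x <-> tie y `<=` tie x).
Proof.
move=> Dx Dy; split.
  by move=> /(_ _ (near_tie_sub pd HA c x))[z [[_ <-]]].
move=> sub B Bx; have [m my] := tie_neq0 y.
have [t [t0 t1 Bt]] := pos_ex (near_dir (y - x) Bx).
exists (x + t *: (y - x)); split => //; split.
  by apply: (interior_mix pd) => //; rewrite t0 ltW.
rewrite (tie_mix (sub _ my) my) ?t0//.
by apply/seteqP; split => [k []//|k ky]; split => //; exact: sub.
Qed.

Lemma closure_face_D T x : closure (face_of T) x -> D x.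
Proof.
have cl : closed D by apply: compact_closed; [exact: norm_hausdorff|exact: pd_compact pd].
move=> h; apply: cl; apply: closureS h => y [Dy _]; exact: interior_subset.
Qed.

Lemma has_gradientP m k : face_of [set m] !=set0 -> has_gradient F (face_of [set m]) k <-> k = m.
Proof.
move=> [x mx]; split; last by move=> ->; exists (c m) => y /face_lf.
move=> [b bk]; have nx : nbhs x (face_of [set m]) by apply: open_nbhs_nbhs; split => //; exact: face_open.
apply/eqP; rewrite -subr_eq0; apply/eqP; apply: (@zdot_dir_eq0 R _ x _ nx) => y my.
have := bk _ my; have := bk _ mx; rewrite (face_lf mx) (face_lf my) /lf zdotBl !zdotBr; lra.
Qed.
End Faces.

(** * Vertices and sides of the polygon *)

Section BoundaryFaces.
Variables (R : realType) (D : set (plane R)) (V : seq (plane R)) (L : seq (lattice * R)).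
Hypothesis pd : polygon_data D V L.
Implicit Types (x y z v w a u : plane R) (S X : set (plane R)).

Lemma vertex_not_interior v : polygon_vertex D v -> D v /\ ~ D° v.
Proof.
move=> [Dv ext]; split => // Div.
pose a : plane R := const_mx 1.
have [t [t0 _ [/= Dp Dm]]] := pos_ex (filterI (near_dir a Div) (near_dir (- a) Div)).
have half : 0 < (2^-1 : R) < 1 by rewrite invr_gt0 ltr0n invf_lt1 ?ltr1n// ltr0n.
have e : v = 2^-1 *: (v + t *: a) + (1 - 2^-1) *: (v + t *: - a).
  by apply/plane_eq; rewrite !mxE; field.
have := ext _ _ _ Dp Dm half e => /(congr1 (fun w : plane R => w 0 0)); rewrite !mxE; lra.
Qed.

Lemma interior_dot_lt u x y : u != 0 -> D° x -> (forall z, D z -> dot u z <= dot u y) -> dot u x < dot u y.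
Proof.
move=> u0 Dx ymax; have [t [t0 _ Dt]] := pos_ex (near_dir u Dx).
have := ymax _ Dt; rewrite dotDr dotZr; have : 0 < t * dot u u by rewrite mulr_gt0// dot_gt0.
lra.
Qed.

Lemma boundary_face_D X x : boundary_face D X -> X x -> D x /\ ~ D° x.
Proof.
case=> [[v vv ->] ->|[S [u [u0 -> _]] ->] [[Dx xmax] _]]; first exact: vertex_not_interior.
by split => // Dix; have := interior_dot_lt u0 Dix xmax; rewrite ltxx.
Qed.

(** [u] sums the negated normals of the sides through [v]. A second point [y] on all these sides
    would let the segment from [y] be extended beyond [v] inside [D], so [v] would not be
    extremal. *)
Lemma vertex_exposed v : polygon_vertex D v -> exists u, forall y, D y -> y <> v -> dot u (y - v) < 0.
Proof.
move=> [Dv ext]; pose act := [seq s <- L | af s v == 0].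
pose u := \sum_(s <- act) - map_mx intr s.1 : plane R.
have gen y r : {subset r <= act} -> dot (\sum_(s <- r) - map_mx intr s.1) (y - v) = - \sum_(s <- r) af s y.
  elim: r => [|s r IH] sub; first by rewrite !big_nil dot0l oppr0.
  rewrite !big_cons opprD dotDl IH; last by move=> k kr; apply: sub; rewrite inE kr orbT.
  congr (_ + _); rewrite dotNl -/(zdot _ _) zdotBr.
  have := sub s (mem_head _ _); rewrite mem_filter => /andP[/eqP]; rewrite /af; lra.
have uE y : dot u (y - v) = - \sum_(s <- act) af s y by exact: gen.
exists u => y Dy yv; rewrite uE oppr_lt0 lt_neqAle.
have af0 s : s \in act -> 0 <= af s y.
  by rewrite mem_filter => /andP[_ sL]; exact: (pd_L pd y).1.
rewrite big_seq sumr_ge0 ?andbT//; apply/eqP => /esym s0; apply: yv; apply/esym.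
have act0 s : s \in act -> af s y = 0.
  move=> sact; move/eqP: s0; rewrite psumr_eq0// => /allP/(_ s sact).
  by rewrite sact => /eqP.
have [e e0 el] : exists2 e, 0 < e & forall s, s \in L -> s \notin act -> e * af s y <= af s v.
  (* Only sides not through [v] limit the extension; the denominator [1 + af s y] avoids dividing by
     0. *)
  have [e e0 el] : exists2 e, 0 < e & forall s, s \in [seq s <- L | af s v != 0] -> e <= af s v / (1 + af s y).
    apply: seq_pos_lb => s; rewrite mem_filter => /andP[sv sL].
    have a1 := (pd_L pd v).1 Dv s sL; have a2 := (pd_L pd y).1 Dy s sL.
    by apply: divr_gt0; [rewrite lt_neqAle eq_sym sv|lra].
  exists e => // s sL sact; have a2 := (pd_L pd y).1 Dy s sL.
  have := el s; rewrite mem_filter sL andbT; move: sact; rewrite mem_filter sL andbT => -> /(_ isT).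
  by rewrite ler_pdivlMr; [rewrite mulrDr; lra|lra].
pose z := v + e *: (v - y).
have Dz : D z.
  apply/(pd_L pd) => s sL.
  have -> : af s z = (1 + e) * af s v - e * af s y by rewrite /z /af zdotDr zdotZr zdotBr; ring.
  have [sact|sact] := boolP (s \in act).
    rewrite act0// mulr0 subr0 mulr_ge0//; [lra|exact: (pd_L pd v).1].
  have := el s sL sact; have := (pd_L pd v).1 Dv s sL => h1 h2.
  have := mulr_ge0 (ltW e0) h1; lra.
pose t := e / (1 + e).
have e1 : 1 + e != 0 by rewrite gt_eqF// addr_gt0.
have t01 : 0 < t < 1 by rewrite /t divr_gt0 ?addr_gt0// ltr_pdivrMr ?addr_gt0// mul1r; lra.
have vE : v = t *: y + (1 - t) *: z by apply/plane_eq; rewrite /z /t !mxE; field.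
have yz := ext _ _ _ Dy Dz t01 vE.
by rewrite vE -yz -scalerDl addrC subrK scale1r.
Qed.
End BoundaryFaces.

Lemma perp_cross (R : realType) (p q w : plane R) : w != 0 -> dot p w = 0 -> dot q w = 0 -> cross p q = 0.
Proof.
move=> /dot_gt0 w0 pw qw; apply/eqP.
have : cross p q * dot w w = dot p w * cross w q - dot q w * cross w p.
  by rewrite /cross !dotE; ring.
by rewrite pw qw !mul0r subrr => /eqP; rewrite mulf_eq0 (gt_eqF w0) orbF.
Qed.

Section Sides.
Variables (R : realType) (D : set (plane R)) (V : seq (plane R)) (L : seq (lattice * R)).
Hypothesis pd : polygon_data D V L.
Implicit Types (x y z v w a u : plane R) (S X : set (plane R)).

Definition maximizers u := [set x | D x /\ forall y, D y -> dot u y <= dot u x].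

Lemma side_flat u y : maximizers u y -> ~ polygon_vertex D y -> exists x z t,
  [/\ D x, D z & x != z] /\ [/\ 0 < t < 1, y = t *: x + (1 - t) *: z & dot u (x - z) = 0].
Proof.
move=> [Dy ymax] nv; have : ~ forall x z (t : R), D x -> D z -> 0 < t < 1 ->
    y = t *: x + (1 - t) *: z -> x = z by move=> h; apply: nv.
move=> /existsNP[x /existsNP[z /existsNP[t]]].
move=> /not_implyP[Dx /not_implyP[Dz /not_implyP[t01 /not_implyP[yE /eqP xz]]]].
exists x, z, t; split => //; split => //.
have := ymax _ Dx; have := ymax _ Dz; rewrite dotBr yE dotDr !dotZr; case/andP: t01; nra.
Qed.

(** A common point that is not a vertex lies inside a segment on which both functionals are
    constant, so these are parallel; an interior point shows the factor to be positive. *)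
Lemma maximizers_eq u u' y : u != 0 -> u' != 0 -> maximizers u y -> maximizers u' y ->
  ~ polygon_vertex D y -> maximizers u = maximizers u'.
Proof.
move=> u0 u'0 uy u'y nv.
have [x [z [t [[Dx Dz xz] [t01 yE uxz]]]]] := side_flat uy nv.
have u'xz : dot u' (x - z) = 0.
  have [_ ymax] := u'y; have := ymax _ Dx; have := ymax _ Dz.
  by rewrite dotBr yE dotDr !dotZr; case/andP: t01; nra.
have [r u'E] : exists r, u' = r *: u.
  by apply: cross0_scale => //; apply: (perp_cross _ uxz u'xz); rewrite subr_eq0.
have [p Dp] := pd_ne pd.
have lt1 := interior_dot_lt u0 Dp (proj2 uy).
have lt2 := interior_dot_lt u'0 Dp (proj2 u'y).
have r0 : 0 < r by move: lt2; rewrite u'E !dotZl; nra.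
have e w : dot u' w = r * dot u w by rewrite u'E dotZl.
apply/seteqP; split => w [Dw wmax]; split => // w' /wmax; rewrite !e; first by rewrite ler_pM2l.
by rewrite ler_pM2l.
Qed.
End Sides.

(** * Matching faces with equal tie sets *)

Section Transfer.
Variables (R : realType) (D : set (plane R)) (V : seq (plane R)) (L : seq (lattice * R)) (N : nat).
Hypothesis pd : polygon_data D V L.
Variable A : seq lattice.
Hypothesis HA : slopes L N A.
Variables (c c' : lattice -> R) (F F' : plane R -> R).
Hypothesis FE : forall x, D x -> F x = Fm A c x.
Hypothesis F'E : forall x, D x -> F' x = Fm A c' x.
Hypothesis F0 : forall x, D x -> 0 <= Fm A c x /\ (~ D° x -> Fm A c x = 0).
Hypothesis F'0 : forall x, D x -> 0 <= Fm A c' x /\ (~ D° x -> Fm A c' x = 0).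
Hypothesis fam : forall x, D° x -> exists2 z, D° z & tie A c' z = tie A c x.
Hypothesis bnd : forall x, D x -> ~ D° x -> tie A c x = tie A c' x.
Implicit Types (m k l : lattice) (x y z v w a u nu : plane R) (T : set lattice) (S U W X Y Z : set (plane R)).
Notation face_of := (face_of D A).

(** A relation rather than a map: it is symmetric in the two coefficient vectors, so each transfer
    statement yields its converse through [corr_sym]. *)
Inductive corr X X' : Prop :=
  | CorrFace x x' of D° x & D° x' & tie A c x = tie A c' x' &
      X = face_of c (tie A c x) & X' = face_of c' (tie A c' x')
  | CorrBoundary of boundary_face D X & X' = X.

Lemma corr_inj X Y X' : corr X X' -> corr Y X' -> X = Y.
Proof.
case=> [x x' Dx Dx' e -> X'E|bX X'X]; case=> [y y' Dy Dy' e2 -> X'E2|bY X'Y].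
- have : face_of c' (tie A c' y') x' by rewrite -X'E2 X'E.
  by move=> [_ e3]; rewrite e e2 e3.
- have : Y x' by rewrite -X'Y X'E.
  by move=> /(boundary_face_D bY)[_]; case.
- have : X y' by rewrite -X'X X'E2.
  by move=> /(boundary_face_D bX)[_]; case.
- by rewrite -X'X.
Qed.

Lemma corr_closure x x' y y' : D° x -> D° x' -> D° y -> D° y' ->
  tie A c x = tie A c' x' -> tie A c y = tie A c' y' ->
  face_of c (tie A c x) `<=` closure (face_of c (tie A c y)) ->
  face_of c' (tie A c' x') `<=` closure (face_of c' (tie A c' y')).
Proof.
move=> Dx Dx' Dy Dy' ex ey sub z [Dz tz].
apply/(closure_face pd HA c' (interior_subset Dz) Dy').
rewrite tz -ex -ey; apply/(closure_face pd HA c (interior_subset Dx) Dy).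
exact: sub.
Qed.

Lemma corr_boundary_closure x x' b : D° x -> D° x' -> tie A c x = tie A c' x' -> ~ D° b ->
  closure (face_of c (tie A c x)) b -> closure (face_of c' (tie A c' x')) b.
Proof.
move=> Dx Dx' e nb cb; have Db := closure_face_D pd cb.
by apply/(closure_face pd HA c' Db Dx'); rewrite -e -bnd//; apply/(closure_face pd HA c Db Dx).
Qed.

Definition argmin_dir T a : set lattice := [set m | T m /\ forall k, T k -> zdot m a <= zdot k a].

(** Just after [v] only slopes tied at [v] compete, and those smallest along [a] win. The face
    entered in a direction therefore depends on the tie set at [v] alone. *)
Lemma tie_dir b v a : \forall t \near 0^'+, tie A b (v + t *: a) = argmin_dir (tie A b v) a.
Proof.
have h := near_dir a (near_tie_sub pd HA b v).
apply: filterS2 h (nbhs_right_gt 0) => t sub t0.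
have lfE m k : tie A b v m -> tie A b v k ->
    (lf b m (v + t *: a) <= lf b k (v + t *: a)) = (zdot m a <= zdot k a).
  move=> tm tk; have := tie_lf tm tk; rewrite /lf !zdotDr !zdotZr => e.
  by rewrite !addrA e lerD2l ler_pM2l.
have [m0 tm0] := tie_ex pd HA b (v + t *: a).
apply/seteqP; split => m.
  move=> tm; have vm := sub _ tm; split => // k vk.
  by rewrite -lfE//; apply: tm.2; case: vk.
move=> [vm mmin]; split; first by case: vm.
move=> k kA; apply: le_trans (tm0.2 _ kA); rewrite lfE//; [exact/mmin/sub|exact: sub].
Qed.

Definition same_point v v' := [/\ D° v, D° v' & tie A c v = tie A c' v'] \/ [/\ D v, ~ D° v & v' = v].

Lemma corr_direction v v' X X' a : same_point v v' -> corr X X' ->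
  direction_at v X a -> direction_at v' X' a.
Proof.
move=> vv' [x x' Dx Dx' e -> ->|bX ->] dir.
  have T : tie A c x = argmin_dir (tie A c v) a.
    by have [t [_ _ [[_ <-] <-]]] := pos_ex (filterI dir (tie_dir c v a)).
  have Dn : \forall t \near 0^'+, D° (v' + t *: a).
    case: vv' => [[_ Dv' _]|[_ _ ->]]; first exact/near_dir/nbhs_interior.
    by apply: filterS dir => t [].
  have tv : tie A c' v' = tie A c v by case: vv' => [[_ _ ->]//|[Dv nv ->]]; rewrite bnd.
  apply: filterS2 Dn (tie_dir c' v' a) => t Dt te; split => //.
  by rewrite te tv -T.
case: vv' => [[Dv _ _]|[_ _ ->]//].
have Dn := near_dir a (nbhs_interior Dv).
have [t [_ _ [h1 h2]]] := pos_ex (filterI dir Dn).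
by case: (boundary_face_D bX h1) => _; case.
Qed.

(* At a point with tie set [T] containing [m], the outer normal vector of the cell
   with gradient [m]; the sum over [T] makes it exposing at a vertex of the cell. *)
Definition normal T m : plane R := \sum_(k <- undup A | `[< T k >]) map_mx intr (m - k).

(* Cyclic orders along a cell are tested on outer normals, which depend only on
   the tie sets, rather than on the chosen points. *)
Inductive supporting m X : plane R -> bool -> Prop :=
  | SupportFace x k of D° x & X = face_of c (tie A c x) & tie A c x m & tie A c x k & k != m :
      supporting m X (normal (tie A c x) m) `[< collinear R (tie A c x) >]
  | SupportVertex v u of polygon_vertex D v & X = [set v] & (forall y, D y -> y <> v -> dot u (y - v) < 0) :
      supporting m X u false
  | SupportSide u of u != 0 & X = maximizers D u `\` polygon_vertex D : supporting m X u true.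

Lemma supporting_ex m X x : low_stratum D F X -> X x -> D x -> tie A c x m ->
  exists nu e, supporting m X nu e.
Proof.
have two y d : kind R d (tie A c y) -> (d < 2)%N -> tie A c y m -> exists k, tie A c y k /\ k != m.
  move=> kd d2 ym; apply: contrapT => none.
  have only k : tie A c y k -> k = m.
    by move=> yk; apply: contrapT => /eqP km; apply: none; exists k.
  case: d kd d2 => [nc _|[|//] [_ [j [k [/eqP jk jy ky]]]] _]; last first.
    by apply: jk; rewrite (only _ jy) (only _ ky).
  apply: nc; exists (const_mx 1 : plane R) => [|j k /only -> /only ->//].
  by apply/eqP => /(congr1 (fun v : plane R => v 0 0)) /eqP; rewrite !mxE oner_eq0.
have face d : face D F d X -> (d < 2)%N -> X x -> tie A c x m -> exists nu e, supporting m X nu e.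
  move=> /(faceP pd HA FE)[y [Dy -> kd]] d2 [Dx e] xm; rewrite -e in kd *.
  have [k [xk km]] := two _ _ kd d2 xm.
  by exists (normal (tie A c x) m), `[< collinear R (tie A c x) >]; apply: SupportFace xm xk km.
case=> [fX|fX|bX] Xx Dx xm; [exact: face fX _ Xx xm|exact: face fX _ Xx xm|].
case: bX => [[v vv XE]|[S [u [u0 SE _]] XE]].
  by have [u ue] := vertex_exposed pd vv; exists u, false; apply: (SupportVertex m vv XE ue).
by exists u, true; apply: (SupportSide m u0); rewrite XE SE.
Qed.

Lemma dot_normal m T a y : T `<=` tie A c a -> T m ->
  dot (normal T m) (y - a) = \sum_(k <- undup A | `[< T k >]) (lf c m y - lf c k y).
Proof.
move=> Ta Tm; have e k : T k -> dot (map_mx intr (m - k)) (y - a) = lf c m y - lf c k y.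
  move=> Tk; rewrite -/(zdot _ _) zdotBl !zdotBr.
  by have := tie_lf (Ta _ Tm) (Ta _ Tk); rewrite /lf; lra.
rewrite /normal; elim/big_rec2: _ => [|k p q /asboolP Tk <-]; first by rewrite dot0l.
by rewrite dotDl e.
Qed.

(** By [dot_normal] this is a sum of nonpositive terms, one for each slope of [T]; a term vanishes
    only if its slope is tied at [y]. *)
Lemma normal_le m T a y : T `<=` tie A c a -> T m -> tie A c y m -> T `<=` [set` A] ->
  dot (normal T m) (y - a) <= 0 /\ (dot (normal T m) (y - a) = 0 -> T `<=` tie A c y).
Proof.
move=> Ta Tm ym TA; rewrite (dot_normal _ Ta)//.
have le k : `[< T k >] -> 0 <= lf c k y - lf c m y.
  by move=> /asboolP/TA kA; rewrite subr_ge0; apply: ym.2.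
have -> : \sum_(k <- undup A | `[< T k >]) (lf c m y - lf c k y) =
    - \sum_(k <- undup A | `[< T k >]) (lf c k y - lf c m y).
  by rewrite -sumrN; apply: eq_bigr => k _; rewrite opprB.
rewrite oppr_le0 sumr_ge0//; split => // /eqP; rewrite oppr_eq0 psumr_eq0// => /allP h k Tk.
have kA := TA _ Tk; have := h k; rewrite mem_undup => /(_ kA); rewrite asboolT//= subr_eq0 => /eqP e.
by split => // l lA; rewrite e; exact: ym.2.
Qed.

Lemma supporting_origin m X nu e a z : supporting m X nu e -> X a -> D° z -> tie A c z = [set m] ->
  0 < dot nu (a - z).
Proof.
move=> [x k Dx XE xm xk km|v u vv XE ue|u u0 XE]; rewrite XE.
- move=> [Da ea] Dz tz.
  have ex : tie A c x `<=` tie A c a by rewrite ea.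
  have zm : tie A c z m by rewrite tz.
  have TA : tie A c x `<=` [set` A] by move=> j [].
  have [le ez] := normal_le ex xm zm TA.
  have -> : a - z = - (z - a) by rewrite opprB.
  rewrite dotNr oppr_gt0 lt_neqAle le andbT; apply/eqP => /ez /(_ k xk).
  by rewrite tz /= => /eqP; rewrite (negPf km).
- move=> -> Dz _; have -> : v - z = - (z - v) by rewrite opprB.
  rewrite dotNr oppr_gt0; apply: ue; first exact: interior_subset.
  by move=> zv; case: (vertex_not_interior vv) => _; rewrite -zv.
- move=> [[Da amax] _] Dz _; rewrite dotBr subr_gt0.
  exact: (interior_dot_lt u0 Dz amax).
Qed.

(** Equality in the supporting inequality puts [b] on the line of the edge or side [X]. Then [Y]
    must be a vertex, since distinct edges and sides of a cell lie on different lines. *)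
Lemma supporting_supports m X Y nu nu' e e' a b z : supporting m X nu e -> supporting m Y nu' e' ->
  X <> Y -> X a -> Y b -> D a -> D b -> tie A c a m -> tie A c b m ->
  supports nu e (a - z) (b - z) e'.
Proof.
move=> sX sY XY Xa Yb Da Db am bm; rewrite /supports.
have -> : b - z - (a - z) = b - a by rewrite opprB addrA subrK.
case: sX Xa => [x k Dx XE xm xk km|v u vv XE ue|u u0 XE].
- rewrite XE => -[Dia ea].
  have ex : tie A c x `<=` tie A c a by rewrite ea.
  have TA : tie A c x `<=` [set` A] by move=> j [].
  have [le ez] := normal_le ex xm bm TA.
  move: le; rewrite le_eqVlt => /predU1P[e0|]; last by left.
  right; have sub := ez e0.
  have [co|nc] := pselect (collinear R (tie A c x)).
    split => //; first exact/asboolP.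
    case: sY Yb => [y l Dy YE ym yl lm|//|u u0 YE].
      rewrite YE => -[Dib eb]; apply/asboolP => co'.
      apply: XY; rewrite XE YE -ea -eb; congr (face_of c _).
      rewrite ea; apply/seteqP; split => // j bj.
      rewrite -ea; rewrite -eb in co'.
      exact: (tie_collinear co' (sub _ xk) (sub _ xm) km (sub _ xk) (sub _ xm) (ex _ xk) (ex _ xm) bj bj).
    (* [b] lies inside a side. The functions tied at [b] are nonnegative and vanish there, so they
       are constant along the side and [k - m] is normal to it. Then [a] and [b] are at the same
       height over the side, yet [a] is interior. *)
    rewrite YE => -[bmax nv].
    have [p [q [t [[Dp Dq pq] [t01 bE upq]]]]] := side_flat bmax nv.
    have nb : ~ D° b by move=> Dib; have := interior_dot_lt u0 Dib (proj2 bmax); rewrite ltxx.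
    have flat j : tie A c x j -> zdot j (p - q) = 0.
      move=> /sub bj; have [jA je] := (tieP pd HA c b j).1 bj.
      have lj w : D w -> 0 <= lf c j w.
        by move=> Dw; apply: le_trans (proj1 (F0 Dw)) _; have [le _] := Fm_min pd HA c w; exact: le.
      have h1 := lj _ Dp; have h2 := lj _ Dq.
      have : lf c j b = 0 by rewrite -je; exact: (proj2 (F0 Db)).
      move: h1 h2; rewrite zdotBr bE /lf zdotDr !zdotZr; case/andP: t01.
      set P := zdot j p; set Q := zdot j q; set C := c j => t0 t1 h1 h2 h3.
      have e1 : t * (C + P) + (1 - t) * (C + Q) = 0 by lra.
      have g1 : 0 <= t * (C + P) by rewrite mulr_ge0// ltW.
      have g2 : 0 <= (1 - t) * (C + Q) by rewrite mulr_ge0// subr_ge0 ltW.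
      have /eqP : t * (C + P) = 0 by lra.
      have /eqP : (1 - t) * (C + Q) = 0 by lra.
      rewrite !mulf_eq0 (gt_eqF t0) subr_eq0 (gt_eqF t1) /= => /eqP z1 /eqP z2; lra.
    have mkflat : dot (map_mx intr (k - m)) (p - q) = 0.
      by rewrite -/(zdot _ _) zdotBl !flat// subrr.
    have pq0 : p - q != 0 by rewrite subr_eq0.
    have [r rE] := cross0_scale u0 (perp_cross pq0 upq mkflat).
    have : zdot (k - m) (a - b) = 0.
      have := tie_lf (ex _ xk) (ex _ xm); have := tie_lf (sub _ xk) (sub _ xm).
      by rewrite /lf zdotBl !zdotBr; lra.
    rewrite /zdot rE dotZl => /eqP; rewrite mulf_eq0 => /orP[/eqP r0|].
      have : map_mx intr (k - m) = 0 :> plane R by rewrite rE r0 scale0r.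
      by move=> /eqP; rewrite map_mx_intr_eq0 subr_eq0 (negPf km).
    by rewrite dotBr subr_eq0 lt_eqF// (interior_dot_lt u0 Dia (proj2 bmax)).
  (* [X] is a vertex: slopes not on a line and tied at both [a] and [b] determine the point. *)
  exfalso; have ba : b = a.
    apply: contrapT => /eqP ba; apply: nc; exists (b - a); first by rewrite subr_eq0.
    move=> i j xi xj; have := tie_lf (ex _ xi) (ex _ xj); have := tie_lf (sub _ xi) (sub _ xj).
    by rewrite /lf !zdotBr; lra.
  rewrite ba in Yb.
  case: sY Yb => [y l Dy YE ym yl lm|v u vv YE ue|u u0 YE]; rewrite YE.
  + by move=> [_ ey]; apply: XY; rewrite XE YE -ea ey.
  + by move=> av; case: (vertex_not_interior vv) => _; rewrite -av.
  + by move=> [[_ amax] _]; have := interior_dot_lt u0 Dia amax; rewrite ltxx.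
- rewrite XE => ->; left; apply: ue => // bv; rewrite bv in Yb.
  case: sY Yb => [y l Dy YE ym yl lm|v' u' vv' YE ue'|u' u0 YE]; rewrite YE.
  + by move=> [Dv _]; case: (vertex_not_interior vv).
  + by move=> vv''; apply: XY; rewrite XE YE vv''.
  + by move=> [_ nv]; exact: nv.
rewrite XE => -[[_ amax] nva].
have := amax _ Db; rewrite -subr_le0 -dotBr le_eqVlt => /predU1P[e0|]; last by left.
right; split => //.
have bmax : maximizers D u b.
  by split => // y /amax; move: e0; rewrite dotBr; lra.
case: sY Yb => [y l Dy YE ym yl lm|//|u' u'0 YE]; rewrite YE.
- by move=> [Dib _]; have := interior_dot_lt u0 Dib (proj2 bmax); rewrite ltxx.
- by move=> [b'max nvb]; case: XY; rewrite XE YE (maximizers_eq pd u0 u'0 bmax b'max nvb).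
Qed.
End Transfer.

(** * Transfer of incidences, cyclic orders and labels *)

Section Transfer2.
Variables (R : realType) (D : set (plane R)) (V : seq (plane R)) (L : seq (lattice * R)) (N : nat).
Hypothesis pd : polygon_data D V L.
Variable A : seq lattice.
Hypothesis HA : slopes L N A.
Variables (c c' : lattice -> R) (F F' : plane R -> R).
Hypothesis FE : forall x, D x -> F x = Fm A c x.
Hypothesis F'E : forall x, D x -> F' x = Fm A c' x.
Hypothesis F0 : forall x, D x -> 0 <= Fm A c x /\ (~ D° x -> Fm A c x = 0).
Hypothesis F'0 : forall x, D x -> 0 <= Fm A c' x /\ (~ D° x -> Fm A c' x = 0).
Hypothesis fam : forall x, D° x -> exists2 z, D° z & tie A c' z = tie A c x.
Hypothesis bnd : forall x, D x -> ~ D° x -> tie A c x = tie A c' x.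
Implicit Types (m k l : lattice) (x y z v w a u nu : plane R) (T : set lattice) (S U W X Y Z : set (plane R)).
Notation face_of := (face_of D A).
Notation corr := (corr D A).

Lemma corr_ex d X : face D F d X -> exists2 X', corr c c' X X' & face D F' d X'.
Proof.
move=> /(faceP pd HA FE)[x [Dx -> kd]]; have [x' Dx' e] := fam Dx.
exists (face_of c' (tie A c' x')); first exact: CorrFace Dx Dx' (esym e) erefl erefl.
by apply/(faceP pd HA F'E); exists x'; rewrite e.
Qed.

Lemma corr_face d X X' : corr c c' X X' -> face D F d X -> exists x x',
  [/\ D° x, D° x', tie A c x = tie A c' x', kind R d (tie A c x) & X = face_of c (tie A c x) /\ X' = face_of c' (tie A c' x')].
Proof.
move=> XX' /(faceP pd HA FE)[y [Dy XE kd]].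
case: XX' => [x x' Dx Dx' e XE' X'E|bX _].
  exists x, x'; split => //; have : X x by rewrite XE'.
  by rewrite XE => -[_ ->].
by have [_] := boundary_face_D bX (eq_ind_r (fun X => X y) (conj Dy erefl) XE); case.
Qed.

Lemma corr_face_image d X X' : corr c c' X X' -> face D F d X -> face D F' d X'.
Proof.
move=> XX' fX; have [x [x' [_ Dx' e kd [_ ->]]]] := corr_face XX' fX.
by apply/(faceP pd HA F'E); exists x'; rewrite -e.
Qed.

Lemma corr_incidence d d' X X' Y Y' : corr c c' X X' -> corr c c' Y Y' -> face D F d X -> face D F d' Y ->
  X `<=` closure Y -> X' `<=` closure Y'.
Proof.
move=> XX' YY' /(corr_face XX')[x [x' [Dx Dx' ex _ [-> ->]]]] /(corr_face YY')[y [y' [Dy Dy' ey _ [-> ->]]]].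
exact: (corr_closure pd HA Dx Dx' Dy Dy' ex ey).
Qed.

Lemma corr_boundary_incidence d X X' B : corr c c' X X' -> face D F d X -> boundary_face D B ->
  B `&` closure X !=set0 -> B `&` closure X' !=set0.
Proof.
move=> XX' /(corr_face XX')[x [x' [Dx Dx' ex _ [-> ->]]]] bB [b [Bb cb]].
have [_ nb] := boundary_face_D bB Bb; exists b; split => //.
exact: (corr_boundary_closure pd HA bnd Dx Dx' ex nb cb).
Qed.

Lemma corr_cyclic_at v v' X X' Y Y' Z Z' : corr c c' [set v] [set v'] ->
  corr c c' X X' -> corr c c' Y Y' -> corr c c' Z Z' ->
  cyclic_at v X Y Z -> cyclic_at v' X' Y' Z'.
Proof.
move=> vv XX YY ZZ [[XY YZ ZX] [a [b [d [da db dd abd]]]]].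
have sp : same_point D A c c' v v'.
  case: vv => [x x' Dx Dx' e vE v'E|bv ve]; [left|right].
    have [Dv tv] : face_of c (tie A c x) v by rewrite -vE.
    have [Dv' tv'] : face_of c' (tie A c' x') v' by rewrite -v'E.
    by rewrite tv tv'.
  have [Dv nv] := boundary_face_D bv erefl.
  by split => //; have : [set v'] v' by []; rewrite ve.
split.
  by split=> e; [apply: XY|apply: YZ|apply: ZX]; [move: YY|move: ZZ|move: XX]; rewrite -e; exact: corr_inj.
by exists a, b, d; split => //; [move: da|move: db|move: dd]; exact: (corr_direction pd HA bnd sp).
Qed.

Lemma supporting_corr m X X' nu e : supporting D A c m X nu e -> corr c c' X X' ->
  supporting D A c' m X' nu e.
Proof.
move=> sX XX'; case: sX XX' => [x k Dx XE xm xk km|v u vv XE ue|u u0 XE].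
- case=> [y y' Dy Dy' ey XE' X'E|bX _]; last first.
    have Xx : X x by rewrite XE.
    by have [_] := boundary_face_D bX Xx; case.
  have e' : tie A c x = tie A c' y'.
    rewrite -ey; have : X x by rewrite XE.
    by rewrite XE' => -[_ ->].
  rewrite e' in xm xk *; exact: SupportFace Dy' X'E xm xk km.
- have Xb : boundary_face D X by left; exists v.
  case=> [y y' Dy Dy' ey XE' X'E|_ ->]; last exact: (SupportVertex A c' m vv XE ue).
  have Xy : X y by rewrite XE'.
  by have [_] := boundary_face_D Xb Xy; case.
case=> [y y' Dy Dy' ey XE' X'E|_ ->]; last exact: (SupportSide A c' m u0 XE).
have : X y by rewrite XE'.
by rewrite XE => -[[_ ymax] _]; have := interior_dot_lt u0 Dy ymax; rewrite ltxx.
Qed.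

Lemma corr_point U U' X X' a : corr c c' U U' -> face D F 2 U -> corr c c' X X' ->
  X a -> closure U a -> exists2 a', X' a' & closure U' a'.
Proof.
move=> UU' /(corr_face UU')[y [y' [Dy Dy' ey _ [-> ->]]]] XX' Xa cUa.
case: XX' => [x x' Dx Dx' ex XE X'E|bX ->].
  exists x'; first by rewrite X'E.
  apply/(closure_face pd HA c' (interior_subset Dx') Dy'); rewrite -ey -ex.
  have [Da <-] : face_of c (tie A c x) a by rewrite -XE.
  exact/(closure_face pd HA c (interior_subset Da) Dy).
exists a => //; have [Da na] := boundary_face_D bX Xa.
exact: (corr_boundary_closure pd HA bnd Dy Dy' ey na cUa).
Qed.

(** The points witnessing the order cannot be carried over; but points and base point chosen on
    either side are ordered like the outer normals, which both sides share by [supporting_corr]. *)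
Lemma corr_cyclic_along U U' X X' Y Y' Z Z' : corr c c' U U' -> face D F 2 U ->
  corr c c' X X' -> corr c c' Y Y' -> corr c c' Z Z' ->
  low_stratum D F X -> low_stratum D F Y -> low_stratum D F Z ->
  cyclic_along U X Y Z -> cyclic_along U' X' Y' Z'.
Proof.
move=> UU' fU XX YY ZZ lX lY lZ [[XY YZ ZX] [p [a [b [d [Uo [Xa Ua] [Yb Ub] [Zd Ud] abd]]]]]].
have [a' X'a' Ua'] := corr_point UU' fU XX Xa Ua.
have [b' Y'b' Ub'] := corr_point UU' fU YY Yb Ub.
have [d' Z'd' Ud'] := corr_point UU' fU ZZ Zd Ud.
have neq S S' W W' : corr c c' S S' -> corr c c' W W' -> S <> W -> S' <> W'.
  by move=> SS WW SW e; apply: SW; move: WW; rewrite -e; exact: corr_inj.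
have X'Y' := neq _ _ _ _ XX YY XY; have Y'Z' := neq _ _ _ _ YY ZZ YZ; have Z'X' := neq _ _ _ _ ZZ XX ZX.
have [x [x' [Dx Dx' ex [m xm] [UE U'E]]]] := corr_face UU' fU.
rewrite UE in Uo Ua Ub Ud; rewrite U'E in Ua' Ub' Ud'.
have mem w : closure (face_of c (tie A c x)) w -> D w /\ tie A c w m.
  move=> cw; have Dw := closure_face_D pd cw; split => //.
  by have := (closure_face pd HA c Dw Dx).1 cw; rewrite xm; apply.
have mem' w : closure (face_of c' (tie A c' x')) w -> D w /\ tie A c' w m.
  move=> cw; have Dw := closure_face_D pd cw; split => //.
  by have := (closure_face pd HA c' Dw Dx').1 cw; rewrite -ex xm; apply.
have [Da ma] := mem _ Ua; have [Db mb] := mem _ Ub; have [Dd md] := mem _ Ud.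
have [Da' ma'] := mem' _ Ua'; have [Db' mb'] := mem' _ Ub'; have [Dd' md'] := mem' _ Ud'.
have [na [ea sX]] := supporting_ex pd HA FE lX Xa Da ma.
have [nb [eb sY]] := supporting_ex pd HA FE lY Yb Db mb.
have [nd [ed sZ]] := supporting_ex pd HA FE lZ Zd Dd md.
have sX' := supporting_corr sX XX; have sY' := supporting_corr sY YY; have sZ' := supporting_corr sZ ZZ.
case: Uo => Doo; rewrite xm => to.
have x'm : tie A c' x' = [set m] by rewrite -ex.
have XZ := nesym ZX; have YX := nesym XY; have ZY := nesym YZ.
have X'Z' := nesym Z'X'; have Y'X' := nesym X'Y'; have Z'Y' := nesym Y'Z'.
have ss := supporting_supports pd HA F0 p.
have ss' := supporting_supports pd HA F'0 x'.
have h := ccw_normals (supporting_origin sX Xa Doo to) (supporting_origin sY Yb Doo to) (supporting_origin sZ Zd Doo to)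
  (ss _ _ _ _ _ _ _ _ _ sX sY XY Xa Yb Da Db ma mb) (ss _ _ _ _ _ _ _ _ _ sX sZ XZ Xa Zd Da Dd ma md)
  (ss _ _ _ _ _ _ _ _ _ sY sX YX Yb Xa Db Da mb ma) (ss _ _ _ _ _ _ _ _ _ sY sZ YZ Yb Zd Db Dd mb md)
  (ss _ _ _ _ _ _ _ _ _ sZ sX ZX Zd Xa Dd Da md ma) (ss _ _ _ _ _ _ _ _ _ sZ sY ZY Zd Yb Dd Db md mb).
have h' := ccw_normals (supporting_origin sX' X'a' Dx' x'm) (supporting_origin sY' Y'b' Dx' x'm) (supporting_origin sZ' Z'd' Dx' x'm)
  (ss' _ _ _ _ _ _ _ _ _ sX' sY' X'Y' X'a' Y'b' Da' Db' ma' mb') (ss' _ _ _ _ _ _ _ _ _ sX' sZ' X'Z' X'a' Z'd' Da' Dd' ma' md')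
  (ss' _ _ _ _ _ _ _ _ _ sY' sX' Y'X' Y'b' X'a' Db' Da' mb' ma') (ss' _ _ _ _ _ _ _ _ _ sY' sZ' Y'Z' Y'b' Z'd' Db' Dd' mb' md')
  (ss' _ _ _ _ _ _ _ _ _ sZ' sX' Z'X' Z'd' X'a' Dd' Da' md' ma') (ss' _ _ _ _ _ _ _ _ _ sZ' sY' Z'Y' Z'd' Y'b' Dd' Db' md' mb').
split => //; exists x', a', b', d'; split; rewrite ?U'E//.
by apply/h'/h.
Qed.

Lemma corr_gradient U U' m : corr c c' U U' -> face D F 2 U -> has_gradient F U m -> has_gradient F' U' m.
Proof.
move=> UU' fU; have [x [x' [Dx Dx' ex [k xk] [UE U'E]]]] := corr_face UU' fU.
have x'k : tie A c' x' = [set k] by rewrite -ex.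
rewrite UE U'E xk x'k => /(has_gradientP pd HA FE) mk.
by apply/(has_gradientP pd HA F'E); [exists x'|apply: mk; exists x].
Qed.

Lemma corr_weight e e' (w : nat) : corr c c' e e' -> face D F 1 e -> edge_weight D F e w -> edge_weight D F' e' w.
Proof.
move=> ee' fe [U0 [U1 [m0 [m1 [n [[L0 L1 U01 e0 e1] [g0 g1 pn w0 mE]]]]]]].
have [U0' c0 L0'] := corr_ex (L0 : face D F 2 U0); have [U1' c1 L1'] := corr_ex (L1 : face D F 2 U1).
exists U0', U1', m0, m1, n; split; split => //.
- by move=> ee; apply: U01; move: c1; rewrite -ee; exact: corr_inj.
- exact: (corr_incidence ee' c0 fe (L0 : face D F 2 U0)).
- exact: (corr_incidence ee' c1 fe (L1 : face D F 2 U1)).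
- exact: (corr_gradient c0 L0).
- exact: (corr_gradient c1 L1).
Qed.
End Transfer2.

Lemma corr_sym (R : realType) (D : set (plane R)) A c c' X X' : corr D A c c' X X' -> corr D A c' c X' X.
Proof.
case=> [x x' Dx Dx' e XE X'E|bX ->]; last exact: CorrBoundary.
exact: CorrFace Dx' Dx (esym e) X'E XE.
Qed.

(** * The isomorphism of marked types *)

Section TypeIso.
Variables (R : realType) (D : set (plane R)) (V : seq (plane R)) (L : seq (lattice * R)) (N : nat).
Hypothesis pd : polygon_data D V L.
Variable A : seq lattice.
Hypothesis HA : slopes L N A.
Variables (c c' : lattice -> R) (F F' : plane R -> R).
Hypothesis FE : forall x, D x -> F x = Fm A c x.
Hypothesis F'E : forall x, D x -> F' x = Fm A c' x.
Hypothesis F0 : forall x, D x -> 0 <= Fm A c x /\ (~ D° x -> Fm A c x = 0).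
Hypothesis F'0 : forall x, D x -> 0 <= Fm A c' x /\ (~ D° x -> Fm A c' x = 0).
Hypothesis fam : forall x, D° x -> exists2 z, D° z & tie A c' z = tie A c x.
Hypothesis fam' : forall x, D° x -> exists2 z, D° z & tie A c z = tie A c' x.
Hypothesis bnd : forall x, D x -> ~ D° x -> tie A c x = tie A c' x.
Implicit Types (X Y Z U B : set (plane R)) (P Q : config R N).

Let bnd' x : D x -> ~ D° x -> tie A c' x = tie A c x.
Proof. by move=> Dx nx; rewrite bnd. Qed.

(** One formula serves all strata: interior points are matched by their tie sets and boundary points
    are kept. *)
Definition tie_image X : set (plane R) :=
  [set y | (D° y /\ exists x, [/\ X x, D° x & tie A c' y = tie A c x]) \/ (X y /\ ~ D° y)].

Lemma tie_image_corr X : stratum D F X -> corr D A c c' X (tie_image X).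
Proof.
case=> [[d /(faceP pd HA FE)[x [Dx -> kd]]]|bX].
  have [x' Dx' e] := fam Dx; apply: (CorrFace Dx Dx' (esym e)) => //.
  apply/seteqP; split => y.
    move=> [[Dy [z [[_ tz] _ tyz]]]|[[Dy _] nDy]]; last by case: nDy.
    by split; rewrite // tyz tz e.
  by move=> [Dy ty]; left; split => //; exists x; split; rewrite // ty e.
apply: CorrBoundary => //; apply/seteqP; split => y.
  by move=> [[Dy [z [/(boundary_face_D bX)[_ nz] Dz _]]]|[]].
by move=> By; right; split => //; have [] := boundary_face_D bX By.
Qed.

Lemma tie_image_iso P Q : (forall i, D° (row i P)) -> (forall i, D° (row i Q)) ->
  (forall i, tie A c (row i P) = tie A c' (row i Q)) -> type_iso D F P F' Q tie_image.
Proof.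
move=> DP DQ mark.
have sf d X : face D F d X -> stratum D F X by move=> fX; left; exists d.
have sl X : low_stratum D F X -> stratum D F X.
  by case=> [fX|fX|bX]; [left; exists 0%N|left; exists 1%N|right].
have low' X : low_stratum D F X -> low_stratum D F' (tie_image X).
  move=> lX; have co := tie_image_corr (sl _ lX).
  case: lX => [fX|fX|bX].
  - by apply: Or31; exact: (corr_face_image pd HA FE F'E co fX).
  - by apply: Or32; exact: (corr_face_image pd HA FE F'E co fX).
  - apply: Or33; case: co => [x x' Dx _ _ XE _|_ -> //].
    by have [_] := boundary_face_D bX (eq_ind_r (fun X => X x) (conj Dx erefl) XE); case.
have img d X : face D F d X -> face D F' d (tie_image X).
  by move=> fX; exact: (corr_face_image pd HA FE F'E (tie_image_corr (sf _ _ fX)) fX).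
have cs X := @corr_sym R D A c c' X (tie_image X).
split.
- move=> d; split.
  + by move=> X fX; exact: img fX.
  + move=> X Y /set_mem fX /set_mem fY e.
    have := tie_image_corr (sf _ _ fY); rewrite -e; exact: corr_inj (tie_image_corr (sf _ _ fX)).
  + move=> Y fY; have [X YX fX] := corr_ex pd HA F'E FE fam' fY.
    exists X => //; have co := tie_image_corr (sf _ _ fX).
    exact: (corr_inj (corr_sym co) YX).
- move=> B bB; case: (tie_image_corr (or_intror bB : stratum D F B)) => // x x' Dx _ _ XE _.
  by have [_] := boundary_face_D bB (eq_ind_r (fun X => X x) (conj Dx erefl) XE); case.
- move=> d d' X Y fX fY; have cX := tie_image_corr (sf _ _ fX); have cY := tie_image_corr (sf _ _ fY).
  split; first exact: (corr_incidence pd HA FE cX cY fX fY).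
  exact: (corr_incidence pd HA F'E (cs _ cX) (cs _ cY) (img _ _ fX) (img _ _ fY)).
- move=> d X B fX bB; have cX := tie_image_corr (sf _ _ fX).
  split; first exact: (corr_boundary_incidence pd HA FE bnd cX fX bB).
  exact: (corr_boundary_incidence pd HA F'E bnd' (cs _ cX) (img _ _ fX) bB).
- move=> v v' X Y Z sv ve sX sY sZ.
  have cv := tie_image_corr sv; rewrite ve in cv.
  have cX := tie_image_corr sX; have cY := tie_image_corr sY; have cZ := tie_image_corr sZ.
  split; first exact: (corr_cyclic_at pd HA bnd cv cX cY cZ).
  exact: (corr_cyclic_at pd HA bnd' (corr_sym cv) (cs _ cX) (cs _ cY) (cs _ cZ)).
- move=> U X Y Z fU lX lY lZ; have cU := tie_image_corr (sf _ _ fU).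
  have cX := tie_image_corr (sl _ lX); have cY := tie_image_corr (sl _ lY); have cZ := tie_image_corr (sl _ lZ).
  split; first exact: (corr_cyclic_along pd HA FE F0 F'0 bnd cU fU cX cY cZ lX lY lZ).
  exact: (corr_cyclic_along pd HA F'E F'0 F0 bnd' (cs _ cU) (img _ _ fU) (cs _ cX) (cs _ cY) (cs _ cZ)
    (low' _ lX) (low' _ lY) (low' _ lZ)).
- move=> U m fU; have cU := tie_image_corr (sf _ _ fU).
  split; first exact: (corr_gradient pd HA FE F'E cU fU).
  exact: (corr_gradient pd HA F'E FE (cs _ cU) (img _ _ fU)).
- move=> e w fe; have ce := tie_image_corr (sf _ _ fe).
  split; first exact: (corr_weight pd HA FE F'E fam ce fe).
  exact: (corr_weight pd HA F'E FE fam' (cs _ ce) (img _ _ fe)).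
- move=> i d X fX.
  have [x [x' [Dx Dx' ex _ [XE ->]]]] := corr_face pd HA FE (tie_image_corr (sf _ _ fX)) fX.
  rewrite {1}XE /face_of /= -ex mark; split => -[_ e]; split => //.
Qed.
End TypeIso.

(** * Null sets *)

Section Null.
Variables (R : realType) (m n : nat).
Implicit Types (S : set 'M[R]_(m.+1, n.+1)).
Local Open Scope ereal_scope.

(** The sizes are successors so that a degenerate box, used to pad finite covers, has volume 0; over
    an empty index range the volume would be the empty product 1. *)
Definition null_set S := forall e : R, (0 < e)%R -> exists a b : nat -> 'M[R]_(m.+1, n.+1),
  [/\ forall k i j, (a k i j <= b k i j)%R, S `<=` \bigcup_k box (a k) (b k) &
      \sum_(k <oo) (box_volume (a k) (b k))%:E <= e%:E].

Lemma box_volume_ge0 (a b : 'M[R]_(m.+1, n.+1)) : (forall i j, (a i j <= b i j)%R) -> (0 <= box_volume a b)%R.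
Proof. by move=> ab; apply: prodr_ge0 => i _; apply: prodr_ge0 => j _; rewrite subr_ge0. Qed.

Lemma null_set_outer S : null_set S -> lebesgue_outer S = 0.
Proof.
move=> h; apply/eqP; rewrite eq_le; apply/andP; split.
  apply/lee_addgt0Pr => e e0; rewrite add0e.
  have [a [b [ab cov le]]] := h e e0; apply: le_trans le.
  by apply: ereal_inf_lbound; exists a, b.
apply: le_ereal_inf_tmp => _ [a [b [ab _ ->]]].
by apply: nneseries_ge0 => k _ _; rewrite lee_fin box_volume_ge0.
Qed.

Lemma null_set_sub S S' : S `<=` S' -> null_set S' -> null_set S.
Proof.
move=> sub h e e0; have [a [b [ab cov le]]] := h e e0.
by exists a, b; split => //; exact: subset_trans cov.
Qed.

(** The [k]-th set gets a cover of volume at most [e / 2 ^ k.+1], and the double sequence of boxes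
    is enumerated by a bijection of [nat] with pairs. *)
Lemma null_set_bigcup (S : nat -> set 'M[R]_(m.+1, n.+1)) : (forall k, null_set (S k)) ->
  null_set (\bigcup_k S k).
Proof.
move=> Snull e e0.
have ek k : (0 < e / (2 ^ k.+1)%:R)%R by rewrite divr_gt0// ltr0n expn_gt0.
pose W k (ab : (nat -> 'M[R]_(m.+1, n.+1)) * (nat -> 'M[R]_(m.+1, n.+1))) :=
  [/\ forall l i j, (ab.1 l i j <= ab.2 l i j)%R, S k `<=` \bigcup_l box (ab.1 l) (ab.2 l) &
      \sum_(l <oo) (box_volume (ab.1 l) (ab.2 l))%:E <= (e / (2 ^ k.+1)%:R)%:E].
have [G GW] : {G & forall k, W k (G k)}.
  apply: (@choice _ _ W) => k; have [a [b abW]] := Snull k _ (ek k).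
  by exists (a, b).
have /card_esym/ppcard_eqP[f] := card_nat2.
pose vol (p : nat * nat) := (box_volume ((G p.1).1 p.2) ((G p.1).2 p.2))%:E.
have vol0 p : 0 <= vol p by rewrite lee_fin box_volume_ge0//; have [h _ _] := GW p.1; exact: h.
exists (fun k => (G (f k).1).1 (f k).2), (fun k => (G (f k).1).2 (f k).2); split.
- by move=> k i j; have [h _ _] := GW (f k).1; exact: h.
- move=> x [k _ Skx]; have [_ cov _] := GW k; have [l _ xl] := cov _ Skx.
  by exists (f^-1%FUN (k, l)) => //=; rewrite invK ?inE.
rewrite (_ : \sum_(k <oo) _ = \sum_(i <oo) \sum_(j <oo) vol (i, j)).
  apply: le_trans (epsilon_trick0 xpredT (ltW e0)).
  by apply: lee_nneseries => [k _ _|k _]; [exact: nneseries_ge0|have [_ _] := GW k].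
rewrite nneseries_esumT => [|k]; last exact: vol0.
rewrite -(reindex_esum setT setT f vol) => //.
rewrite nneseries_esumT => [|k]; last by apply: nneseries_ge0 => l _ _; exact: vol0.
under [RHS]eq_esum => i _ do rewrite nneseries_esumT//.
rewrite esum_esum => [|i j _ _]; last exact: vol0.
rewrite (_ : setT `*`` (fun=> setT) = setT); last by apply/seteqP; split.
by apply: eq_esum => -[].
Qed.

Lemma finite_cover (I : finType) (a b : I -> 'M[R]_(m.+1, n.+1)) S (e : R) :
  (forall i j l, (a i j l <= b i j l)%R) -> S `<=` \bigcup_i box (a i) (b i) ->
  (\sum_i box_volume (a i) (b i) <= e)%R ->
  exists a' b' : nat -> 'M[R]_(m.+1, n.+1), [/\ forall k i j, (a' k i j <= b' k i j)%R,
    S `<=` \bigcup_k box (a' k) (b' k) & \sum_(k <oo) (box_volume (a' k) (b' k))%:E <= e%:E].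
Proof.
move=> ab cov le.
pose A k := nth (0%R : 'M[R]_(m.+1, n.+1)) [seq a i | i <- enum I] k.
pose B k := nth (0%R : 'M[R]_(m.+1, n.+1)) [seq b i | i <- enum I] k.
have sA : size [seq a i | i <- enum I] = #|I| by rewrite size_map cardE.
have sB : size [seq b i | i <- enum I] = #|I| by rewrite size_map cardE.
have AE i : A (enum_rank i) = a i.
  rewrite /A (nth_map i) ?nth_enum_rank// -cardE; exact: ltn_ord.
have BE i : B (enum_rank i) = b i.
  rewrite /B (nth_map i) ?nth_enum_rank// -cardE; exact: ltn_ord.
have AB k i j : (A k i j <= B k i j)%R.
  have [kI|kI] := ltnP k #|I|.
    by have := ab (enum_val (Ordinal kI)) i j; rewrite -AE -BE enum_valK.
  by rewrite /A /B !nth_default ?sA ?sB.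
exists A, B; split => //.
  by move=> x /cov[i _ xi]; exists (enum_rank i) => //; rewrite AE BE.
rewrite (@nneseries_split _ _ 0 #|I|) => [|k _]; last by rewrite lee_fin box_volume_ge0.
rewrite add0n [X in _ + X](_ : _ = 0); last first.
  apply: eseries0 => k /= kI _; rewrite /A /B !nth_default ?sA ?sB//.
  by rewrite /box_volume big_ord_recl big_ord_recl !mxE subrr !mul0r.
rewrite adde0 sumEFin lee_fin; apply: le_trans le.
rewrite big_mkord (reindex (@enum_rank I)) /=; last first.
  by apply: onW_bij; exact: enum_rank_bij.
by apply: ler_sum => i _; rewrite AE BE.
Qed.
End Null.

(** * Bounded pieces of hyperplanes are null *)

Section Hyperplane.
Variables (R : realType) (m n : nat).
Local Notation I := ('I_m.+1 * 'I_n.+1)%type.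
Implicit Types (K : I -> R) (P : 'M[R]_(m.+1, n.+1)).

(** Cut the range of every coordinate except [i0] into [n'] intervals of length [d]. Over each cell,
    the equation confines coordinate [i0] to an interval of length [2 * C * d]; the [n' ^ M] boxes
    have total volume [T / n']. *)
Lemma hyperplane_null K (q B : R) : (exists i, K i != 0) ->
  null_set [set P | (forall i j, `|P i j| < B) /\ \sum_(i : I) K i * P i.1 i.2 = q].
Proof.
move=> [i0 Ki0] e e0.
have [B0|B0] := leP B 0.
  have [|||a' [b' h]] := @finite_cover R m n void (fun i => match i with end) (fun i => match i with end)
    [set P | (forall i j, `|P i j| < B) /\ \sum_(i : I) K i * P i.1 i.2 = q] e.
  - by case.
  - by move=> P [/(_ 0 0) /(le_lt_trans (normr_ge0 _))]; rewrite ltNge B0.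
  - by rewrite big1 ?(ltW e0)// => -[].
  by exists a', b'.
pose C := \sum_(i : I) `|K i| / `|K i0|.
have C0 : 0 <= C by apply: sumr_ge0 => i _; rewrite divr_ge0.
pose M := #|predC1 i0|.
pose T := (2 * B) ^+ M * (2 * C * (2 * B)).
have B2 : 0 <= 2 * B by lra.
have T0 : 0 <= T by apply: mulr_ge0; [exact: exprn_ge0|apply: mulr_ge0 => //; exact: mulr_ge0].
pose n' := (Num.truncn (T / e)).+1.
have n'0 : 0 < n'%:R :> R by rewrite ltr0n.
have n'T : T / n'%:R <= e.
  rewrite ler_pdivrMr// mulrC -ler_pdivrMr// ltW//.
  by rewrite /n'; exact: truncnS_gt.
pose d := 2 * B / n'%:R.
have d0 : 0 < d by rewrite divr_gt0// mulr_gt0.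
(* Cell indices, pinned to [ord0] at [i0] so that there are [n' ^ M] of them. *)
pose J := {f : {ffun I -> 'I_n'} | f \in pffun_on ord0 (predC1 i0) predT}.
pose lo (f : J) (i : I) : R := - B + d * (val f i)%:R.
pose x0 (f : J) := (q - \sum_(i | i != i0) K i * lo f i) / K i0.
pose a (f : J) : 'M[R]_(m.+1, n.+1) := \matrix_(i, j) (if (i, j) == i0 then x0 f - C * d else lo f (i, j)).
pose b (f : J) : 'M[R]_(m.+1, n.+1) := \matrix_(i, j) (if (i, j) == i0 then x0 f + C * d else lo f (i, j) + d).
have Cd : 0 <= C * d by rewrite mulr_ge0// ltW.
apply: (@finite_cover R m n J a b).
- by move=> f i j; rewrite !mxE; case: ifP => _; [lra|rewrite lerDl ltW].
- move=> P [PB Pq].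
  pose g : {ffun I -> 'I_n'} := [ffun i => if i == i0 then ord0 else inord (Num.truncn ((P i.1 i.2 + B) / d))].
  have gJ : g \in pffun_on ord0 (predC1 i0) predT.
    apply/pffun_onP; split => //; apply/fintype.subsetP => i; rewrite !inE ffunE.
    by have [_|//] := eqVneq i i0; rewrite eqxx.
  have lt i : (Num.truncn ((P i.1 i.2 + B) / d) < n')%N.
    have := PB i.1 i.2; rewrite ltr_norml => /andP[p1 p2].
    have t0 : 0 <= (P i.1 i.2 + B) / d by rewrite divr_ge0 ?(ltW d0)//; lra.
    rewrite -(ltr_nat R); have /andP[le _] := truncn_itv t0; apply: le_lt_trans le _.
    rewrite ltr_pdivrMr// /d mulrC divfK ?gt_eqF//; lra.
  have itv i : i != i0 -> lo (exist _ g gJ) i <= P i.1 i.2 <= lo (exist _ g gJ) i + d.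
    move=> ii0; rewrite /lo /= ffunE (negPf ii0) inordK//.
    have := PB i.1 i.2; rewrite ltr_norml => /andP[p1 p2].
    have t0 : 0 <= (P i.1 i.2 + B) / d by rewrite divr_ge0 ?(ltW d0)//; lra.
    have /andP[] := truncn_itv t0; rewrite ler_pdivlMr// ltr_pdivrMr// -natr1.
    by set t := (Num.truncn _)%:R; rewrite [d * _]mulrC; lra.
  exists (exist _ g gJ) => // i j; rewrite !mxE; case: ifPn => [/eqP ij|ij]; last exact: (itv (i, j)).
  set f := exist _ g gJ in itv *.
  have Pi0 : P i j = (q - \sum_(k | k != i0) K k * P k.1 k.2) / K i0.
    rewrite -Pq (bigD1 i0)//= addrK mulrC mulKf//.
    by rewrite -ij.
  have h : `|P i j - x0 f| <= C * d.
    have sw (s1 s2 : R) : (q - s1) / K i0 - (q - s2) / K i0 = (s2 - s1) / K i0 by ring.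
    rewrite Pi0 /x0 sw -sumrB.
    rewrite normrM (eq_bigr (fun k => K k * (lo f k - P k.1 k.2))); last by move=> k _; rewrite mulrBr.
    rewrite normfV ler_pdivrMr ?normr_gt0//.
    apply: le_trans (ler_norm_sum _ _ _) _.
    apply: (@le_trans _ _ (\sum_(k | k != i0) `|K k| * d)).
      apply: ler_sum => k ki0; rewrite normrM ler_wpM2l// ler_norml.
      by have /andP[] := itv k ki0; lra.
    rewrite /C !mulr_suml [leRHS](bigD1 i0)//=; apply: ler_wpDl.
      by rewrite !mulr_ge0// ltW.
    by apply: ler_sum => k _; rewrite mulrAC divfK ?normr_eq0.
  by move: h; rewrite ler_norml => /andP[]; lra.
have volE f : box_volume (a f) (b f) = d ^+ M * (2 * C * d).
  rewrite /box_volume pair_bigA /= (bigD1 i0)//= mulrC; congr (_ * _).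
    rewrite (eq_bigr (fun=> d)) ?prodr_const//.
    by move=> i ii0; rewrite !mxE -surjective_pairing (negPf ii0); ring.
  by rewrite !mxE -surjective_pairing eqxx; ring.
rewrite (eq_bigr _ (fun f _ => volE f)) sumr_const.
have -> : #|{: J}| = (n' ^ M)%N.
  by rewrite card_sig card_pffun_on card_ord.
rewrite -[_ *+ _]mulr_natl natrX.
apply: le_trans n'T; rewrite le_eqVlt; apply/orP; left; apply/eqP.
have dn : n'%:R * d = 2 * B by rewrite /d mulrC divfK// gt_eqF.
by rewrite mulrA -exprMn dn /T /d; field; rewrite gt_eqF.
Qed.
End Hyperplane.

(** * Universal genericity *)

Section StronglyGeneric.
Variables (R : realType) (N : nat) (Omega : set (plane R)).
Implicit Types (P Q : config R N) (D : set (plane R)).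

(** The line of a side passes through a rational vertex, so a point on it satisfies a rational
    affine relation. *)
Lemma generic_interior D V L P : polygon_data D V L -> generic P -> (forall i, D (row i P)) ->
  forall i, D° (row i P).
Proof.
move=> pd gP DP i; apply/(pd_Li pd) => s sL.
have a0 := (pd_L pd _).1 (DP i) s sL; rewrite lt_neqAle a0 andbT.
apply/eqP => e0; have s0 := pd_n0 pd sL; move/eqP: s0; apply.
have [v vV ve] : exists2 v, v \in V & af s v = 0.
  apply: contrapT => none; have [x Dx sx] := pd_touch pd sL.
  have : 0 < s.2 + zdot s.1 x.
    apply: (pd_pos pd) Dx => v vV; have v0 := (pd_L pd _).1 (pd_V pd vV) s sL.
    rewrite lt_neqAle -/(af s v) v0 andbT.
    by apply/eqP => e; apply: none; exists v.
  by rewrite -/(af s x) sx ltxx.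
apply: (@generic_qspan R N P finset.set0 i s.1 gP); first by rewrite inE.
have [q qE] := pd_rat pd vV 0; have [q' q'E] := pd_rat pd vV 1.
have -> : zdot s.1 (row i P) = ratr ((s.1 0 0)%:~R * q + (s.1 0 1)%:~R * q').
  rewrite rmorphD !rmorphM /= !ratr_int -qE -q'E -zdotE.
  by move: ve e0; rewrite /af; lra.
exact: qspan_rat.
Qed.

Lemma tie_pair_collinear (T : set lattice) m k : (forall l, T l <-> l = m \/ l = k) -> m != k -> collinear R T.
Proof.
move=> TE mk; pose p : plane R := map_mx intr (m - k).
have p0 : p != 0 by rewrite map_mx_intr_eq0 subr_eq0.
exists (rot p); first exact: rot_neq0.
have e : zdot m (rot p) = zdot k (rot p).
  by apply/eqP; rewrite -subr_eq0 -zdotBl -[zdot _ _]/(dot p (rot p)) dot_rot.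
by move=> i j /TE[->|->] /TE[->|->].
Qed.

Lemma generic_strongly_generic D P : rational_polygon_in Omega D -> generic P ->
  (forall i, D (row i P)) -> (forall i j, i != j -> row i P <> row j P) -> strongly_generic D P.
Proof.
move=> ratD gP DP neq; have [V [L pd]] := polygon_dataP ratD.
have {}DP := generic_interior pd gP DP.
have [A HA] := slopes_ex L N.
have [c cmin] := minimal_coef_ex pd HA DP.
have [ct [ct_fix ct_cont ct_tie]] := deformation_ex pd gP cmin.
have FE x := relaxation_minimal pd HA DP cmin (x := x).
have pair := tie_pair pd gP cmin.
have F0 x (Dx : D x) := admissible_Fm pd HA (proj1 cmin) Dx.
split.
- by split.
- move=> i; exists (face_of D A c (tie A c (row i P))); last by split.
  apply/(faceP pd HA FE); exists (row i P); split => //.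
  have [m [k [mk tE]]] := pair i; split; first exact: tie_pair_collinear tE mk.
  by exists m, k; split => //; apply/tE; [left|right].
(* Two points on one edge share its tied slopes [m] and [k], so [zdot (m - k)] takes equal values at
   them, which is a relation. *)
- move=> i j e ij /(faceP pd HA FE)[x [Dx -> _]] [_ ei] [_ ej].
  have [m [k [/eqP mk tE]]] := pair i; apply: mk.
  have im : tie A c (row i P) m by apply/tE; left.
  have ik : tie A c (row i P) k by apply/tE; right.
  have jm : tie A c (row j P) m by rewrite ej -ei.
  have jk : tie A c (row j P) k by rewrite ej -ei.
  apply/eqP; rewrite -subr_eq0; apply/eqP.
  apply: (@generic_qspan R N P [set j]%SET i _ gP); first by rewrite inE.
  have -> : zdot (m - k) (row i P) = zdot (m - k) (row j P).
    have := tie_lf im ik; have := tie_lf jm jk; rewrite /lf !zdotBl; lra.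
  by apply: qspan_dot; rewrite inE.
have n1 := near_interior pd DP.
have n2 := deform_minimal pd cmin ct_fix ct_cont ct_tie.
have n3 := near_nontie ct_cont.
have n4 := near_free pd ct_cont.
have n5 := tie_families pd HA gP cmin ct_fix ct_cont.
apply: filterS3 (filterI n1 n2) (filterI n3 n4) n5 => Q [DQ Qmin] [Qtie Qfree] Qfam.
have F'E x := relaxation_minimal pd HA DQ Qmin (x := x).
have F'0 x (Dx : D x) := admissible_Fm pd HA (proj1 Qmin) Dx.
exists (tie_image D A c (ct Q)).
apply: (tie_image_iso pd HA FE F'E F0 F'0) => //.
- by move=> x /Qfam[].
- by move=> x /Qfam[].
(* A function tied at a boundary point vanishes there, so its slope is fixed and its coefficient is
   the same for [P] and [Q]. *)
- move=> x Dx nx.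
  have z1 := (F0 x Dx).2 nx; have z2 := (F'0 x Dx).2 nx.
  apply/seteqP; split => m /(tieP pd HA)[mA me]; apply/(tieP pd HA); split => //.
    rewrite z2 /lf ct_fix; first by rewrite -z1.
    apply/negP => /(free_slopesP D A c m)[_ /(_ x Dx)]; rewrite -me z1 ltxx //.
  have mB : m \notin free_slopes D A c.
    by apply/negP => mB; have := Qfree m mB x Dx; rewrite -me z2 ltxx.
  by rewrite z1 -z2 me /lf ct_fix.
- by move=> i; rewrite (deform_tie cmin ct_tie Qtie).
Qed.

Lemma generic_universal P : generic P -> Conf Omega P -> universally_generic Omega P.
Proof.
move=> gP [OP neq] D ratD; have [DP|/existsNP nD] := pselect (forall i, D (row i P)).
  by left; exact: (generic_strongly_generic ratD).
by right.
Qed.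
End StronglyGeneric.

(** * Permutation invariance *)

Section Permutation.
Variables (R : realType) (N : nat).
Implicit Types (P Q : config R N) (D Omega : set (plane R)) (s : 'S_N).

Lemma row_row_perm s P i : row i (row_perm s P) = row (s i) P.
Proof. by apply/rowP => j; rewrite !mxE. Qed.

Lemma points_row_perm s P : points (row_perm s P) = points P.
Proof.
apply/seteqP; split => x [i _ <-]; first by exists (s i) => //; rewrite row_row_perm.
by exists ((s^-1)%g i) => //; rewrite row_row_perm permKV.
Qed.

Lemma mx_norm_le m n (M : 'M[R]_(m, n)) (r : R) : 0 <= r -> (forall i j, `|M i j| <= r) -> `|M| <= r.
Proof.
move=> r0 h; rewrite [leLHS]/Num.norm/= mx_normrE; apply/bigmax_leP; split => // -[i j] _ /=; exact: h.
Qed.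

Lemma continuous_row_perm s : continuous (row_perm s : config R N -> config R N).
Proof.
move=> P A /nbhs_ballP[e /= e0 eA].
apply/nbhs_ballP; exists e => //= Q [_ PQ]; apply: eA; split => // i j.
by rewrite !mxE; exact: PQ.
Qed.

Lemma Conf_row_perm D s P : Conf D P -> Conf D (row_perm s P).
Proof.
move=> [DP neq]; split => [i|i j ij]; rewrite !row_row_perm; first exact: DP.
by apply: neq; apply: contra ij => /eqP/perm_inj ->.
Qed.

(** The relaxation depends only on the set of points, so the same [phi] works and only the marking
    clause is reindexed. *)
Lemma same_type_row_perm D s P Q : same_type D P (row_perm (s^-1)%g Q) -> same_type D (row_perm s P) Q.
Proof.
rewrite /same_type !points_row_perm => -[phi [h1 h2 h3 h4 h5 h6 h7 h8 h9]].
exists phi; split => // i d X fX; rewrite row_row_perm.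
by have := h9 (s i) d X fX; rewrite row_row_perm permK.
Qed.

Lemma strongly_generic_row_perm D s P : strongly_generic D P -> strongly_generic D (row_perm s P).
Proof.
move=> [cP one two near_type]; split; rewrite ?points_row_perm.
- exact: Conf_row_perm.
- by move=> i; have [e fe ei] := one (s i); exists e; rewrite ?row_row_perm.
- move=> i j e ij fe; rewrite !row_row_perm; apply: two => //.
  by apply: contra ij => /eqP/perm_inj ->.
- have e : row_perm (s^-1)%g (row_perm s P) = P.
    by apply/row_matrixP => i; rewrite !row_row_perm permKV.
  have := @continuous_row_perm (s^-1)%g (row_perm s P) _; rewrite e => /(_ _ near_type).
  by apply: (@filterS _ (nbhs (row_perm s P))) => Q /same_type_row_perm.
Qed.

Lemma universally_generic_row_perm Omega : permutation_invariant (@universally_generic R N Omega).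
Proof.
move=> s P uP D ratD; case: (uP D ratD) => [sP|[cP [i nDi]]]; first by left; exact: strongly_generic_row_perm.
right; split; first exact: Conf_row_perm.
by exists ((s^-1)%g i); rewrite row_row_perm permKV.
Qed.
End Permutation.

(** * Residuality and full measure *)

Section Residual.
Variables (R : realType) (Omega : set (plane R)).
Hypothesis O0 : Omega° !=set0.
Implicit Types (D : set (plane R)) (x y : plane R).

(** Needed for [universally_generic_Conf]: an intersection over an empty family would not be
    contained in [Conf Omega]. A small triangle with rational corners near an interior point
    works. *)
Lemma rational_polygon_ex : exists D, rational_polygon_in Omega D.
Proof.
have [x Ox] := O0.
have [r r0 rO] : exists2 r, 0 < r & forall y, `|x - y| < r -> Omega y.
  have : nbhs x Omega := Ox.
  by rewrite -filter_from_ballE => -[r /= r0 rO]; exists r => // y xy; apply: rO; rewrite mx_norm_ball.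
(* The corner is offset from [x], and the legs are bounded, by less than [r / 4] in each coordinate,
   so the triangle stays within [r / 2] of [x]. *)
have r4 : 0 < r / 4 by rewrite divr_gt0.
have rat_near t : exists q : rat, t < ratr q < t + r / 4.
  have [|q] := @rat_in_itvoo R t (t + r / 4); first by rewrite ltrDl.
  by rewrite in_itv /=; exists q.
have [a ax] := rat_near (x 0 0); have [b bx] := rat_near (x 0 1); have [d d0] := rat_near 0.
rewrite add0r in d0; set dR : R := ratr d in d0.
have dp : 0 < dR by case/andP: d0.
pose pt (u v : rat) : plane R := \row_j (if j == 0 then ratr u else ratr v).
pose p (i : 'I_3) : plane R := if i == 0 then pt a b else if i == 1 then pt (a + d) b else pt a (b + d).
pose D := [set x | exists t : 'I_3 -> R, [/\ forall i, 0 <= t i, \sum_i t i = 1 & x = \sum_i t i *: p i]].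
have prat i j : exists q : rat, p i 0 j = ratr q.
  rewrite /p /pt; case: ifP => _; [|case: ifP => _]; rewrite mxE; case: ifP => _; by eexists.
have pnear i j : `|x 0 j - p i 0 j| <= r / 2.
  rewrite /p /pt ler_norml; case/andP: ax => ax1 ax2; case/andP: bx => bx1 bx2; case/andP: d0 => d1 d2.
  by case: (ord2P j) => ->; case: ifP => _; [|case: ifP => _| |case: ifP => _];
    rewrite !mxE /= ?rmorphD /= -?/dR; lra.
exists D; split.
- by exists 3%N, p.
- exists (\row_j (if j == 0 then ratr a + dR / 3 else ratr b + dR / 3)).
  have c0 : continuous (fun y : plane R => y 0 0 - ratr a).
    by move=> y; apply: (@cvgB _ _ _ (nbhs y)); [exact: coord_continuous|exact: cvg_cst].
  have c1 : continuous (fun y : plane R => y 0 1 - ratr b).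
    by move=> y; apply: (@cvgB _ _ _ (nbhs y)); [exact: coord_continuous|exact: cvg_cst].
  have c2 : continuous (fun y : plane R => dR - (y 0 0 - ratr a) - (y 0 1 - ratr b)).
    move=> y; apply: (@cvgB _ _ _ (nbhs y)); last exact: c1.
    by apply: (@cvgB _ _ _ (nbhs y)); [exact: cvg_cst|exact: c0].
  rewrite /interior /=.
  have n0 := @near_gt0 R (plane R) _ _ (c0 (\row_j (if j == 0 then ratr a + dR / 3 else ratr b + dR / 3))).
  have n1 := @near_gt0 R (plane R) _ _ (c1 (\row_j (if j == 0 then ratr a + dR / 3 else ratr b + dR / 3))).
  have n2 := @near_gt0 R (plane R) _ _ (c2 (\row_j (if j == 0 then ratr a + dR / 3 else ratr b + dR / 3))).
  rewrite !mxE /= in n0 n1 n2.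
  have {}n0 := n0 ltac:(lra); have {}n1 := n1 ltac:(lra); have {}n2 := n2 ltac:(lra).
  apply: filterS3 n0 n1 n2 => y y0 y1 y2.
  exists (fun i => if i == 0 then (dR - (y 0 0 - ratr a) - (y 0 1 - ratr b)) / dR else
    if i == 1 then (y 0 0 - ratr a) / dR else (y 0 1 - ratr b) / dR).
  have dn : dR != 0 by rewrite gt_eqF.
  split.
  + by move=> i; case: ifP => _; [|case: ifP => _]; rewrite divr_ge0// ltW.
  + by rewrite !big_ord_recl big_ord0 /=; field.
  + rewrite !big_ord_recl big_ord0 /p /pt /=; apply/plane_eq; rewrite !mxE /= !rmorphD /= -/dR; by field.
- move=> y [t [t0 t1 yE]]; apply: rO; apply: (@le_lt_trans _ _ (r / 2)); last by lra.
  apply: mx_norm_le => [|k j]; first by rewrite ltW// divr_gt0.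
  have -> : (x - y) k j = \sum_i t i * (x 0 j - p i 0 j).
    rewrite (ord1 k) yE !mxE summxE -[X in X - _ = _]mul1r -t1 mulr_suml -sumrB.
    by apply: eq_bigr => i _; rewrite mxE mulrBr.
  apply: le_trans (ler_norm_sum _ _ _) _.
  have -> : r / 2 = \sum_i t i * (r / 2) by rewrite -mulr_suml t1 mul1r.
  by apply: ler_sum => i _; rewrite normrM (ger0_norm (t0 i)); apply: ler_wpM2l.
- move=> v; rewrite /D -hull_setT => /hull_vertex[i ->] j; exact: prat.
Qed.

Lemma universally_generic_Conf N (P : config R N) : universally_generic Omega P -> Conf Omega P.
Proof.
have [D ratD] := rational_polygon_ex; have [_ _ DO _] := ratD.
by move=> /(_ D ratD)[[[DP neq] _ _ _]|[]//]; split => // i; exact: (DO _ (interior_subset (DP i))).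
Qed.
End Residual.

Section Avoid.
Variables (R : realType) (N : nat).
Implicit Types (P Q : config R N) (K : 'M[int]_(N, 2)) (q : int) (Omega : set (plane R)).

Lemma continuous_row i : continuous (fun P : config R N => row i P).
Proof.
move=> P A /nbhs_ballP[e /= e0 eA].
apply/nbhs_ballP; exists e => //= Q [_ PQ]; apply: eA; split => // a b.
by rewrite !mxE; exact: PQ.
Qed.

Lemma near_Conf Omega P : open Omega -> Conf Omega P -> \forall Q \near P, Conf Omega Q.
Proof.
move=> Oo [OP neq].
have nO : \forall Q \near P, forall i, i \in enum 'I_N -> Omega (row i Q).
  apply: (@near_all _ (nbhs P) _ _ _ (fun i Q => Omega (row i Q))) => i _.
  exact: (continuous_row (open_nbhs_nbhs (conj Oo (OP i)))).
have nN : \forall Q \near P, forall ij, ij \in [seq ij <- enum {: 'I_N * 'I_N} | ij.1 != ij.2] ->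
    row ij.1 Q <> row ij.2 Q.
  apply: (@near_all _ (nbhs P) _ _ _ (fun ij Q => row ij.1 Q <> row ij.2 Q)) => -[i j].
  rewrite mem_filter => /andP[/= ij _].
  have dc : {for P, continuous (fun Q => row i Q - row j Q)}.
    by apply: (@cvgB _ _ _ (nbhs P)); exact: continuous_row.
  have d0 : row i P - row j P != 0 by rewrite subr_eq0; apply/eqP; exact: neq.
  have h := @cvgr_neq0 _ _ _ (nbhs P) (nbhs_filter P) _ _ dc d0.
  by apply: (@filterS _ (nbhs P) _ _ _ _ h) => Q /= hQ; apply/eqP; rewrite -subr_eq0.
apply: (@filterS2 _ (nbhs P) _ _ _ _ _ nO nN) => Q h1 h2; split => [i|i j ij].
  by apply: h1; rewrite mem_enum.
by apply: (h2 (i, j)); rewrite mem_filter ij mem_enum.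
Qed.

(** Relations are enumerated through their codes; a code that decodes to nothing, or to [K = 0],
    imposes no condition. *)
Definition avoid (k : nat) : set (config R N) := [set P | forall K q,
  unpickle k = Some (K, q) -> K != 0 -> lin K P != q%:~R].

Lemma continuous_lin K : continuous (lin K : config R N -> R).
Proof. by apply: (@continuous_sum R) => i; exact: continuous_zdot_row. Qed.

Lemma open_avoid k : open (avoid k).
Proof.
rewrite openE => P aP; case u : (unpickle k : option ('M[int]_(N, 2) * int)) => [[K q]|]; last first.
  by apply: filterE => Q K q; rewrite u.
have [K0|K0] := eqVneq K 0.
  by apply: filterE => Q K' q'; rewrite u => -[<- _]; rewrite K0 eqxx.
have d0 : [set x : R | x != q%:~R] (lin K P) := aP _ _ u K0.
have := @continuous_lin K P _ (open_nbhs_nbhs (conj (@open_neq _ (q%:~R : R)) d0)).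
by apply: (@filterS _ (nbhs P)) => Q /= h K' q'; rewrite u => -[<- <-].
Qed.

Lemma lin_shift K P t : lin K (P + t *: map_mx intr K) = lin K P + t * lin K (map_mx intr K).
Proof.
rewrite /lin mulr_sumr -big_split; apply: eq_bigr => i _.
by rewrite linearD linearZ zdotDr zdotZr.
Qed.

Lemma lin_self_gt0 K : K != 0 -> 0 < lin K (map_mx intr K : config R N).
Proof.
move=> K0; have ge0 i : 0 <= zdot (row i K) (row i (map_mx intr K : config R N)).
  by rewrite -map_row /zdot dotE addr_ge0// -expr2 sqr_ge0.
rewrite lt_neqAle eq_sym sumr_ge0 ?andbT// psumr_neq0//.
apply/hasP; have [i Ki] : exists i, row i K != 0.
  apply/existsP; apply: contraNT K0 => /existsPn h; apply/eqP/row_matrixP => i.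
  by rewrite row0; apply/eqP; rewrite -[_ == _]negbK h.
exists i; rewrite ?mem_index_enum //= -map_row.
by apply: dot_gt0; rewrite map_mx_intr_eq0.
Qed.

(** A step [t] along [K] itself changes [lin K] by [t] times a positive number, by [lin_self_gt0],
    so arbitrarily small steps leave the hyperplane. *)
Lemma avoid_dense Omega k : open Omega -> Conf Omega `<=` closure (avoid k `&` Conf Omega).
Proof.
move=> Oo P cP B PB.
case u : (unpickle k : option ('M[int]_(N, 2) * int)) => [[K q]|]; last first.
  exists P; split; last exact: (nbhs_singleton PB).
  by split => // K q; rewrite u.
have [K0|K0] := eqVneq K 0.
  exists P; split; last exact: (nbhs_singleton PB).
  by split => // K' q'; rewrite u => -[<- _]; rewrite K0 eqxx.
have [/eqP lP|lP] := boolP (lin K P == q%:~R); last first.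
  exists P; split; last exact: (nbhs_singleton PB).
  by split => // K' q'; rewrite u => -[<- <-].
have [t [t0 _ [Bt Ct]]] := pos_ex (near_dir (map_mx intr K) (filterI PB (near_Conf Oo cP))).
exists (P + t *: map_mx intr K); split => //; split => // K' q'; rewrite u => -[<- <-] _.
by rewrite lin_shift lP -subr_eq0 addrAC subrr add0r mulf_neq0// gt_eqF// lin_self_gt0.
Qed.

Lemma generic_avoid P : (forall k, avoid k P) -> generic P.
Proof. by move=> h K q; apply: (h (pickle (K, q))); rewrite pickleK. Qed.

Lemma universally_generic_residual Omega : open Omega -> Omega° !=set0 ->
  residual_in (@Conf R N Omega) (@universally_generic R N Omega).
Proof.
move=> Oo O0; split; first by move=> P; exact: universally_generic_Conf.
exists avoid; split; first by move=> k; split; [exact: open_avoid|exact: avoid_dense].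
move=> P h; apply: generic_universal; last exact: (h 0%N I).2.
by apply: generic_avoid => k; exact: (h k I).1.
Qed.
End Avoid.

Lemma lin_double (R : realType) N (K : 'M[int]_(N, 2)) (P : config R N) :
  lin K P = \sum_(i : 'I_N * 'I_2) (K i.1 i.2)%:~R * P i.1 i.2.
Proof.
rewrite -(pair_big xpredT xpredT (fun i j => (K i j)%:~R * P i j)) /=.
by apply: eq_bigr => i _; apply: eq_bigr => j _; rewrite !mxE.
Qed.

(** Boundedness of [Omega] places the complement in countably many bounded pieces of hyperplanes,
    one for each code. *)
Lemma universally_generic_full (R : realType) N (Omega : set (plane R)) : bounded_set Omega ->
  full_measure_in (@Conf R N.+1 Omega) (@universally_generic R N.+1 Omega).
Proof.
move=> Ob; apply: (@null_set_outer R N 1).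
have [B [_ OB]] : exists B : R, 0 < B /\ forall x, Omega x -> `|x| < B.
  by have [B B0 OB] := ex_strict_bound_gt0 Ob; exists B.
apply: (@null_set_sub R N 1 _ (\bigcup_k [set P : config R N.+1 | (forall i j, `|P i j| < B) /\ ~ avoid k P])).
  move=> P [cP nP]; have [k nk] : exists k, ~ avoid k P.
    apply/existsNP => h; apply: nP; apply: generic_universal => //; exact: generic_avoid.
  exists k => //; split => // i j; apply: le_lt_trans (OB _ (cP.1 i)).
  by have := coord_le_norm (row i P) 0 j; rewrite mxE.
apply: (@null_set_bigcup R N 1) => k.
suff [K [q [K0 avK]]] : exists (K : 'M[int]_(N.+1, 2)) (q : int), K != 0 /\ forall P : config R N.+1,
    ~ avoid k P -> lin K P = q%:~R.
  have K0' : exists i : 'I_N.+1 * 'I_2, (K i.1 i.2)%:~R != 0 :> R.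
    apply: contrapT => /forallNP h; move/eqP: K0; apply; apply/matrixP => i j.
    by have /negP := h (i, j); rewrite negbK intr_eq0 mxE => /eqP.
  apply: (@null_set_sub R N 1 _ _ _ (@hyperplane_null R N 1 (fun i => (K i.1 i.2)%:~R) q%:~R B K0')).
  by move=> P [PB /avK]; rewrite lin_double.
have [[K [q [u K0]]]|none] := pselect (exists (K : 'M[int]_(N.+1, 2)) (q : int),
    unpickle k = Some (K, q) /\ K != 0).
  exists K, q; split => // P nP; apply: contrapT => ne; apply: nP => K' q'.
  by rewrite u => -[<- <-] _; apply/eqP.
(* This code imposes no condition, so no configuration fails it and any nonzero relation will do. *)
exists (const_mx 1), 0; split.
  by apply/eqP => /matrixP/(_ 0 0); rewrite !mxE.
move=> P nP; exfalso; apply: nP => K q u K0; exfalso; apply: none; by exists K, q.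
Qed.

Theorem proposition9p4 (R : realType) (Omega : set (plane R))
    (Omega_bounded : bounded_set Omega) (Omega_open : open Omega)
    (Omega_convex : convex_set Omega) (Omega_nonempty : Omega° !=set0)
    (N : nat) (N_ge1 : (1 <= N)%N) :
  [/\ permutation_invariant (@universally_generic R N Omega),
      residual_in (@Conf R N Omega) (@universally_generic R N Omega),
      full_measure_in (@Conf R N Omega) (@universally_generic R N Omega) &
      forall (P : config R N) (D : set (plane R)),
        universally_generic Omega P -> rational_polygon_in Omega D ->
        points P `<=` D° -> strongly_generic D P].
Proof.
split.
- exact: universally_generic_row_perm.
- exact: universally_generic_residual.
- by case: N N_ge1 => // N' _; exact: universally_generic_full.
- move=> P D uP ratD PD; case: (uP D ratD) => // -[_ [i nD]].
  by case: nD; apply: interior_subset; apply: PD; exists i.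
Qed.
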